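(* Let $T>0$, let $[\phi_0,\phi_1]\in H^{1/2}_{w^{-1}}\times L^2(-1,1)$, and let $f:\mathbb{R}\to\mathbb{R}$ be Lipschitz and such that there exists a constant $c>0$ with $|f(x)|\le c|x|$ for all $x\in\mathbb{R}$. Let $\phi\in C((0,T);H^{1/2}_{w^{-1}})$ be the solution of $$\begin{cases}\phi_{tt}+\mathcal{A}\phi=f(\phi), & (t,x)\in(0,T)\times(-1,1),\\ \phi(0,x)=\phi_0(x), & x\in(-1,1),\\ \phi_t(0,x)=\phi_1(x), & x\in(-1,1).\end{cases}$$ If $\phi=0$ in a nonempty open subset $M\subset(0,T)\times(-1,1)$, then $\phi\equiv 0$ in $(0,T)\times(-1,1)$.
   Context: All functions are real-valued. Let $w(x)=\sqrt{1-x^2}$ on $(-1,1)$, $\|v\|_{w^{-1}}^2=\int_{-1}^1 w^{-1}|v|^2dx$, and $L^2_{w^{-1}}$ the corresponding weighted space. $L^2=L^2(-1,1)$, with inner product $(\cdot,\cdot)_{L^2}$. The operator $\mathcal{A}$ is $$\mathcal{A}\phi(x)=\partial_x\left(\frac{\sqrt{1-x^2}}{\pi}\,\mathrm{P.V.}\int_{-1}^{1}\frac{\phi(\xi)}{\sqrt{1-\xi^2}\,(x-\xi)}\,d\xi\right),$$ with $\partial_x$ taken in the sense of distributions on $(-1,1)$. Let $T_n$ be the Chebyshev polynomials of the first kind, $T_n(\cos\theta)=\cos(n\theta)$; they form an orthogonal basis of $L^2_{w^{-1}}$. For $\phi,\psi\in L^2_{w^{-1}}$ with partial sums $\phi_N,\psi_N$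 of their expansions in the $T_n$ (degree at most $N$), the pairing is understood as $(\mathcal{A}\phi,\psi)_{L^2}=\lim_{N\to\infty}\int_{-1}^1(\mathcal{A}\phi_N)\,\psi_N\,dx$. The space $H^{1/2}_{w^{-1}}=H^{1/2}_{w^{-1}}(-1,1)$ is the Hilbert space of $\psi\in L^2$ with $$\|\psi\|^2_{H^{1/2}_{w^{-1}}}:=\|\psi\|_{w^{-1}}^2+(\mathcal{A}\psi,\psi)_{L^2}<\infty.$$ The solution of the Cauchy problem means the (unique) function $\phi$ with $[\phi,\phi_t]\in C([0,T];H^{1/2}_{w^{-1}}\times L^2)$, $\phi(0)=\phi_0$, $\phi_t(0)=\phi_1$, and, for every $\psi\in H^{1/2}_{w^{-1}}$, $\frac{d^2}{dt^2}(\phi(t),\psi)_{L^2}+(\mathcal{A}\phi(t),\psi)_{L^2}=(f(\phi(t)),\psi)_{L^2}$ in the sense of distributions on $(0,T)$. *)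

(* Defs.v *)
From HB Require Import structures.
From mathcomp Require Export all_boot all_order all_algebra.
From mathcomp Require Export all_classical all_reals all_analysis.
Export Order.TTheory GRing.Theory Num.Theory.
Export numFieldNormedType.Exports.

#[export] Set Implicit Arguments.
#[export] Unset Strict Implicit.
#[export] Unset Printing Implicit Defensive.

Open Scope classical_set_scope.
Open Scope ring_scope.

(* Elements of L^2, L^2_{w^-1} and H^{1/2}_{w^-1} are represented by functions
   R -> R. Only their values in Omega = (-1, 1), up to a null set, matter. *)
Definition Omega {R : realType} : set R := `]-1, 1[.

Definition weight {R : realType} (x : R) : R := Num.sqrt (1 - x ^+ 2).

Definition eq_ae_Omega {R : realType} (u v : R -> R) : Prop :=
  {ae @lebesgue_measure R, forall x, Omega x -> u x = v x}.

Definition dotL2 {R : realType} (u v : R -> R) : R :=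
  \int[lebesgue_measure]_(x in Omega) (u x * v x).

Definition sqnormL2 {R : realType} (v : R -> R) : \bar R :=
  \int[lebesgue_measure]_(x in Omega) (v x ^+ 2)%:E.

Definition inL2 {R : realType} (v : R -> R) : Prop :=
  measurable_fun Omega v /\ (sqnormL2 v < +oo)%E.

Definition sqnormW {R : realType} (v : R -> R) : \bar R :=
  \int[lebesgue_measure]_(x in Omega) ((weight x)^-1 * v x ^+ 2)%:E.

Definition dotW {R : realType} (u v : R -> R) : R :=
  \int[lebesgue_measure]_(x in Omega) ((weight x)^-1 * (u x * v x)).

Definition smooth {R : realType} (eta : R -> R) : Prop :=
  forall (n : nat) (x : R), derivable (derive1n n eta) x 1.

Definition test_function {R : realType} (D : set R) (eta : R -> R) : Prop :=
  [/\ smooth eta, compact (closure [set x | eta x != 0])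
    & closure [set x | eta x != 0] `<=` D].

Definition pv_integral {R : realType} (phi : R -> R) (x : R) : R :=
  lim ((\int[lebesgue_measure]_(xi in Omega `&` [set xi | (e < `|x - xi|)%R])
          (phi xi / (weight xi * (x - xi)))) @[e --> 0^'+]).

(* [calA phi] is a distribution on Omega, i.e. a functional on test functions:
   the distributional derivative of (w / pi) P.V. \int ... *)
Definition calA {R : realType} (phi : R -> R) (eta : R -> R) : R :=
  - \int[lebesgue_measure]_(x in Omega)
      (weight x / pi * pv_integral phi x * derive1 eta x).

Definition is_density {R : realType} (D : (R -> R) -> R) (g : R -> R) : Prop :=
  locally_integrable Omega g /\
  forall eta, test_function Omega eta -> D eta = dotL2 g eta.

(* The function a regular distribution is identified with; it is determined up
   to a null set, and arbitrary if the distribution is not regular. *)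
Definition density {R : realType} (D : (R -> R) -> R) : R -> R :=
  get [set g | is_density D g].

(* The Chebyshev polynomial T_n, as a function on [-1, 1]. *)
Definition chebyshevT {R : realType} (n : nat) (x : R) : R :=
  cos (n%:R * acos x).

Definition chebyshev_sum {R : realType} (phi : R -> R) (N : nat) (x : R) : R :=
  \sum_(0 <= n < N.+1)
    dotW phi (chebyshevT n) / dotW (chebyshevT n) (chebyshevT n)
      * chebyshevT n x.

(* The pairing (A phi, psi)_{L^2}. It is extended-real valued, since
   (A psi, psi)_{L^2} = +oo is possible for psi in L^2_{w^-1}. *)
Definition pairA {R : realType} (phi psi : R -> R) : \bar R :=
  lim ((dotL2 (density (calA (chebyshev_sum phi N))) (chebyshev_sum psi N))%:E
         @[N --> \oo]).

Definition sqnormH {R : realType} (psi : R -> R) : \bar R :=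
  (sqnormW psi + pairA psi psi)%E.

Definition inH {R : realType} (psi : R -> R) : Prop :=
  inL2 psi /\ (sqnormH psi < +oo)%E.

(* u \in C([0, T]; X), for a space X with membership predicate [inX] and squared
   norm [sqnormX] *)
Definition continuous_into {R : realType} (inX : (R -> R) -> Prop)
    (sqnormX : (R -> R) -> \bar R) (T : R) (u : R -> R -> R) : Prop :=
  (forall t : R, t \in `[0, T] -> inX (u t)) /\
  (forall s : R, s \in `[0, T] ->
     sqnormX (u t \- u s) @[t --> within `[0, T] (nbhs s)] --> 0%E).

(* u' is the time derivative of u : [0, T] -> L^2 (one-sided at 0 and T) *)
Definition is_time_derivative {R : realType} (T : R) (u u' : R -> R -> R)
    : Prop :=
  forall s : R, s \in `[0, T] ->
    sqnormL2 (fun x => (u t x - u s x) / (t - s) - u' s x)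
      @[t --> within `[0, T] s^'] --> 0%E.

Definition weak_equation {R : realType} (T : R) (f : R -> R)
    (phi : R -> R -> R) : Prop :=
  forall psi, inH psi -> forall eta, test_function (`]0, T[) eta ->
    \int[lebesgue_measure]_(t in `]0, T[) (dotL2 (phi t) psi * derive1n 2 eta t)
    + \int[lebesgue_measure]_(t in `]0, T[) (fine (pairA (phi t) psi) * eta t)
    = \int[lebesgue_measure]_(t in `]0, T[) (dotL2 (f \o phi t) psi * eta t).

Definition is_solution {R : realType} (T : R) (f phi0 phi1 : R -> R)
    (phi : R -> R -> R) : Prop :=
  exists phi_t : R -> R -> R,
    [/\ continuous_into inH sqnormH T phi,
        continuous_into inL2 sqnormL2 T phi_t,
        is_time_derivative T phi phi_t,
        eq_ae_Omega (phi 0) phi0 /\ eq_ae_Omega (phi_t 0) phi1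
      & weak_equation T f phi].

(* phi = 0 in M, for phi a curve of classes of functions of x: for almost every
   t, phi(t) = 0 almost everywhere in the slice {x | (t, x) \in M}. *)
Definition vanishes_on {R : realType} (M : set (R * R)) (phi : R -> R -> R)
    : Prop :=
  {ae @lebesgue_measure R, forall t,
    {ae @lebesgue_measure R, forall x, M (t, x) -> phi t x = 0}}.

(* Main.v *)
Require Import Defs.
From mathcomp Require Import measurable_realfun complex ring lra zify.

(* With x = cos s, the principal value of T_n / w is -(pi / w) sin (n s), so
   A T_n = n T_n / w, and (A u, v) is the diagonal form sum_n n u_n v_n |T_n|^2
   in the Chebyshev coefficients.

   Where phi vanishes on J x I, the weak equation gives (A phi(t), psi) = 0 for
   t in J and psi supported in I. Fix t and let u = phi(t). Testing with the hat
   function of half-width dl centred at s = al yields sum_n c_n cos (n al) = 0,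
   where c_n = n u_n tau_n and tau_n is the n-th coefficient of the hat. The
   integral of u(cos r) over 0 < r < s is the sum of u_0 s and of the series of
   the u_n sin (n s) / n, and it is constant for cos s in I; its second difference
   of step dl is -sum_n c_n sin (n al), which is therefore 0 too. The c_n are
   summable, so sum_n c_n z^n is continuous on the closed disc and vanishes on
   an arc: it is zero. To see this, divide by a power of z, so that the constant
   term is not 0, and multiply finitely many rotates, so that the product
   vanishes on the whole circle, hence at 0. Thus u = 0.

   Finally phi(t) = 0 for t in J propagates to ]0, T[ by an energy estimate at
   the level of L^2, in which |f(x)| <= c |x| bounds the right-hand side. *)

(** * Smooth functions *)

(** On the arc over I, the data say that a function and, through A, a conjugate series both vanish,
    but for u in H^{1/2} neither series need converge there. Both are smoothed by the same
    multiplier tau_n = 2 (1 - cos (n dl)) / n^2, which comes from the hat on one side and from the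
    second difference of an integral on the other. Since |n u_n tau_n| <= n u_n^2 + n tau_n^2 and
    tau_n = O(n^-2), the H^{1/2} bound makes the c_n summable. The price is that tau_n can vanish,
    so dl is chosen anew for each n, with n dl <= pi. Once all modes n >= 1 are zero, the integral
    of u is u_0 s, and its constancy on an arc forces u_0 = 0.

    Uniqueness on the circle is proved for partial sums with explicit errors, so only polynomials
    occur. Completeness of the T_n is needed for step functions alone, which iterates of a cubic
    approximate.

    In time, the solution is known only against a fixed psi. The scalar functions (phi(t), psi) and
    (phi_t(t), psi) are first shown to be differentiable in the classical sense; the energy estimate
    then closes on short time intervals and is iterated. *)

Section Smooth.
Context {R : realType}.
Implicit Types (f g : R -> R) (x : R).

(** The derivative is peeled off next to the function, not outermost as in [derive1n], so that the
    product and chain rules pass through an induction on the order. *)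
Fixpoint Cn (n : nat) (f : R -> R) : Prop :=
  if n is m.+1 then (forall x, derivable f x 1) /\ Cn m (derive1 f) else True.

Lemma smoothP f : smooth f <-> forall n, Cn n f.
Proof.
split=> [sf n|Cf n x].
  elim: n f sf => [//|n IH] f sf; split; first exact: sf 0%N.
  by apply: IH => k x; rewrite -derive1Sn; exact: sf.
elim: n f Cf x => [|n IH] f Cf x; first by have [] := Cf 1%N.
rewrite derive1Sn; apply: IH => k.
by have [] := Cf k.+1.
Qed.

Lemma CnW n f : Cn n.+1 f -> Cn n f.
Proof. by elim: n f => [//|n IH] f [? ?]; split=> //; exact: IH. Qed.

Lemma derive1_eq f (df : R -> R) : (forall x, is_derive x 1 f (df x)) -> derive1 f = df.
Proof. by move=> fdf; apply/funext => x; rewrite derive1E (@derive_val _ _ _ _ _ _ _ (fdf x)). Qed.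

Lemma is_derive_derive1 f x : derivable f x 1 -> is_derive x 1 f (derive1 f x).
Proof. by move=> h; rewrite derive1E; exact: derivableP. Qed.

Lemma CnS_is_derive n f (df : R -> R) :
  (forall x, is_derive x 1 f (df x)) -> Cn n df -> Cn n.+1 f.
Proof. by move=> fdf Cdf; split; [move=> x; case: (fdf x)|rewrite (derive1_eq fdf)]. Qed.

Lemma CnD n f g : Cn n f -> Cn n g -> Cn n (fun x => f x + g x).
Proof.
elim: n f g => [//|n IH] f g [df Cf] [dg Cg].
apply: (@CnS_is_derive _ _ (fun x => derive1 f x + derive1 g x)); last exact: IH.
by move=> x; apply: is_deriveD; exact: is_derive_derive1.
Qed.

Lemma CnM n f g : Cn n f -> Cn n g -> Cn n (fun x => f x * g x).
Proof.
elim: n f g => [//|n IH] f g Cf Cg; have [[df Cf'] [dg Cg']] := (Cf, Cg).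
apply: (@CnS_is_derive _ _ (fun x => f x * derive1 g x + g x * derive1 f x)).
  by move=> x; apply: is_deriveM; exact: is_derive_derive1.
by apply: CnD; apply: IH => //; exact: CnW.
Qed.

Lemma Cn_cst n (c : R) : Cn n (fun=> c).
Proof.
by elim: n c => [//|n IH] c; apply: (@CnS_is_derive _ _ (fun=> 0)).
Qed.

Lemma is_derive_affine (k c x : R) : is_derive x 1 (fun y => k * y + c) k.
Proof. by apply: is_derive_eq; rewrite addr0 /GRing.scale/= mulr1. Qed.

Lemma Cn_affine n f (k c : R) : Cn n f -> Cn n (fun x => f (k * x + c)).
Proof.
elim: n f => [//|n IH] f [df Cf].
have dfa x : is_derive x 1 (fun x => f (k * x + c)) (derive1 f (k * x + c) * k).
  apply: (@is_derive1_comp _ f (fun x => k * x + c)); first exact: is_derive_derive1.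
  exact: is_derive_affine.
apply: (CnS_is_derive dfa); apply: CnM; [exact: IH|exact: Cn_cst].
Qed.

Lemma smoothM f g : smooth f -> smooth g -> smooth (fun x => f x * g x).
Proof. by move=> /smoothP sf /smoothP sg; apply/smoothP => n; exact: CnM. Qed.

Lemma smoothD f g : smooth f -> smooth g -> smooth (fun x => f x + g x).
Proof. by move=> /smoothP sf /smoothP sg; apply/smoothP => n; exact: CnD. Qed.

Lemma smooth_cst (c : R) : smooth (fun=> c).
Proof. by apply/smoothP => n; exact: Cn_cst. Qed.

Lemma smooth_affine f (k c : R) : smooth f -> smooth (fun x => f (k * x + c)).
Proof. by move=> /smoothP sf; apply/smoothP => n; exact: Cn_affine. Qed.

Lemma smooth_is_derive f df : (forall x, is_derive x 1 f (df x)) -> smooth df -> smooth f.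
Proof.
move=> fdf /smoothP sdf; apply/smoothP => -[//|n]; exact: CnS_is_derive fdf _.
Qed.

Lemma smooth_derivable f x : smooth f -> derivable f x 1.
Proof. by move=> /(_ 0%N x). Qed.

Lemma derivable_continuous f x : derivable f x 1 -> {for x, continuous f}.
Proof. by move=> /derivable1_diffP /differentiable_continuous. Qed.

Lemma smooth_continuous f : smooth f -> continuous f.
Proof. by move=> sf x; apply: derivable_continuous; exact: smooth_derivable. Qed.

Lemma smooth_derive1 f : smooth f -> smooth (derive1 f).
Proof. by move=> sf n x; rewrite -derive1Sn; exact: sf. Qed.

Definition flat (p : {poly R}) (x : R) : R :=
  if 0 < x then p.[x^-1] * expR (- x^-1) else 0.

(** One term of the exponential series suffices: exp y >= 1 + y^(n+1) / (n+1)!. *)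
Lemma exprn_expRN n (y : R) : 0 < y -> y ^+ n * expR (- y) <= n.+1`!%:R / y.
Proof.
move=> y0; rewrite ler_pdivlMr// mulrAC -exprSr expRN ler_pdivrMr ?expR_gt0//.
rewrite -ler_pdivrMl ?ltr0n ?fact_gt0//; apply: le_trans (expR_ge1Dxn n (ltW y0)).
by rewrite mulrC lerDr.
Qed.

(** A linear bound is what differentiability at 0 needs: the difference quotient of [flat p] at 0 is
    [flat ('X * p)], which therefore tends to 0. *)
Lemma flat_bound p : exists C, 0 <= C /\ forall x, `|flat p x| <= C * `|x|.
Proof.
exists (\sum_(i < size p) `|p`_i| * i.+1`!%:R); split.
  by apply: sumr_ge0 => i _; rewrite mulr_ge0.
move=> x; rewrite /flat; case: ifPn => x0; last first.
  by rewrite normr0 mulr_ge0// sumr_ge0// => i _; rewrite mulr_ge0.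
rewrite normrM (ger0_norm (expR_ge0 _)) horner_coef mulr_suml.
apply: (@le_trans _ _ ((\sum_(i < size p) `|p`_i| * x^-1 ^+ i) * expR (- x^-1))).
  rewrite ler_wpM2r ?expR_ge0// (le_trans (ler_norm_sum _ _ _))//.
  apply: ler_sum => i _; rewrite normrM (@ger0_norm _ (x^-1 ^+ i)) ?lexx//.
  by rewrite exprn_ge0// invr_ge0 ltW.
rewrite mulr_suml; apply: ler_sum => i _.
rewrite -!mulrA ler_wpM2l// (gtr0_norm x0).
by have := @exprn_expRN i x^-1; rewrite invr_gt0 invrK; exact.
Qed.

Lemma is_derive_flat p x : is_derive x 1 (flat p) (flat ('X^2 * (p - p^`())) x).
Proof.
have [x0|x0|->] := ltgtP x 0.
- rewrite {2}/flat ltNge (ltW x0)/=.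
  apply: near_eq_is_derive (is_derive_cst (0:R) x 1).
  near=> y; rewrite /flat /cst; case: ifPn => // y0; exfalso.
  suff : y < 0 by rewrite ltNge (ltW y0).
  by near: y; exact: lt_nbhsl.
- rewrite {2}/flat x0.
  have xn0 : x != 0 by rewrite gt_eqF.
  have dinv : is_derive x 1 (fun y : R => y^-1) (- x ^- 2).
    have := @is_deriveV _ id x 1 1 xn0 (is_derive_id _ _).
    by rewrite /GRing.scale/= mulr1.
  have d1 := @is_derive1_comp _ (horner p) (fun y : R => y^-1) x _ _ (is_derive_poly p _) dinv.
  have d2 : is_derive x 1 (fun y : R => - y^-1) (x ^- 2).
    by rewrite -[x ^- 2]opprK; exact: is_deriveN.
  have d3 := @is_derive1_comp _ expR (fun y : R => - y^-1) x _ _ (is_derive_expR _) d2.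
  have d4 := @is_deriveM _ _ _ _ x 1 _ _ d1 d3.
  have -> : ('X^2 * (p - p^`())).[x^-1] * expR (- x^-1) =
    (horner p \o (fun y : R => y^-1)) x *: (expR (- x^-1) * x ^- 2) +
    (expR \o (fun y : R => - y^-1)) x *: (p^`().[x^-1] * - x ^- 2).
    rewrite /GRing.scale/= hornerM hornerXn hornerD hornerN; field.
    exact: xn0.
  apply: near_eq_is_derive d4.
  near=> y; rewrite /flat; case: ifPn => //; rewrite -leNgt => y0; exfalso.
  suff : 0 < y by rewrite ltNge y0.
  by near: y; exact: lt_nbhsr.
- rewrite {2}/flat ltxx.
  have [C [C0 hC]] := flat_bound ('X * p).
  have dq : h^-1 *: (flat p (h *: 1 + 0) - flat p 0) @[h --> 0^'] --> (0 : R).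
    apply/cvgr0Pnorm_le => e e0; near=> h.
    have hn0 : h != 0 by near: h; exact: nbhs_dnbhs_neq.
    have -> : h^-1 *: (flat p (h *: 1 + 0) - flat p 0) = flat ('X * p) h.
      rewrite /GRing.scale/= mulr1 addr0 /flat ltxx subr0; case: ifPn => _; last by rewrite mulr0.
      by rewrite hornerM hornerX mulrA.
    rewrite (le_trans (hC h))//.
    have : `|h| <= e / (C + 1).
      by near: h; apply: dnbhs0_le; rewrite divr_gt0// ltr_wpDl.
    rewrite ler_pdivlMr ?ltr_wpDl// => /(le_trans _); apply.
    by rewrite mulrC ler_wpM2l// lerDl.
  have cv : cvg (h^-1 *: (flat p (h *: 1 + 0) - flat p 0) @[h --> 0^']) by apply: cvgP dq.
  apply: DeriveDef.
    exact: cv.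
  by rewrite /derive; exact/cvg_lim.
Unshelve. all: by end_near. Qed.

Lemma smooth_flat p : smooth (flat p).
Proof.
apply/smoothP => n; elim: n p => [//|n IH] p.
by apply: CnS_is_derive; [exact: is_derive_flat|exact: IH].
Qed.

End Smooth.

Notation mset D := (measurable (D : set (measurableTypeR _))).
Notation mfun D f := (measurable_fun (D : set (measurableTypeR _)) f).

(** * Integration on the line *)

Section Integration.
Context {R : realType}.
Implicit Types (f g : R -> R) (D : set R).
Local Notation mu := (@lebesgue_measure R).

Definition intg D (f : R -> R) : Prop := mu.-integrable D (EFin \o f).

Lemma intg_measurable D f : intg D f -> mfun D f.
Proof. by move=> /measurable_int /measurable_EFinP. Qed.

Lemma le_intg D f g : mset D -> mfun D f -> intg D g ->
  (forall x, D x -> `|f x| <= g x) -> intg D f.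
Proof.
move=> mD mf ig fg; apply: (le_integrable mD _ _ ig); first exact/measurable_EFinP.
by move=> x Dx /=; rewrite lee_fin (le_trans (fg x Dx))// ler_norm.
Qed.

Lemma eq_intg D f g : mset D -> (forall x, D x -> f x = g x) -> intg D f -> intg D g.
Proof.
by move=> mD fg; apply: eq_integrable => // x; rewrite inE => Dx /=; rewrite fg.
Qed.

Lemma intgD D f g : mset D -> intg D f -> intg D g -> intg D (fun x => f x + g x).
Proof. by move=> mD fi gi; have := integrableD mD fi gi. Qed.

Lemma intgB D f g : mset D -> intg D f -> intg D g -> intg D (fun x => f x - g x).
Proof. by move=> mD fi gi; have := integrableB mD fi gi. Qed.

Lemma intgZ D (k : R) f : mset D -> intg D f -> intg D (fun x => k * f x).
Proof. by move=> mD fi; have := integrableZl mD k fi. Qed.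

Lemma intgN D f : mset D -> intg D f -> intg D (fun x => - f x).
Proof.
move=> mD /(intgZ (-1) mD); apply: eq_intg => // x _; by rewrite mulN1r.
Qed.

Lemma intg_norm D f : intg D f -> intg D (fun x => `|f x|).
Proof. by move=> fi; have := integrable_abse fi. Qed.

Lemma intg_sum D (I : Type) (s : seq I) (h : I -> R -> R) : mset D ->
  (forall i, intg D (h i)) -> intg D (fun x => \sum_(i <- s) h i x).
Proof.
move=> mD hi; elim: s => [|i s IH].
  apply: (@eq_intg _ (fun=> 0)) => //; first by move=> x _; rewrite big_nil.
  by have := integrable0 mu D.
by apply: eq_intg (intgD mD (hi i) IH) => // x _; rewrite big_cons.
Qed.

Lemma Rintegral_sum D (I : Type) (s : seq I) (h : I -> R -> R) : mset D ->
  (forall i, intg D (h i)) ->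
  \int[mu]_(x in D) (\sum_(i <- s) h i x) = \sum_(i <- s) \int[mu]_(x in D) h i x.
Proof.
move=> mD hi; elim: s => [|i s IH].
  rewrite big_nil; under eq_Rintegral do rewrite big_nil.
  by rewrite Rintegral_cst// mul0r.
rewrite big_cons -IH -RintegralD//; [|exact: hi|exact: intg_sum].
by apply: eq_Rintegral => x _; rewrite big_cons.
Qed.

Lemma intgM_bounded D f g (M : R) : mset D -> mfun D f ->
  (forall x, D x -> `|f x| <= M) -> intg D g -> intg D (fun x => f x * g x).
Proof.
move=> mD mf fM ig; apply: (@le_intg _ _ (fun x => M * `|g x|)) => //.
- by apply: measurable_funM => //; exact: intg_measurable.
- by apply: intgZ => //; exact: intg_norm.
- by move=> x Dx; rewrite normrM ler_wpM2r// fM.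
Qed.

Lemma intg_segment f (a b : R) : {within `[a, b], continuous f} -> intg `[a, b] f.
Proof. by move=> cf; apply: continuous_compact_integrable => //; exact: segment_compact. Qed.

Lemma intgS D E f : mset D -> mset E -> E `<=` D -> intg D f -> intg E f.
Proof. by move=> mD mE ED; exact: integrableS. Qed.

Lemma aeS (P Q : R -> Prop) : (forall x, P x -> Q x) ->
  {ae mu, forall x, P x} -> {ae mu, forall x, Q x}.
Proof. by move=> PQ; apply: (@filterS _ _ (ae_filter_ringOfSetsType mu)) => x; exact: PQ. Qed.

Lemma Rdominated D (f_ : nat -> R -> R) f g : mset D ->
  (forall n, mfun D (f_ n)) -> mfun D f -> intg D g ->
  {ae mu, forall x, D x -> f_ n x @[n --> \oo] --> f x} ->
  (forall n x, D x -> `|f_ n x| <= g x) ->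
  (\int[mu]_(x in D) f_ n x) @[n --> \oo] --> \int[mu]_(x in D) f x.
Proof.
move=> mD mfn mf ig cvf fg.
have [||||intf _ cv] := @dominated_convergence _ _ _ mu D mD (fun n => EFin \o f_ n)
    (EFin \o f) (EFin \o g) _ _ _ ig.
- by move=> n; exact/measurable_EFinP.
- exact/measurable_EFinP.
- by apply: aeS cvf => x /[apply] h; apply: cvg_EFin => //; exact: nearW.
- by apply: aeW => x n Dx; rewrite lee_fin; exact: fg.
rewrite /Rintegral; apply: fine_cvg.
rewrite fineK; last exact: integrable_fin_num.
exact: cv.
Qed.

(** Lebesgue differentiation: almost everywhere [f] is the derivative of its primitive, which is
    constantly 0. *)
Lemma ae_eq0_of_itv f (c d : R) : intg `[c, d] f ->
  (forall x, x \in `]c, d[ -> \int[mu]_(t in `[c, x]) f t = 0) ->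
  {ae mu, forall x, x \in `]c, d[ -> f x = 0}.
Proof.
(* [FTC1] asks for integrability up to every right end, even beyond [d]; extending [f] by 0 outside
   the segment provides it. *)
move=> fi f0; have lf : forall y, mu.-integrable [set` Interval (BLeft c) (BRight y)] (EFin \o f \_ `[c, d]).
  move=> y; rewrite -restrict_EFin; apply/integrable_restrict => //.
  apply: integrableS fi => //; exact: measurableI.
have := FTC1 lf (integrable_locally _ fi) => h.
apply: aeS (h _) => // x + xcd.
have [cx xd] : c < x /\ x < d by move: xcd; rewrite in_itv => /andP.
move=> /(_ _)[|_]; first exact: cx.
rewrite patchE mem_set; last by rewrite /= in_itv/= !ltW.
move=> <-.
rewrite derive1E; rewrite -(@near_eq_derive R _ _ (cst 0)) ?derive_cst//.
near=> y; rewrite /cst -{1}(f0 y) ?in_itv/=; last first.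
  apply/andP; split; near: y; [exact: lt_nbhsr|exact: lt_nbhsl].
have yd : y < d by near: y; exact: lt_nbhsl.
apply: eq_Rintegral => t; rewrite inE/= in_itv/= => /andP[ct ty].
by rewrite patchE mem_set//= in_itv/= ct (le_trans ty)// ltW.
Unshelve. all: by end_near. Qed.

Lemma RintegralN D f : mset D -> intg D f ->
  \int[mu]_(x in D) (- f x) = - \int[mu]_(x in D) f x.
Proof.
move=> mD fi; rewrite -mulN1r -RintegralZl//.
by apply: eq_Rintegral => x _; rewrite mulN1r.
Qed.

Lemma Rintegral_itv_bnd f (a b : R) (b0 b1 : bool) : mfun `]a, b[ f ->
  \int[mu]_(x in [set` Interval (BSide b0 a) (BSide b1 b)]) f x = \int[mu]_(x in `]a, b[) f x.
Proof.
move=> mf; rewrite /Rintegral integral_itv_bndoo//; exact/measurable_EFinP.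
Qed.

End Integration.

(** * Smooth bumps and test functions *)

Section Bump.
Context {R : realType}.
Implicit Types (f g : R -> R) (D : set R).
Local Notation mu := (@lebesgue_measure R).

(** The parameter [k] is the steepness: as it grows, the bump tends to 1 on []a, b[], so bumps stand
    in for indicators. The arguments are written as affine functions to fit [smooth_affine]. *)
Definition bump (a b k x : R) := flat 1 (k * x - k * a) * flat 1 (- k * x + k * b).

Lemma bumpE a b k x : bump a b k x = flat 1 (k * (x - a)) * flat 1 (k * (b - x)).
Proof. by congr (flat 1 _ * flat 1 _); ring. Qed.

Lemma flat1_ge0 (y : R) : 0 <= flat 1 y.
Proof. by rewrite /flat; case: ifP => // _; rewrite hornerC mul1r expR_ge0. Qed.

Lemma flat1_le1 (y : R) : flat 1 y <= 1.
Proof.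
rewrite /flat; case: ifP => // y0; rewrite hornerC mul1r -expR0 ler_expR.
by rewrite lerNl oppr0 invr_ge0 ltW.
Qed.

Lemma flat1_eq0 (y : R) : y <= 0 -> flat 1 y = 0.
Proof. by rewrite /flat ltNge => ->. Qed.

Lemma smooth_bump a b k : smooth (bump a b k).
Proof. by apply: smoothM; apply: smooth_affine; exact: smooth_flat. Qed.

Lemma bump_ge0 a b k x : 0 <= bump a b k x.
Proof. by rewrite mulr_ge0// flat1_ge0. Qed.

Lemma bump_le1 a b k x : bump a b k x <= 1.
Proof. by rewrite -[1]mulr1 ler_pM ?flat1_ge0 ?flat1_le1. Qed.

Lemma bump_eq0 a b k x : 0 <= k -> ~~ (a < x < b) -> bump a b k x = 0.
Proof.
move=> k0; rewrite negb_and -!leNgt bumpE => /orP[xa|bx].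
  by rewrite [flat 1 (k * (x - a))]flat1_eq0 ?mul0r// mulr_ge0_le0// subr_le0.
by rewrite mulrC [flat 1 (k * (b - x))]flat1_eq0 ?mul0r// mulr_ge0_le0// subr_le0.
Qed.

Lemma test_function_sub D a b f : smooth f -> `[a, b] `<=` D ->
  (forall x, ~~ (a <= x <= b) -> f x = 0) -> test_function D f.
Proof.
move=> sf abD f0.
have sub : closure [set x | f x != 0] `<=` `[a, b].
  have /closure_id -> : closed (`[a, b]%classic : set R) by exact: interval_closed.
  apply: closure_subset => x /=; rewrite in_itv/=; apply: contraNT => /f0 ->.
  by rewrite eqxx.
split=> //; last exact: subset_trans abD.
apply: (subclosed_compact _ (@segment_compact _ a b) sub); exact: closed_closure.
Qed.

Lemma test_bump D a b k : 0 <= k -> `[a, b] `<=` D -> test_function D (bump a b k).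
Proof.
move=> k0 abD; apply: (@test_function_sub _ a b) => //; first exact: smooth_bump.
move=> x xab; apply: bump_eq0 => //; apply: contra xab => /andP[? ?].
by rewrite !ltW.
Qed.

Lemma cvg_flat1 (c : R) : 0 < c -> flat 1 (n.+1%:R * c) @[n --> \oo] --> (1 : R).
Proof.
move=> c0.
have -> : (fun n => flat 1 (n.+1%:R * c)) = (fun n => expR (- (n.+1%:R^-1 * c^-1))).
  by apply/funext => n; rewrite /flat mulr_gt0// hornerC mul1r invfM.
rewrite -[X in _ --> X]expR0; apply: continuous_cvg; first exact: continuous_expR.
rewrite -[X in _ --> X]oppr0; apply: cvgN; rewrite -[X in _ --> X](mul0r c^-1).
by apply: cvgMl; exact: cvg_harmonic.
Qed.

Lemma cvg_bump a b x : a < x < b -> bump a b n.+1%:R x @[n --> \oo] --> (1 : R).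
Proof.
move=> /andP[ax xb].
have -> : (fun n => bump a b n.+1%:R x) =
   (fun n => flat 1 (n.+1%:R * (x - a)) * flat 1 (n.+1%:R * (b - x))).
  by apply/funext => n; rewrite bumpE.
by rewrite -[X in _ --> X](mulr1 1); apply: cvgM; apply: cvg_flat1; rewrite subr_gt0.
Qed.

Lemma continuous_mfun D f : continuous f -> mset D -> mfun D f.
Proof.
move=> cf mD; apply: (@measurable_funS _ _ _ _ setT) => //.
exact: continuous_measurable_fun.
Qed.

Lemma Rintegral_supp D E f : E `<=` D -> (forall x, D x -> ~ E x -> f x = 0) ->
  \int[mu]_(x in D) f x = \int[mu]_(x in E) f x.
Proof.
move=> ED f0; rewrite [LHS]Rintegral_mkcond [RHS]Rintegral_mkcond.
congr (Rintegral _ _ _); apply/funext => x; rewrite !patchE.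
have [Ex|Ex] := pselect (E x); first by rewrite !mem_set//; exact: ED.
rewrite [x \in E]memNset//; case: ifPn => //; rewrite inE => Dx; exact: f0.
Qed.

(** Dominated convergence along [k = n.+1]: the bumps are between 0 and 1 and tend to the indicator
    of the open interval. *)
Lemma itv_integral_eq0_of_bump f (a b : R) : intg `[a, b] f ->
  (forall k, 0 < k -> \int[mu]_(x in `[a, b]) (f x * bump a b k x) = 0) ->
  \int[mu]_(x in `[a, b]) f x = 0.
Proof.
move=> fi f0.
have mf := intg_measurable fi.
have mb k : mfun `[a, b] (bump a b k).
  by apply: continuous_mfun => //; by apply: smooth_continuous; exact: smooth_bump.
have h : (\int[mu]_(x in `]a, b[) (f x * bump a b n.+1%:R x)) @[n --> \oo] -->
   \int[mu]_(x in `]a, b[) f x.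
  have sub : `]a, b[ `<=` `[a, b] by exact: subset_itv_oo_cc.
  have fi' : intg `]a, b[ f by exact: intgS fi.
  apply: (@Rdominated _ _ _ _ (fun x => `|f x|)) => //.
  - move=> n; apply: (measurable_funS _ sub) => //.
    apply: measurable_funM; [exact: mf|exact: mb].
  - exact: intg_measurable.
  - exact: intg_norm.
  - apply: aeW => x /=; rewrite in_itv/= => xab.
    by rewrite -[X in _ --> X]mulr1; apply: cvgMr; exact: cvg_bump.
  - by move=> n x _; rewrite normrM ler_piMr// ger0_norm ?bump_ge0 ?bump_le1.
have e g : mfun `[a, b] g -> \int[mu]_(x in `[a, b]) g x = \int[mu]_(x in `]a, b[) g x.
  move=> mg; apply: Rintegral_itv_bnd; apply: measurable_funS mg => //.
  exact: subset_itv_oo_cc.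
rewrite e//; apply/esym; apply: (@cvg_unique _ _ _ _ _ _ _ h) => //.
have -> : (fun n : nat => \int[mu]_(x in `]a, b[) (f x * bump a b n.+1%:R x)) = (fun=> 0).
  apply/funext => n; rewrite -e ?f0//; apply: measurable_funM; [exact: mf|exact: mb].
exact: cvg_cst.
Qed.

End Bump.

(** * Weak derivatives on an interval *)

Section DuBoisReymond.
Context {R : realType}.
Implicit Types (f g : R -> R) (D : set R) (x : R).
Local Notation mu := (@lebesgue_measure R).

Lemma is_derive_continuous f x (df : R) : is_derive x 1 f df -> {for x, continuous f}.
Proof. by move=> [d _]; exact: derivable_continuous. Qed.

Lemma within_continuous f (A : set R) :
  (forall x, A x -> {for x, continuous f}) -> {within A, continuous f}.
Proof.
by move=> cf; apply/subspace_continuousP => x Ax; apply: cvg_within_filter; exact: cf.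
Qed.

Lemma is_derive_LR f (df : R -> R) (c d : R) : c < d ->
  (forall x, x \in `[c, d] -> is_derive x 1 f (df x)) ->
  derivable_oo_LRcontinuous f c d /\ {in `]c, d[, derive1 f =1 df}.
Proof.
move=> cd fdf.
have cf x : x \in `[c, d] -> {for x, continuous f}.
  by move=> /fdf; exact: is_derive_continuous.
split; last first.
  move=> x xcd; rewrite derive1E; apply: derive_val.
  by apply: fdf; apply: subset_itv_oo_cc xcd.
split.
- by move=> x xcd; case: (fdf x (subset_itv_oo_cc xcd)).
- by apply: cvg_at_right_filter; apply: cf; rewrite in_itv/= lexx ltW.
- by apply: cvg_at_left_filter; apply: cf; rewrite in_itv/= lexx ltW.
Qed.

Lemma RFTC2 f F (c d : R) : c <= d -> {within `[c, d], continuous f} ->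
  (forall x, x \in `[c, d] -> is_derive x 1 F (f x)) ->
  \int[mu]_(x in `[c, d]) f x = F d - F c.
Proof.
rewrite le_eqVlt => /predU1P[->|cd] cf dF.
  by rewrite set_itv1 Rintegral_set1 subrr.
have [FLR Ff] := is_derive_LR cd dF.
by rewrite /Rintegral (continuous_FTC2 cd cf FLR Ff).
Qed.

Lemma Rby_parts F G f g (c d : R) : c < d ->
  {within `[c, d], continuous f} -> {within `[c, d], continuous g} ->
  (forall x, x \in `[c, d] -> is_derive x 1 F (f x)) ->
  (forall x, x \in `[c, d] -> is_derive x 1 G (g x)) ->
  \int[mu]_(x in `[c, d]) (F x * g x) =
    (F d * G d - F c * G c) - \int[mu]_(x in `[c, d]) (f x * G x).
Proof.
move=> cd cf cg dF dG.
have [FLR Ff] := is_derive_LR cd dF.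
have [GLR Gg] := is_derive_LR cd dG.
exact: Rintegration_by_parts.
Qed.

Lemma is_derive_Rintegral f (c x u : R) : c < x -> x < u -> intg `[c, u] f ->
  {for x, continuous f} ->
  is_derive x 1 (fun y => \int[mu]_(t in `[c, y]) f t) (f x).
Proof.
move=> cx xu fi cf; have [dm m'] := continuous_FTC1_closed xu fi cx cf.
by apply: DeriveDef; [exact: dm|rewrite -derive1E].
Qed.

Lemma intg_supp f (c d : R) : continuous f -> (forall x, ~~ (c <= x <= d) -> f x = 0) ->
  intg setT f.
Proof.
move=> cf f0.
have fi : intg `[c, d] f by apply: intg_segment; exact: continuous_subspaceT.
have -> : f = f \_ `[c, d].
  apply/funext => x; rewrite patchE; case: ifPn => //.
  by rewrite notin_setE/= in_itv/= => /negP/f0.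
rewrite /intg -restrict_EFin; apply/integrable_restrict => //.
by rewrite setTI.
Qed.

(** The primitive from minus infinity vanishes to the left of [c], and to the right of [d] because
    the mean of [f] is 0; hence its support is compact. *)
Lemma test_primitive D (c d : R) f : smooth f -> c <= d -> `[c, d] `<=` D ->
  (forall x, ~~ (c <= x <= d) -> f x = 0) -> \int[mu]_(x in `[c, d]) f x = 0 ->
  exists2 eta, test_function D eta & forall x, is_derive x 1 eta (f x).
Proof.
move=> sf cd cdD f0 if0.
have fi := intg_supp (smooth_continuous sf) f0.
pose eta (x : R) := \int[mu]_(t in `]-oo, x]) f t.
have deta x : is_derive x 1 eta (f x).
  have xu : x < x + 1 by rewrite ltrDl.
  have fi' : mu.-integrable `]-oo, (x + 1)] (EFin \o f) by exact: intgS fi.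
  have [|dm m'] := continuous_FTC1 xu fi' _ (@smooth_continuous _ _ sf x); first by rewrite ltNyr.
  by apply: DeriveDef; [exact: dm|rewrite -derive1E].
exists eta; last exact: deta.
apply: (@test_function_sub _ _ c d); [exact: smooth_is_derive deta sf|exact: cdD|].
move=> x; rewrite negb_and -!ltNge => /orP[xc|dx].
  rewrite /eta; under eq_Rintegral.
    move=> t; rewrite inE/= in_itv/= => tx; rewrite f0; last first.
      by rewrite negb_and -ltNge (le_lt_trans tx).
    over.
  by rewrite Rintegral_cst// mul0r.
rewrite -if0 /eta; apply: Rintegral_supp.
  by apply: subset_itv; rewrite bnd_simp// ltW.
by move=> t _ /negP; rewrite in_itv/=; exact: f0.
Qed.

(** Otherwise all bumps would have mean 0, and [itv_integral_eq0_of_bump] for the constant 1 would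
    give [d - c = 0]. *)
Lemma Rintegral_bump_neq0 (c d : R) : c < d ->
  exists2 k, 0 < k & \int[mu]_(x in `[c, d]) bump c d k x != 0.
Proof.
move=> cd; apply: contrapT => H.
have : \int[mu]_(x in `[c, d]) (cst 1 x : R) = 0.
  apply: itv_integral_eq0_of_bump.
    by apply: intg_segment; exact: cst_continuous.
  move=> k k0; apply/eqP; apply/negPn/negP => h; apply: H; exists k => //.
  by apply: contraNN h => /eqP h; apply/eqP; rewrite -[RHS]h; apply: eq_Rintegral => x _; rewrite mul1r.
rewrite (@RFTC2 (cst 1) id) ?ltW//; [move=> /eqP|exact: cst_continuous].
by rewrite subr_eq0 => /eqP dc; move: cd; rewrite dc ltxx.
Qed.

(** Du Bois-Reymond. The constant is the mean of [w] against a fixed bump [rho0]. Any other bump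
    minus the multiple of [rho0] of equal mass has mean 0, so it is the derivative of a test
    function; hence [w - kap] is orthogonal to all bumps and has integral 0 on every segment. *)
Lemma weak_cst (w : R -> R) (c d : R) : c < d -> {in `]c, d[, continuous w} ->
  (forall eta, test_function (`]c, d[) eta -> \int[mu]_(x in `]c, d[) (w x * derive1 eta x) = 0) ->
  exists kap, {in `]c, d[, forall x, w x = kap}.
Proof.
move=> cd cw w0.
(* [rho0] sits on the middle third, so that its support is a segment inside the open interval. *)
pose c0 := (2 * c + d) / 3; pose d0 := (c + 2 * d) / 3.
have [cc0 c0d0 d0d] : [/\ c < c0, c0 < d0 & d0 < d] by rewrite /c0 /d0; split; lra.
have [k0 k0_gt0 I0] := Rintegral_bump_neq0 c0d0.
set rho0 := bump c0 d0 k0 in I0; set I := \int[mu]_(x in _) _ in I0.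
exists (I^-1 * \int[mu]_(x in `[c0, d0]) (w x * rho0 x)).
set kap := I^-1 * _.
have cwi (x y : R) : c < x -> y < d -> {within `[x, y], continuous w}.
  move=> cx yd; apply: within_continuous => z; rewrite /= in_itv/= => /andP[xz zy].
  by apply: cw; rewrite in_itv/= (lt_le_trans cx)//= (le_lt_trans zy).
have key (x y : R) : c < x -> x <= y -> y < d -> \int[mu]_(t in `[x, y]) (w t - kap) = 0.
  move=> cx xy yd.
  have cwk : {within `[x, y], continuous (fun t => w t - kap)}.
    by move=> t; apply: cvgB; [exact: cwi|exact: cst_continuous].
  apply: itv_integral_eq0_of_bump; first exact: intg_segment.
  move=> k k_gt0; set rho := bump x y k.
  pose J := \int[mu]_(t in `[x, y]) rho t.
  (* mean zero, hence the derivative of a test function *)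
  pose h t := rho t - (J / I) * rho0 t.
  (* [[m, M]] is a segment of []c, d[] that contains the supports of both bumps. *)
  pose m := Num.min x c0; pose M := Num.max y d0.
  have [mx mc0] : m <= x /\ m <= c0 by rewrite /m !ge_min !lexx orbT.
  have [yM d0M] : y <= M /\ d0 <= M by rewrite /M !le_max !lexx orbT.
  have cm : c < m by rewrite /m lt_min cx cc0.
  have Md : M < d by rewrite /M gt_max yd d0d.
  have sr : smooth rho by exact: smooth_bump.
  have sr0 : smooth rho0 by exact: smooth_bump.
  have sh : smooth h.
    have -> : h = (fun t => rho t + (- (J / I)) * rho0 t).
      by apply/funext => t; rewrite /h mulNr.
    by apply: smoothD; [exact: sr|apply: smoothM; [exact: smooth_cst|exact: sr0]].
  have rho_out t : ~~ (x <= t <= y) -> rho t = 0.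
    move=> H; apply: bump_eq0; first exact: ltW.
    by apply: contra H => /andP[? ?]; rewrite !ltW.
  have rho0_out t : ~~ (c0 <= t <= d0) -> rho0 t = 0.
    move=> H; apply: bump_eq0; first exact: ltW.
    by apply: contra H => /andP[? ?]; rewrite !ltW.
  have sub1 : `[x, y] `<=` (`[m, M] : set R) by apply: subset_itv; rewrite bnd_simp.
  have sub2 : `[c0, d0] `<=` (`[m, M] : set R) by apply: subset_itv; rewrite bnd_simp.
  have h_out t : ~~ (m <= t <= M) -> h t = 0.
    move=> H; rewrite /h rho_out ?rho0_out ?mulr0 ?subrr//.
      by apply: contra H => /andP[? ?]; rewrite (le_trans mc0)// (le_trans _ d0M).
    by apply: contra H => /andP[? ?]; rewrite (le_trans mx)// (le_trans _ yM).
  have ci (g : R -> R) : continuous g -> intg `[m, M] g.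
    by move=> cg; apply: intg_segment; exact: continuous_subspaceT.
  have cr := smooth_continuous sr; have cr0 := smooth_continuous sr0.
  have h_int : \int[mu]_(t in `[m, M]) h t = 0.
    rewrite RintegralB//; [|exact: (ci _ cr)|by apply: intgZ => //; exact: (ci _ cr0)].
    rewrite RintegralZl//; last exact: (ci _ cr0).
    rewrite (Rintegral_supp sub1); last by move=> t _ /negP; rewrite in_itv/=; exact: rho_out.
    rewrite (Rintegral_supp sub2); last by move=> t _ /negP; rewrite in_itv/=; exact: rho0_out.
    by rewrite -/J -/I divfK ?subrr.
  have mM : m <= M by rewrite (le_trans mx)// (le_trans xy).
  have mMcd : `[m, M] `<=` `]c, d[.
    by move=> t; rewrite /= !in_itv/= => /andP[mt tM]; rewrite (lt_le_trans cm)//= (le_lt_trans tM).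
  have [eta teta deta] := test_primitive sh mM mMcd h_out h_int.
  have := w0 _ teta; rewrite (derive1_eq deta).
  rewrite (Rintegral_supp mMcd); last first.
    by move=> t _ /negP; rewrite in_itv/= => /h_out ->; rewrite mulr0.
  have wi g : continuous g -> intg `[m, M] (fun t => w t * g t).
    move=> cg; apply: intg_segment => t; apply: cvgM; first exact: cwi.
    exact: continuous_subspaceT.
  under eq_Rintegral do rewrite /h mulrBr [X in _ - X]mulrCA.
  rewrite RintegralB//; [|exact: (wi _ cr)|by apply: intgZ => //; exact: (wi _ cr0)].
  rewrite RintegralZl//; last exact: (wi _ cr0).
  rewrite (Rintegral_supp sub1); last by move=> t _ /negP; rewrite in_itv/= => /rho_out ->; rewrite mulr0.
  rewrite (Rintegral_supp sub2); last by move=> t _ /negP; rewrite in_itv/= => /rho0_out ->; rewrite mulr0.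
  rewrite -mulrA -/kap => h0.
  under eq_Rintegral do rewrite mulrBl.
  rewrite RintegralB//.
  - rewrite RintegralZl// -/J; first by rewrite mulrC h0.
    by apply: intgS (ci _ cr).
  - by apply: intgS (wi _ cr).
  - by apply: intgZ => //; apply: intgS (ci _ cr).
move=> x; rewrite in_itv/= => /andP[cx xd].
pose c1 := (c + x) / 2; pose d1 := (x + d) / 2.
have [cc1 c1x xd1 d1d] : [/\ c < c1, c1 < x, x < d1 & d1 < d] by rewrite /c1 /d1; split; lra.
have cwk z : c < z -> z < d -> {for z, continuous (fun t => w t - kap)}.
  move=> cz zd; apply: cvgB; last exact: cst_continuous.
  by apply: cw; rewrite in_itv/= cz.
have wki : intg `[c1, d1] (fun t => w t - kap).
  apply: intg_segment; apply: within_continuous => z; rewrite /= in_itv/= => /andP[xz zy].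
  by apply: cwk; [exact: lt_le_trans xz|exact: le_lt_trans zy _].
have := is_derive_Rintegral c1x xd1 wki (cwk _ cx xd).
move=> H; apply/eqP; rewrite -subr_eq0; apply/eqP.
rewrite -(@derive_val _ _ _ _ _ _ _ H).
rewrite -(@near_eq_derive R _ _ (cst 0)) ?derive_cst//.
near=> y; rewrite /cst; apply/esym; apply: key => //.
- by apply: ltW; near: y; exact: lt_nbhsr.
- by rewrite (lt_trans _ d1d)//; near: y; exact: lt_nbhsl.
Unshelve. all: by end_near. Qed.

(** If [m] is a primitive of [k], then [v - m] has weak derivative 0, so [weak_cst] makes it
    constant near [t]. *)
Lemma weak_derivative (v k : R -> R) (a b : R) : {in `]a, b[, continuous v} -> {in `]a, b[, continuous k} ->
  (forall eta, test_function (`]a, b[) eta ->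
    \int[mu]_(x in `]a, b[) (v x * derive1 eta x) = - \int[mu]_(x in `]a, b[) (k x * eta x)) ->
  forall t, t \in `]a, b[ -> is_derive t 1 v (k t).
Proof.
move=> cv ck H t; rewrite in_itv/= => /andP[at_ tb].
(* Two nested segments: the primitive starts at [c1] and the test functions live in []c, d[], so
   that it is differentiable on the closed segment [[c, d]], as integration by parts requires. *)
pose c1 := (a + t) / 2; pose d1 := (t + b) / 2.
have [ac1 c1t td1 d1b] : [/\ a < c1, c1 < t, t < d1 & d1 < b] by rewrite /c1 /d1; split; lra.
pose c := (c1 + t) / 2; pose d := (t + d1) / 2.
have [c1c ct td dd1] : [/\ c1 < c, c < t, t < d & d < d1] by rewrite /c /d; split; lra.
have ckx x : a < x -> x < b -> {for x, continuous k}.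
  by move=> ax xb; apply: ck; rewrite in_itv/= ax.
have cvx x : a < x -> x < b -> {for x, continuous v}.
  by move=> ax xb; apply: cv; rewrite in_itv/= ax.
have ki : intg `[c1, d1] k.
  apply: intg_segment; apply: within_continuous => z; rewrite /= in_itv/= => /andP[xz zy].
  by apply: ckx; [exact: lt_le_trans xz|exact: le_lt_trans zy _].
pose m x := \int[mu]_(s in `[c1, x]) k s.
have dm x : c1 < x -> x < d1 -> is_derive x 1 m (k x).
  move=> c1x xd1; apply: (@is_derive_Rintegral _ _ _ d1) => //.
  by apply: ckx; [exact: lt_trans c1x|exact: lt_trans d1b].
have [| |eta te|kap hk] := @weak_cst (fun x => v x - m x) c d.
- exact: lt_trans td.
- move=> x; rewrite in_itv/= => /andP[cx xd].
  apply: cvgB.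
    by apply: cvx; lra.
  by apply: is_derive_continuous; apply: dm; lra.
- have [se ce cde] := te.
  have eta0 x : ~~ (c < x < d) -> eta x = 0.
    move=> xcd; apply/eqP; apply: contraNT xcd => ex.
    have /cde : closure [set x | eta x != 0] x by exact: subset_closure.
    by rewrite /= in_itv/=.
  have deta0 x : ~ (`[c, d]%classic x) -> derive1 eta x = 0.
    move=> xcd; rewrite derive1E -(@near_eq_derive R _ _ (cst 0)) ?derive_cst//.
    have : open (~` (`[c, d]%classic : set R)).
      by rewrite openC; exact: interval_closed.
    rewrite openE => /(_ x xcd); apply: filterS => y ycd; apply/esym; apply: eta0.
    apply/negP => /andP[cy yd]; apply: ycd; rewrite /= in_itv/= !ltW//.
  have tab : test_function (`]a, b[) eta.
    split => //; apply: subset_trans cde _.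
    by apply: subset_itv; rewrite bnd_simp; lra.
  have := H _ tab.
  have subcd : `[c, d] `<=` `]a, b[.
    move=> z; rewrite /= !in_itv/= => /andP[cz zd].
    by lra.
  rewrite (Rintegral_supp subcd); last by move=> x _ /deta0 ->; rewrite mulr0.
  rewrite (Rintegral_supp subcd); last first.
    move=> x _ xcd; rewrite eta0 ?mulr0//; apply/negP => /andP[cy yd]; apply: xcd.
    by rewrite /= in_itv/= !ltW.
  have subcd' : `]c, d[ `<=` (`[c, d] : set R) by exact: subset_itv_oo_cc.
  have cd : c < d by exact: lt_trans td.
  have cin x : x \in `[c, d] -> a < x /\ x < b.
    by move=> /subcd; rewrite /= in_itv/= => /andP.
  have cw (g : R -> R) : (forall x, a < x -> x < b -> {for x, continuous g}) ->
      {within `[c, d], continuous g}.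
    by move=> cg; apply: within_continuous => x /cin[? ?]; exact: cg.
  have sde := smooth_derive1 se.
  have cdeta : {within `[c, d], continuous (derive1 eta)}.
    by apply: continuous_subspaceT; exact: smooth_continuous.
  have dm' x : x \in `[c, d] -> is_derive x 1 m (k x).
    rewrite in_itv/= => /andP[cx xd]; apply: dm; lra.
  have := @Rby_parts m eta k (derive1 eta) c d cd (cw _ ckx) cdeta dm' _.
  move=> /(_ (fun x _ => is_derive_derive1 (@smooth_derivable R eta x se))).
  rewrite (eta0 c) ?ltxx// (eta0 d) ?ltxx ?andbF// !mulr0 subrr sub0r => <-.
  move=> e1.
  rewrite -(@Rintegral_itv_bnd _ _ _ _ true false).
    have cm : {within `[c, d], continuous m}.
      by apply: within_continuous => x xcd; apply: is_derive_continuous; exact: dm'.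
    under eq_Rintegral do rewrite mulrBl.
    rewrite RintegralB//; first by rewrite e1 subrr.
      by apply: intg_segment => x; apply: cvgM; [exact: cw|exact: cdeta].
    by apply: intg_segment => x; apply: cvgM; [exact: cm|exact: cdeta].
  apply: open_continuous_measurable_fun; first exact: interval_open.
  move=> x; rewrite inE => /subcd' xcd; apply: cvgM; last exact: smooth_continuous.
  have [ax xb] := cin _ xcd.
  by apply: cvgB; [exact: cvx|apply: is_derive_continuous; exact: dm'].
have {}dm := dm _ c1t td1.
have -> : k t = k t + 0 by rewrite addr0.
apply: (@near_eq_is_derive _ _ _ (fun x => m x + cst kap x)).
  have tcd : `]c, d[%classic t by rewrite /= in_itv/= ct.
  have : nbhs t `]c, d[%classic by apply: open_nbhs_nbhs; split => //; exact: interval_open.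
  by apply: filterS => x xcd; rewrite /cst -(hk x xcd) addrC subrK.
Qed.

End DuBoisReymond.

(** * Functions representing distributions *)

Section Density.
Context {R : realType}.
Implicit Types (f g : R -> R) (x : R).
Local Notation mu := (@lebesgue_measure R).
Local Notation Om := (@Omega R).

Lemma loc_intg_segment g (c d : R) : -1 < c -> d < 1 -> locally_integrable Om g -> intg `[c, d] g.
Proof.
move=> c1 d1 [mg _ gfin].
have sub : `[c, d] `<=` Om.
  by move=> x; rewrite /Omega /= !in_itv/= => /andP[cx xd]; lra.
apply/integrableP; split; last by have := gfin _ sub (@segment_compact _ _ _).
apply/measurable_EFinP; apply: (measurable_funS _ sub); last exact: mg.
exact: measurable_itv.
Qed.

Lemma ae_Omega (P : R -> Prop) :
  (forall c d : R, -1 < c -> c < d -> d < 1 -> {ae mu, forall x, x \in `]c, d[ -> P x}) ->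
  {ae mu, forall x, Om x -> P x}.
Proof.
move=> H.
pose r (n : nat) : R := 1 - n.+2%:R^-1.
have r1 n : r n < 1 by rewrite /r ltrBlDr ltrDl invr_gt0.
have r0 n : 0 < r n by rewrite /r subr_gt0 invf_lt1// ltr1n.
have h : forall n, {ae mu, forall x, x \in `](- r n), (r n)[ -> P x}.
  by move=> n; have := r1 n; have := r0 n => ? ?; apply: H; lra.
apply: aeS (ae_foralln h) => x hx; rewrite /Omega/= in_itv/= => /andP[x1 x2].
pose e := 1 - `|x|.
have e0 : 0 < e by rewrite subr_gt0 ltr_norml x1.
pose n := Num.Def.truncn e^-1.
have xr : `|x| < r n.
  rewrite /r ltrBrDr -ltrBrDl -/e invf_plt ?posrE//.
  rewrite (lt_trans (truncnS_gt _))// ltr_nat//.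
by apply: (hx n); rewrite in_itv/= -ltr_norml.
Qed.

(** Testing with bumps shows that [g1 - g2] has integral 0 on every segment, and Lebesgue
    differentiation does the rest. *)
Lemma density_unique g1 g2 : locally_integrable Om g1 -> locally_integrable Om g2 ->
  (forall eta, test_function Om eta -> dotL2 g1 eta = dotL2 g2 eta) -> eq_ae_Omega g1 g2.
Proof.
move=> l1 l2 H; apply: ae_Omega => c d c1 cd d1.
have i1 x : x <= d -> intg `[c, x] g1 by move=> xd; apply: loc_intg_segment => //; lra.
have i2 x : x <= d -> intg `[c, x] g2 by move=> xd; apply: loc_intg_segment => //; lra.
have i12 x : x <= d -> intg `[c, x] (fun x => g1 x - g2 x).
  by move=> xd; apply: intgB => //; [exact: i1|exact: i2].
suff h : {ae mu, forall x, x \in `]c, d[ -> g1 x - g2 x = 0}.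
  by apply: aeS h => x h /h /eqP; rewrite subr_eq0 => /eqP.
apply: ae_eq0_of_itv; first exact: i12.
move=> x; rewrite in_itv/= => /andP[cx xd].
apply: itv_integral_eq0_of_bump; first by apply: i12; exact: ltW.
move=> k k0.
have sub : `[c, x] `<=` Om.
  by move=> y; rewrite /Omega /= !in_itv/= => /andP[cy yd]; lra.
have tb : test_function Om (bump c x k) by apply: test_bump => //; exact: ltW.
have := H _ tb; rewrite /dotL2.
have out y : Om y -> ~ `[c, x]%classic y -> bump c x k y = 0.
  move=> _; rewrite /= in_itv/= => cyx; apply: bump_eq0; first exact: ltW.
  by apply/negP => /andP[? ?]; apply: cyx; rewrite !ltW.
rewrite (Rintegral_supp sub); last by move=> y Oy /out ->; rewrite ?mulr0.
rewrite (Rintegral_supp sub); last by move=> y Oy /out ->; rewrite ?mulr0.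
move=> e12; under eq_Rintegral do rewrite mulrBl.
have mb : mfun `[c, x] (bump c x k).
  by apply: continuous_mfun => //; apply: smooth_continuous; exact: smooth_bump.
have ib g : intg `[c, x] g -> intg `[c, x] (fun t => g t * bump c x k t).
  move=> ig; apply: (@eq_intg _ _ (fun t => bump c x k t * g t)) => //.
    by move=> t _; rewrite mulrC.
  apply: (@intgM_bounded _ _ _ _ 1) => // t _.
  by rewrite ger0_norm ?bump_ge0 ?bump_le1.
rewrite RintegralB ?e12 ?subrr//; first by apply: ib; apply: i1; exact: ltW.
by apply: ib; apply: i2; exact: ltW.
Qed.

Lemma density_ae D g : is_density D g -> eq_ae_Omega (density D) g.
Proof.
move=> dg; have : is_density D (density D) by apply: (@getPex _ [set g | is_density D g]); exists g.
move=> [l1 h1]; have [l2 h2] := dg.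
by apply: density_unique => // eta te; rewrite -h1// -h2.
Qed.

End Density.

(** * Improper integrals through primitives *)

Section Improper.
Context {R : realType}.
Implicit Types (f F : R -> R) (a b x : R).
Local Notation mu := (@lebesgue_measure R).

(** The denominator starts at 3, so that the left end is strictly below the right end already for
    [n = 0]. *)
Definition inner_l a b (n : nat) : R := a + (b - a) / n.+3%:R.
Definition inner_r a b (n : nat) : R := b - (b - a) / n.+3%:R.

Lemma inner_bounds a b n : a < b -> [/\ a < inner_l a b n, inner_l a b n < inner_r a b n &
  inner_r a b n < b].
Proof.
move=> ab; rewrite /inner_l /inner_r.
have ba : 0 < b - a by rewrite subr_gt0.
have h : (b - a) / n.+3%:R < (b - a) / 2.
  by rewrite ltr_pM2l// ltf_pV2 ?posrE// ltr_nat.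
have h0 : 0 < (b - a) / n.+3%:R by rewrite divr_gt0.
by set dl := (b - a) / _ in h h0 *; split; lra.
Qed.

Lemma cvg_inner_step a b : (b - a) / n.+3%:R @[n --> \oo] --> (0 : R).
Proof.
rewrite -[X in _ --> X](mulr0 (b - a)); apply: cvgMr.
by move: (@cvg_harmonic R); rewrite -cvg_shiftS -cvg_shiftS.
Qed.

Lemma cvg_inner_l a b : inner_l a b n @[n --> \oo] --> a.
Proof.
rewrite -[X in _ --> X]addr0; apply: cvgD; first exact: cvg_cst.
exact: cvg_inner_step.
Qed.

Lemma cvg_inner_r a b : inner_r a b n @[n --> \oo] --> b.
Proof.
rewrite -[X in _ --> X]subr0; apply: cvgB; first exact: cvg_cst.
exact: cvg_inner_step.
Qed.

Lemma inner_nondecreasing a b : a < b ->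
  nondecreasing_seq (fun n => `[inner_l a b n, inner_r a b n]%classic).
Proof.
move=> ab; apply/nondecreasing_seqP => n; rewrite subsetEset.
have h : (b - a) / n.+4%:R <= (b - a) / n.+3%:R.
  by rewrite ler_pM2l ?subr_gt0// lef_pV2 ?posrE// ler_nat.
by apply: subset_itv; rewrite bnd_simp ?lerD2l ?lerN2.
Qed.

Lemma inner_sub a b n : a < b -> `[inner_l a b n, inner_r a b n] `<=` (`]a, b[ : set R).
Proof.
move=> ab x; have [h1 _ h2] := inner_bounds n ab.
by rewrite /= !in_itv/= => /andP[h3 h4]; lra.
Qed.

Lemma inner_near a b x : a < x < b ->
  \forall n \near \oo, `[inner_l a b n, inner_r a b n]%classic x.
Proof.
move=> /andP[ax xb]; have h1 := cvgr_lt _ (@cvg_inner_l a b) _ ax; have h2 := cvgr_gt _ (@cvg_inner_r a b) _ xb.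
near=> n; rewrite /= in_itv/=; apply/andP; split; apply: ltW.
  by near: n; exact: h1.
by near: n; exact: h2.
Unshelve. all: by end_near. Qed.

Lemma bigcup_inner a b : a < b ->
  \bigcup_n `[inner_l a b n, inner_r a b n]%classic = `]a, b[%classic.
Proof.
move=> ab; apply/seteqP; split=> [x [n _]|x xab]; first exact: inner_sub.
have [N _ h] : \forall n \near \oo, `[inner_l a b n, inner_r a b n]%classic x.
  by apply: inner_near; move: xab; rewrite /= in_itv.
by exists N => //; apply: h => /=.
Qed.

Lemma itvoo_continuous_within f a b n : a < b -> {in `]a, b[, continuous f} ->
  {within `[inner_l a b n, inner_r a b n], continuous f}.
Proof.
by move=> ab cf; apply: within_continuous => x xi; apply: cf; exact: (inner_sub ab xi).
Qed.

Lemma itvoo_mfun f a b : {in `]a, b[, continuous f} -> mfun `]a, b[ f.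
Proof.
move=> cf; apply: open_continuous_measurable_fun; first exact: interval_open.
by move=> x; rewrite inE => xab; exact: cf.
Qed.

(** Monotone convergence along the inner segments, where the integral is a difference of two values
    of [F], hence at most [M + M]. *)
Lemma improper_intg f F a b M : a < b -> (forall x, x \in `]a, b[ -> 0 <= f x) ->
  {in `]a, b[, continuous f} -> (forall x, x \in `]a, b[ -> is_derive x 1 F (f x)) ->
  (forall x, x \in `]a, b[ -> `|F x| <= M) -> intg `]a, b[ f.
Proof.
move=> ab f0 cf dF FM.
have mf := itvoo_mfun cf.
apply/integrableP; split; first exact/measurable_EFinP.
have -> : (\int[mu]_(x in `]a, b[) `|(EFin \o f) x| = \int[mu]_(x in `]a, b[) (f x)%:E)%E.
  by apply: eq_integral => x; rewrite inE => xab /=; rewrite ger0_norm// f0.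
have cv : (\int[mu]_(x in `[inner_l a b n, inner_r a b n]) (f x)%:E)%E @[n --> \oo] -->
    (\int[mu]_(x in `]a, b[) (f x)%:E)%E.
  rewrite -(bigcup_inner ab).
  apply: (@ge0_nondecreasing_set_cvg_integral _ (measurableTypeR R)); first exact: inner_nondecreasing.
  - by move=> i; exact: measurable_itv.
  - move=> i; apply/measurable_EFinP; apply: (measurable_funS _ (@inner_sub _ _ i ab)) => //.
  - by move=> i x xi; rewrite lee_fin f0//; exact: (inner_sub ab xi).
apply: (@le_lt_trans _ _ (M + M)%:E); last exact: ltry.
rewrite -(cvg_lim _ cv)//; apply: lime_le; first by apply/cvg_ex; eexists; exact: cv.
apply: nearW => n; have [an anbn bn] := inner_bounds n ab.
have sub := @inner_sub _ _ n ab.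
have [FLR Ff] := @is_derive_LR _ F f _ _ anbn (fun x xn => dF x (sub x xn)).
rewrite (continuous_FTC2 anbn (itvoo_continuous_within ab cf) FLR Ff) -EFinB lee_fin.
apply: (le_trans (ler_norm _)); apply: (le_trans (ler_normB _ _)).
by apply: lerD; apply: FM; apply: sub; rewrite /= in_itv/= lexx// ltW.
Qed.

Lemma improper_FTC f F a b (k l : R) : a < b -> intg `]a, b[ f ->
  {in `]a, b[, continuous f} -> (forall x, x \in `]a, b[ -> is_derive x 1 F (f x)) ->
  F x @[x --> a^'+] --> k -> F x @[x --> b^'-] --> l ->
  \int[mu]_(x in `]a, b[) f x = l - k.
Proof.
move=> ab fi cf dF Fa Fb.
have mf := itvoo_mfun cf.
pose I n := `[inner_l a b n, inner_r a b n]%classic.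
have mI n : mset (I n) by exact: measurable_itv.
have h : (\int[mu]_(x in `]a, b[) (f \_ (I n)) x) @[n --> \oo] --> \int[mu]_(x in `]a, b[) f x.
  apply: (@Rdominated _ _ _ _ (fun x => `|f x|)) => //.
  - move=> n; apply: (@measurable_funS _ _ _ _ setT) => //.
    apply/(@measurable_restrictT _ _ _ _ (I n)); first exact: mI.
    by apply: (measurable_funS _ (@inner_sub _ _ n ab)).
  - exact: intg_norm.
  - apply: aeW => x; rewrite /= in_itv/= => xab.
    apply: cvg_near_cst.
    by apply: filterS (inner_near xab) => n xn; rewrite patchE mem_set.
  - by move=> n x _; rewrite patchE; case: ifP => //; rewrite normr0.
have -> : l - k = lim ((\int[mu]_(x in `]a, b[) (f \_ (I n)) x) @[n --> \oo]).
  apply/esym; apply/cvg_lim => //.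
  have -> : (fun n => \int[mu]_(x in `]a, b[) (f \_ (I n)) x) =
      (fun n => F (inner_r a b n) - F (inner_l a b n)).
    apply/funext => n; have [an anbn bn] := inner_bounds n ab.
    have sub := @inner_sub _ _ n ab.
    rewrite (Rintegral_supp sub); last by move=> x _ nIx; rewrite patchE memNset.
    rewrite -(@RFTC2 _ f F _ _ (ltW anbn) (itvoo_continuous_within ab cf)
      (fun x xn => dF x (sub x xn))).
    by apply: eq_Rintegral => x; rewrite inE => xI; rewrite patchE mem_set.
  apply: cvgB.
    move/cvg_at_leftP : Fb; apply; split; last exact: cvg_inner_r.
    by move=> n; have [] := inner_bounds n ab.
  move/cvg_at_rightP : Fa; apply; split; last exact: cvg_inner_l.
  by move=> n; have [] := inner_bounds n ab.
by apply/esym/cvg_lim.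
Qed.

End Improper.

(** * Chebyshev polynomials and the principal value *)

Section Weighted.
Context {R : realType}.
Implicit Types (f g G : R -> R) (x y : R).
Local Notation mu := (@lebesgue_measure R).
Local Notation Om := (@Omega R).

Lemma OmE x : Om x = (-1 < x < 1).
Proof. by rewrite /Omega/= in_itv/=. Qed.

Lemma mOm : mset Om. Proof. exact: measurable_itv. Qed.

Lemma acos_Om x : Om x -> 0 < acos x < pi.
Proof.
rewrite OmE => /andP[x1 x2]; apply/andP; split.
  by apply: acos_gt0; rewrite x2 ltW.
by apply: acos_ltpi; rewrite x1 ltW.
Qed.

Lemma acosK_Om x : Om x -> cos (acos x) = x.
Proof. by rewrite OmE => /andP[x1 x2]; apply: acosK; rewrite in_itv/= !ltW. Qed.

Lemma weight_acos x : Om x -> weight x = sin (acos x).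
Proof. by rewrite OmE => /andP[x1 x2]; rewrite sin_acos// !ltW. Qed.

Lemma weight_gt0 x : Om x -> 0 < weight x.
Proof. by move=> xO; rewrite weight_acos//; apply: sin_gt0_pi; exact: acos_Om. Qed.

Definition winv x : R := (weight x)^-1.

Lemma winv_gt0 x : Om x -> 0 < winv x.
Proof. by move=> xO; rewrite invr_gt0 weight_gt0. Qed.

Lemma winv_ge1 x : Om x -> 1 <= winv x.
Proof.
move=> xO; rewrite -[1]invr1 lef_pV2 ?posrE ?weight_gt0//.
by rewrite weight_acos// sin_le1.
Qed.

Lemma is_derive_acos x : Om x -> is_derive x 1 (@acos R) (- winv x).
Proof. by rewrite OmE => xO; exact: is_derive1_acos. Qed.

Lemma acos_continuous x : Om x -> {for x, continuous (@acos R)}.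
Proof. by move=> /is_derive_acos; exact: is_derive_continuous. Qed.

Lemma winv_continuous x : Om x -> {for x, continuous winv}.
Proof.
move=> xO; apply: cvgV; first by rewrite gt_eqF// weight_gt0.
apply: (@continuous_comp _ _ _ (fun z : R => 1 - z ^+ 2) (@Num.sqrt R)); last exact: sqrt_continuous.
apply: cvgB; first exact: cvg_cst.
exact: exprn_continuous.
Qed.

Lemma Om_mfun f : (forall x, Om x -> {for x, continuous f}) -> mfun Om f.
Proof. by move=> cf; apply: itvoo_mfun => x xO; exact: cf. Qed.

Lemma cvg_continuous (T : Type) (F : set_system T) (FF : Filter F) (h : T -> R) g (l : R) :
  h @ F --> l -> continuous g -> (fun z => g (h z)) @ F --> g l.
Proof. by move=> hl cg; apply: (cvg_comp _ _ hl); exact: cg. Qed.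

Lemma acos_mfun g : continuous g -> mfun Om (fun x => g (acos x)).
Proof.
move=> cg; apply: Om_mfun => x xO; apply: (@cvg_continuous _ _ _ (@acos R)) => //; exact: acos_continuous.
Qed.

Lemma winv_mfun : mfun Om winv.
Proof. by apply: Om_mfun; exact: winv_continuous. Qed.

Lemma winv_intg : intg Om winv.
Proof.
apply: (@improper_intg _ _ (fun x => - acos x) (-1) 1 pi) => //.
- by move=> x xO; rewrite ltW// winv_gt0.
- by move=> x xO; exact: winv_continuous.
- by move=> x xO; rewrite -[winv x]opprK; apply: is_deriveN; exact: is_derive_acos.
- by move=> x /acos_Om/andP[h1 h2]; rewrite normrN gtr0_norm// ltW.
Qed.

Lemma intgW f M : mfun Om f -> (forall x, Om x -> `|f x| <= M) -> intg Om (fun x => winv x * f x).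
Proof.
move=> mf fM; apply: (@eq_intg _ _ (fun x => f x * winv x)); first exact: mOm.
  by move=> x _; rewrite mulrC.
by apply: (@intgM_bounded _ _ _ _ M) => //; [exact: mOm|exact: winv_intg].
Qed.

Lemma acos_cvg1 : acos x @[x --> (1 : R)^'-] --> (0 : R).
Proof.
apply/cvgrPdist_lt => e e0.
(* The cap keeps [e'] in the range on which cos is strictly decreasing, so that the inequality can
   be moved through [acos]. *)
pose e' := Num.min e (pi / 2).
have e'0 : 0 < e' by rewrite lt_min e0 divr_gt0// pi_gt0.
have e'pi : e' < pi by rewrite gt_min; apply/orP; right; have := @pi_gt0 R; lra.
have ce : cos e' < 1.
  by rewrite -cos0 ltr_cos ?in_itv/= ?lexx ?pi_ge0 ?(ltW e'0) ?(ltW e'pi).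
near=> x.
have x1 : x < 1 by near: x; exact: nbhs_left_lt.
have xe : cos e' < x by near: x; exact: nbhs_left_gt.
have x_1 : -1 < x by apply: le_lt_trans xe; exact: cos_geN1.
have xO : Om x by rewrite OmE x_1.
have /andP[a0 api] := acos_Om xO.
rewrite sub0r normrN gtr0_norm//.
have : acos x < e'.
  by rewrite -ltr_cos ?in_itv/= ?acosK_Om// ?(ltW a0) ?(ltW api) ?(ltW e'0) ?(ltW e'pi).
by move=> /lt_le_trans; apply; rewrite ge_min lexx.
Unshelve. all: by end_near. Qed.

Lemma acos_cvgN1 : acos x @[x --> (-1 : R)^'+] --> (pi : R).
Proof.
apply/cvgrPdist_lt => e e0.
have /cvgrPdist_lt/(_ e e0)[d /= d0 H] := acos_cvg1.
near=> x.
have x1 : -1 < x by near: x; exact: nbhs_right_gt.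
have xd : x < -1 + d by near: x; apply: nbhs_right_lt; rewrite ltrDl.
have x11 : x < 1 by near: x; apply: nbhs_right_lt; lra.
have := H (- x); rewrite /= /ball_/= acosN ?ltW// sub0r normrN; apply; last by lra.
by rewrite ltr_norml; lra.
Unshelve. all: by end_near. Qed.

(** The substitution x = cos s, carried out with the primitive [- G (acos x)]; its end values are
    limits, since [acos] is not differentiable at -1 and 1. *)
Lemma W_FTC g G M : continuous g -> (forall y, is_derive y 1 G (g y)) ->
  (forall y, `|g y| <= M) ->
  \int[mu]_(x in Om) (winv x * g (acos x)) = G pi - G 0.
Proof.
move=> cg dG gM.
have cG : continuous G by move=> y; exact: is_derive_continuous.
transitivity (- G 0 - - G pi); last by rewrite opprK addrC.
apply: (@improper_FTC _ _ (fun x => - G (acos x))) => //.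
- by apply: (@intgW _ M) => [|x _]; [exact: acos_mfun|exact: gM].
- move=> x xO; apply: cvgM; first exact: winv_continuous.
  by apply: (@cvg_continuous _ _ _ (@acos R)) => //; exact: acos_continuous.
- move=> x xO; have -> : winv x * g (acos x) = - (g (acos x) * - winv x) by ring.
  apply: is_deriveN; apply: (@is_derive1_comp _ G (@acos R)).
- by apply: cvgN; apply: (@cvg_continuous _ _ _ (@acos R)) => //; exact: acos_cvgN1.
- by apply: cvgN; apply: (@cvg_continuous _ _ _ (@acos R)) => //; exact: acos_cvg1.
Qed.

Lemma sin_natpi n : sin (n%:R * pi) = 0 :> R.
Proof.
elim: n => [|n IH]; first by rewrite mul0r sin0.
by rewrite -natr1 mulrDl mul1r sinDpi IH oppr0.
Qed.

Lemma is_derive_cos_mul (k y : R) : is_derive y 1 (fun z => cos (k * z)) (- (k * sin (k * y))).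
Proof.
have -> : - (k * sin (k * y)) = - sin (k * y) * k by ring.
apply: (@is_derive1_comp _ cos (fun z => k * z)).
by have := @is_derive_affine _ k 0 y; under eq_fun do rewrite addr0.
Qed.

Lemma is_derive_sin_mul (k y : R) : is_derive y 1 (fun z => sin (k * z)) (k * cos (k * y)).
Proof.
have -> : k * cos (k * y) = cos (k * y) * k by ring.
apply: (@is_derive1_comp _ sin (fun z => k * z)).
by have := @is_derive_affine _ k 0 y; under eq_fun do rewrite addr0.
Qed.

Lemma cos_mul_continuous (k : R) : continuous (fun y : R => cos (k * y)).
Proof. by move=> y; apply: is_derive_continuous; exact: is_derive_cos_mul. Qed.

Lemma cos_bound y : `|cos y| <= 1 :> R.
Proof. by rewrite ler_norml cos_geN1 cos_le1. Qed.

Lemma sin_bound y : `|sin y| <= 1 :> R.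
Proof. by rewrite ler_norml sin_geN1 sin_le1. Qed.

Lemma intW_cos n : \int[mu]_(x in Om) (winv x * cos (n%:R * acos x)) = if n is 0 then pi else 0.
Proof.
case: n => [|n].
  transitivity (id (pi : R) - id 0); last by rewrite subr0.
  apply: (@W_FTC (fun y => cos (0%:R * y)) id 1).
  - exact: cos_mul_continuous.
  - by move=> y; rewrite mul0r cos0; exact: is_derive_id.
  - by move=> y; exact: cos_bound.
pose G (y : R) := n.+1%:R^-1 * sin (n.+1%:R * y).
transitivity (G pi - G 0); last by rewrite /G sin_natpi !mulr0 sin0 mulr0 subrr.
apply: (@W_FTC (fun y => cos (n.+1%:R * y)) G 1).
- exact: cos_mul_continuous.
- move=> y; have -> : cos (n.+1%:R * y) = n.+1%:R^-1 * (n.+1%:R * cos (n.+1%:R * y)).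
    by rewrite mulKf// pnatr_eq0.
  by apply: is_deriveZ; exact: is_derive_sin_mul.
- by move=> y; exact: cos_bound.
Qed.

Lemma chebyshevT_mfun n : mfun Om (@chebyshevT R n).
Proof. exact: (@acos_mfun (fun y => cos (n%:R * y)) (@cos_mul_continuous _)). Qed.

Lemma chebyshevT_bound n x : `|chebyshevT n x| <= 1 :> R.
Proof. exact: cos_bound. Qed.

Definition chebh (n : nat) : R := if n is 0 then pi else pi / 2.

Lemma chebh_gt0 n : 0 < chebh n.
Proof. by case: n => [|n]; rewrite /chebh ?divr_gt0// pi_gt0. Qed.

Lemma cosMcos (a b : R) : cos a * cos b = 2^-1 * (cos (a + b) + cos (a - b)).
Proof. by rewrite cosD cosB; field. Qed.

(** With truncated subtraction, [m - n + (n - m)] is the distance of [m] and [n]; a natural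
    frequency is what [intW_cos] accepts. *)
Lemma cos_distn m n y : cos (m%:R * y - n%:R * y) = cos ((m - n + (n - m))%N%:R * y) :> R.
Proof.
rewrite -mulrBl; have [mn|/ltnW nm] := leqP m n.
  rewrite (eqP mn) add0n natrB// -cosN; congr cos; ring.
by rewrite (eqP nm) addn0 natrB.
Qed.

Lemma dotW_chebyshev m n : dotW (chebyshevT m) (chebyshevT n) = if m == n then chebh n else 0 :> R.
Proof.
rewrite /dotW.
have -> : \int[mu]_(x in Omega) ((weight x)^-1 * (chebyshevT m x * chebyshevT n x)) =
  \int[mu]_(x in Om) (2^-1 * (winv x * cos ((m + n)%N%:R * acos x) +
     winv x * cos ((m - n + (n - m))%N%:R * acos x))).
  apply: eq_Rintegral => x _; rewrite /chebyshevT cosMcos cos_distn -mulrDl -natrD /winv; ring.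
have i k : intg Om (fun x => winv x * cos (k%:R * acos x)).
  apply: (@intgW _ 1); first exact: (chebyshevT_mfun k).
  by move=> x _; exact: cos_bound.
rewrite RintegralZl; [|exact: mOm|apply: intgD; [exact: mOm|exact: i|exact: i]].
rewrite RintegralD; [|exact: mOm|exact: i|exact: i].
rewrite !intW_cos /chebh.
case: eqP => [<-|mn].
  by rewrite subnn addn0; case: m => [|m]; rewrite ?addn0 ?addSn; field.
have -> : (m + n)%N = (m + n).-1.+1 by lia.
have -> : (m - n + (n - m))%N = (m - n + (n - m)).-1.+1 by lia.
by rewrite addr0 mulr0.
Qed.

End Weighted.

Lemma cvg_sum_nat (R : realType) (T : Type) (F : set_system T) (FF : Filter F)
    (f : nat -> T -> R) (l : nat -> R) N : (forall n, f n @ F --> l n) ->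
  (fun z => \sum_(0 <= n < N) f n z) @ F --> \sum_(0 <= n < N) l n.
Proof.
move=> fl; elim: N => [|N IH].
  by under eq_fun do rewrite big_geq//; rewrite big_geq//; exact: cvg_cst.
by under eq_fun do rewrite big_nat_recr//=; rewrite big_nat_recr//=; apply: cvgD.
Qed.

Section PrincipalValue.
Context {R : realType}.
Implicit Types (f g F G : R -> R) (y e : R).
Local Notation mu := (@lebesgue_measure R).
Local Notation Om := (@Omega R).

Context (x : R) (xO : Om x).

Let S e : set R := Om `&` [set xi | e < `|x - xi|].

Let Se e : 0 < e -> S e = `]-1, x - e[ `|` `]x + e, 1[.
Proof.
move=> e0; have := xO; rewrite OmE => /andP[x1 x2].
apply/seteqP; split => y; rewrite /S /= OmE !in_itv/=.
  move=> [/andP[y1 y2]]; rewrite ltr_normr => /orP[h|h]; [left|right]; lra.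
move=> [/andP[y1 y2]|/andP[y1 y2]]; (split; first by lra).
  by rewrite ltr_normr; apply/orP; left; lra.
by rewrite ltr_normr; apply/orP; right; lra.
Qed.

Let mS e : 0 < e -> mset (S e).
Proof. by move=> e0; rewrite Se//; apply: measurableU; exact: measurable_itv. Qed.

Let S_Om e : S e `<=` Om. Proof. exact: subIsetl. Qed.

Let small_e : \forall e \near 0^'+, [/\ 0 < e, -1 < x - e & x + e < 1].
Proof.
have := xO; rewrite OmE => /andP[x1 x2].
near=> e; split => //.
- have : e < x + 1 by near: e; apply: nbhs_right_lt; lra.
  by move=> ?; lra.
- have : e < 1 - x by near: e; apply: nbhs_right_lt; lra.
  by move=> ?; lra.
Unshelve. all: by end_near. Qed.

(** The two sides of the excised interval are handled separately; the puncture contributes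
    [F (x - e) - F (x + e)], in which a symmetric singularity of [F] can cancel. *)
Lemma punctured_FTC f F k l e : 0 < e -> -1 < x - e -> x + e < 1 ->
  intg (S e) f ->
  (forall y, Om y -> y != x -> is_derive y 1 F (f y)) ->
  (forall y, Om y -> y != x -> {for y, continuous f}) ->
  F y @[y --> (-1)^'+] --> k -> F y @[y --> 1^'-] --> l ->
  \int[mu]_(y in S e) f y = F (x - e) - F (x + e) + (l - k).
Proof.
move=> e0 xe1 xe2 fi dF cf Fk Fl.
have := xO; rewrite OmE => /andP[x1 x2].
have c0 y : Om y -> y != x -> {for y, continuous F}.
  by move=> yO yx; have := dF y yO yx; exact: is_derive_continuous.
have O1 : Om (x - e) by rewrite OmE; lra.
have O2 : Om (x + e) by rewrite OmE; lra.
move: (fi); rewrite Se// => fiU.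
have m1 : mset `]-1, x - e[ by exact: measurable_itv.
have m2 : mset `]x + e, 1[ by exact: measurable_itv.
rewrite Rintegral_setU//; last first.
  rewrite disj_set2E; apply/eqP; apply/seteqP; split => // y [].
  by rewrite /= !in_itv/= => /andP[h1 h2] /andP[h3 h4]; lra.
have sub1 y : y \in `]-1, x - e[ -> Om y /\ y != x.
  by rewrite OmE in_itv/= => /andP[h1 h2]; split; [apply/andP; split|]; lra.
have sub2 y : y \in `]x + e, 1[ -> Om y /\ y != x.
  by rewrite OmE in_itv/= => /andP[h1 h2]; split; [apply/andP; split|]; lra.
have i1 : intg `]-1, x - e[ f by apply: intgS (measurableU _ _ m1 m2) m1 _ fiU; exact: subsetUl.
have i2 : intg `]x + e, 1[ f by apply: intgS (measurableU _ _ m1 m2) m2 _ fiU; exact: subsetUr.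
have -> : \int[mu]_(y in `]-1, x - e[) f y = F (x - e) - k.
  apply: (@improper_FTC _ _ F) => //.
  - by move=> y /sub1[? ?]; exact: cf.
  - by move=> y /sub1[? ?]; exact: dF.
  - by apply: cvg_at_left_filter; apply: c0 => //; lra.
have -> : \int[mu]_(y in `]x + e, 1[) f y = l - F (x + e).
  apply: (@improper_FTC _ _ F) => //.
  - by move=> y /sub2[? ?]; exact: cf.
  - by move=> y /sub2[? ?]; exact: dF.
  - by apply: cvg_at_right_filter; apply: c0 => //; lra.
by ring.
Qed.

Let cvg_shift f (s : R) : {for x, continuous f} -> f (x + s * e) @[e --> 0^'+] --> f x.
Proof.
move=> cf; apply: cvg_at_right_filter.
have h : (fun e => x + s * e) e @[e --> (0:R)] --> x.
  rewrite -[X in _ --> X]addr0 -[X in _ --> _ + X](mulr0 s).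
  by apply: cvgD; [exact: cvg_cst|apply: cvgMr; exact: cvg_id].
exact: (cvg_comp _ _ h cf).
Qed.

Lemma cvg_excised g G M : continuous g -> (forall y, is_derive y 1 G (g y)) ->
  (forall y, `|g y| <= M) ->
  \int[mu]_(y in S e) (winv y * g (acos y)) @[e --> 0^'+] -->
  \int[mu]_(y in Om) (winv y * g (acos y)).
Proof.
move=> cg dG gM; rewrite (W_FTC cg dG gM).
have cG : continuous G by move=> y; exact: is_derive_continuous.
pose F y := - G (acos y).
have : F (x + (-1) * e) - F (x + 1 * e) + (- G 0 - - G pi) @[e --> 0^'+] --> G pi - G 0.
  rewrite [X in _ --> X](_ : _ = F x - F x + (- G 0 - - G pi)); last by ring.
  have cF : {for x, continuous F}.
    by apply: cvgN; apply: (@cvg_continuous _ _ _ _ (@acos R)) => //; exact: acos_continuous.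
  apply: cvgD; last exact: cvg_cst.
  by apply: cvgB; exact: cvg_shift.
apply: cvg_trans; apply: near_eq_cvg.
apply: filterS small_e => e [e0 h1 h2]; rewrite mulN1r mul1r.
apply/esym; apply: punctured_FTC => //.
- apply: (@intgS _ Om) => //; [exact: mOm|exact: mS|].
  by apply: (@intgW _ _ M) => [|y _]; [exact: acos_mfun|exact: gM].
- move=> y yO _; have -> : winv y * g (acos y) = - (g (acos y) * - winv y) by ring.
  by apply: is_deriveN; apply: (@is_derive1_comp _ G (@acos R)); exact: is_derive_acos.
- move=> y yO _; apply: cvgM; first exact: winv_continuous.
  by apply: (@cvg_continuous _ _ _ _ (@acos R)) => //; exact: acos_continuous.
- by apply: cvgN; apply: (@cvg_continuous _ _ _ _ (@acos R)) => //; exact: acos_cvgN1.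
- by apply: cvgN; apply: (@cvg_continuous _ _ _ _ (@acos R)) => //; exact: acos_cvg1.
Qed.

Let th := acos x.
Let th_itv : 0 < th < pi. Proof. exact: acos_Om. Qed.
Let cth : cos th = x. Proof. exact: acosK_Om. Qed.
Let sth : 0 < sin th. Proof. exact: sin_gt0_pi. Qed.

(* the primitive of 1 / (w(y) (x - y)) *)
Let pvF y := (sin th)^-1 * (ln (sin ((acos y + th) / 2)) *+ 2 - ln `|x - y|).

Let half_itv s : 0 <= s <= pi -> 0 < sin ((s + th) / 2).
Proof.
move=> /andP[s0 spi]; apply: sin_gt0_pi.
by have /andP[t0 tpi] := th_itv; lra.
Qed.

Let pvF_derive y : Om y -> y != x -> is_derive y 1 pvF (winv y * (x - y)^-1).
Proof.
move=> yO yx; set s := acos y.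
have /andP[s0 spi] : 0 < s < pi by exact: acos_Om.
have hs : 0 < sin ((s + th) / 2) by apply: half_itv; rewrite !ltW.
have xy0 : x - y != 0 by rewrite subr_eq0 eq_sym.
have d1 : is_derive y 1 (fun z => (acos z + th) / 2) (- winv y / 2).
  have -> : (fun z => (acos z + th) / 2) = (fun z => (2^-1 * acos z) + cst (th / 2) z).
    by apply/funext => z; rewrite /cst; field.
  have -> : - winv y / 2 = 2^-1 * - winv y + 0 by field.
  by apply: is_deriveD; apply: is_deriveZ; exact: is_derive_acos.
have d2 := @is_derive1_comp _ sin _ y _ _ (is_derive_sin _) d1.
have d3 := @is_derive1_comp _ (@ln R) (fun z => sin ((acos z + th) / 2)) y _ _ (is_derive1_ln hs) d2.
have d4 : is_derive y 1 (fun z => ln `|x - z|) (- (x - y)^-1).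
  have [yltx|xlty|/eqP] := ltgtP y x; last by rewrite (negbTE yx).
    have p : 0 < x - y by rewrite subr_gt0.
    have e1 : is_derive y 1 (fun z => x - z) (-1).
      have -> : (-1 : R) = 0 - 1 by rewrite sub0r.
      exact: is_deriveB.
    have := @is_derive1_comp _ (@ln R) (fun z => x - z) y _ _ (is_derive1_ln p) e1.
    rewrite mulrN1; apply: near_eq_is_derive.
    near=> z; rewrite /= gtr0_norm// subr_gt0; near: z; exact: lt_nbhsl.
  have p : 0 < y - x by rewrite subr_gt0.
  have e1 : is_derive y 1 (fun z => z - x) 1.
    by have := is_derive_affine 1 (- x) y; under eq_fun do rewrite mul1r.
  have := @is_derive1_comp _ (@ln R) (fun z => z - x) y _ _ (is_derive1_ln p) e1.
  rewrite mulr1 -invrN opprB; apply: near_eq_is_derive.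
  near=> z; rewrite /= distrC gtr0_norm// subr_gt0; near: z; exact: lt_nbhsr.
have -> : winv y * (x - y)^-1 = (sin th)^-1 * ((sin ((s + th) / 2))^-1 *
    (cos ((s + th) / 2) * (- winv y / 2)) *+ 2 - - (x - y)^-1).
  have wy : winv y = (sin s)^-1 by rewrite /winv weight_acos.
  have ys : y = cos s by rewrite acosK_Om.
  rewrite wy; have ss : 0 < sin s by apply: sin_gt0_pi; rewrite s0.
  have key : cos th - cos s = 2 * sin ((s + th) / 2) * sin ((s - th) / 2).
    have -> : cos th = cos ((s + th) / 2 - (s - th) / 2) by congr cos; field.
    have -> : cos s = cos ((s + th) / 2 + (s - th) / 2) by congr cos; field.
    by rewrite cosB cosD; ring.
  have key2 : sin s - sin th = 2 * cos ((s + th) / 2) * sin ((s - th) / 2).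
    have -> : sin th = sin ((s + th) / 2 - (s - th) / 2) by congr sin; field.
    have -> : sin s = sin ((s + th) / 2 + (s - th) / 2) by congr sin; field.
    by rewrite sinB sinD; ring.
  have xyE : x - y = 2 * sin ((s + th) / 2) * sin ((s - th) / 2) by rewrite -key cth -ys.
  have sd : sin ((s - th) / 2) != 0.
    by apply: contraNneq xy0 => h; rewrite xyE h mulr0.
  have -> : sin th = sin s - 2 * cos ((s + th) / 2) * sin ((s - th) / 2) by rewrite -key2; ring.
  rewrite xyE; field.
  rewrite sd (gt_eqF ss) (gt_eqF hs)/=.
  by rewrite -key2 subKr gt_eqF.
apply: is_deriveZ; apply: is_deriveB; exact: is_deriveMn.
Unshelve. all: by end_near. Qed.

Let ln_cvg (F : set_system R) (FF : Filter F) (h : R -> R) (l : R) :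
  0 < l -> h @ F --> l -> (fun z => ln (h z)) @ F --> ln l.
Proof. by move=> l0 hl; apply: (cvg_comp _ _ hl); exact: continuous_ln. Qed.

Let inner_cvg (F : set_system R) (FF : Filter F) (l : R) :
  @acos R @ F --> l -> (fun z => sin ((acos z + th) / 2)) @ F --> sin ((l + th) / 2).
Proof.
move=> hl; apply: (@cvg_continuous _ _ _ _ (fun z => (acos z + th) / 2) sin); last exact: continuous_sin.
by apply: cvgMl; apply: cvgD => //; exact: cvg_cst.
Qed.

Let pvF_cvg (F : set_system R) (FF : Filter F) (l z : R) : 0 <= l <= pi -> z != x ->
  @acos R @ F --> l -> id @ F --> z ->
  pvF @ F --> (sin th)^-1 * (ln (sin ((l + th) / 2)) *+ 2 - ln `|x - z|).
Proof.
move=> l0pi zx hl hz; apply: cvgMr; apply: cvgB.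
  by apply: cvgMn; apply: ln_cvg; [exact: half_itv|exact: inner_cvg].
apply: ln_cvg; first by rewrite normr_gt0 subr_eq0 eq_sym.
by apply: cvg_norm; apply: cvgB => //; exact: cvg_cst.
Qed.

(** The boundary values of [pvF] at 1 and at -1 agree, by 1 - x = 2 sin^2 (th / 2) and 1 + x = 2
    cos^2 (th / 2). This is why the principal value of 1 / w is 0. *)
Let pv_ends : ln (sin ((0 + th) / 2)) *+ 2 - ln `|x - 1| =
  ln (sin ((pi + th) / 2)) *+ 2 - ln `|x - -1|.
Proof.
have := xO; rewrite OmE => /andP[x1 x2].
have /andP[t0 tpi] := th_itv.
have -> : sin ((pi + th) / 2) = cos (th / 2).
  have -> : (pi + th) / 2 = th / 2 + pi / 2 by field.
  exact: sinDpihalf.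
rewrite add0r opprK distrC !gtr0_norm; [|lra|lra].
have s0 : 0 < sin (th / 2) by apply: sin_gt0_pi; lra.
have c0 : 0 < cos (th / 2) by apply: cos_gt0_pihalf; lra.
have e : cos th = cos (th / 2 + th / 2) by congr cos; field.
have sc := cos2Dsin2 (th / 2).
rewrite cosD cth in e.
rewrite !expr2 in sc.
have -> : 1 - x = 2 * (sin (th / 2) ^+ 2) by rewrite expr2; lra.
have -> : x + 1 = 2 * (cos (th / 2) ^+ 2) by rewrite expr2; lra.
by rewrite !lnM ?posrE ?exprn_gt0//; ring.
Qed.

Definition pvk n y := chebyshevT n y / (weight y * (x - y)).

Let pvkE n y : Om y -> y != x -> pvk n y = winv y * (chebyshevT n y * (x - y)^-1).
Proof.
move=> yO yx; rewrite /pvk /winv; field.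
by rewrite subr_eq0 eq_sym yx gt_eqF// weight_gt0.
Qed.

Let S_neq e y : 0 < e -> S e y -> Om y /\ y != x.
Proof.
move=> e0 [yO] /= h; split => //; apply: contraTneq h => ->.
by rewrite subrr normr0 -leNgt ltW.
Qed.

Let xV_continuous y : y != x -> {for y, continuous (fun z => (x - z)^-1)}.
Proof.
move=> yx; apply: cvgV; first by rewrite subr_eq0 eq_sym.
by apply: cvgB; [exact: cvg_cst|exact: cvg_id].
Qed.

Lemma pvk_intg n e : 0 < e -> -1 < x - e -> x + e < 1 -> intg (S e) (pvk n).
Proof.
move=> e0 h1 h2.
apply: (@eq_intg _ _ (fun y => (chebyshevT n y * (x - y)^-1) * winv y)); first exact: mS.
  by move=> y /(S_neq e0)[yO yx]; rewrite pvkE// mulrC.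
apply: (@intgM_bounded _ _ _ _ e^-1); first exact: mS.
- apply: measurable_funM.
    by apply: (measurable_funS mOm (@S_Om e)); exact: chebyshevT_mfun.
  rewrite Se//; apply/measurable_funU; [exact: measurable_itv|exact: measurable_itv|].
  by split; apply: itvoo_mfun => y; rewrite in_itv/= => /andP[h3 h4]; apply: xV_continuous; lra.
- move=> y yS; have [yO yx] := S_neq e0 yS; case: yS => _ /= he.
  rewrite normrM normfV -[e^-1]mul1r ler_pM ?invr_ge0// ?chebyshevT_bound//.
  by rewrite lef_pV2 ?posrE ?(ltW he)// (lt_trans e0).
- apply: (@intgS _ Om) => //; [exact: mOm|exact: mS|exact: winv_intg].
Qed.

Let pv0 : \int[mu]_(y in S e) pvk 0 y @[e --> 0^'+] --> (0 : R).
Proof.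
pose H y := ln (sin ((acos y + th) / 2)).
have cH : {for x, continuous H}.
  by apply: ln_cvg; [apply: half_itv; have /andP[? ?] := th_itv; rewrite !ltW|apply: inner_cvg; exact: acos_continuous].
have : (sin th)^-1 * ((H (x + (-1) * e) - H (x + 1 * e)) *+ 2) @[e --> 0^'+] --> (0 : R).
  rewrite [X in _ --> X](_ : _ = (sin th)^-1 * ((H x - H x) *+ 2)); last by rewrite subrr mul0rn mulr0.
  by apply: cvgMr; apply: cvgMn; apply: cvgB; exact: cvg_shift.
apply: cvg_trans; apply: near_eq_cvg.
apply: filterS small_e => e [e0 h1 h2]; rewrite mulN1r mul1r; apply/esym.
have := xO; rewrite OmE => /andP[x1 x2].
pose k := (sin th)^-1 * (ln (sin ((pi + th) / 2)) *+ 2 - ln `|x - -1|).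
pose l := (sin th)^-1 * (ln (sin ((0 + th) / 2)) *+ 2 - ln `|x - 1|).
transitivity (pvF (x - e) - pvF (x + e) + (l - k)); last first.
  (* Both [x - e] and [x + e] are at distance [e] from [x], so the logarithmic singularities cancel
     and only the continuous part [H] remains. *)
  rewrite /l /k pv_ends subrr addr0 /pvF /H.
  have -> : x - (x - e) = e by ring.
  have -> : x - (x + e) = - e by ring.
  by rewrite normrN; ring.
apply: punctured_FTC => //.
- exact: pvk_intg.
- move=> y yO yx; rewrite pvkE// /chebyshevT mul0r cos0 mul1r; exact: pvF_derive.
- move=> y yO yx.
  have c : {for y, continuous (fun z => winv z * (x - z)^-1)}.
    by apply: cvgM; [exact: winv_continuous|exact: xV_continuous].
  have e1 z : Om z -> z != x -> pvk 0 z = winv z * (x - z)^-1.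
    by move=> ? ?; rewrite pvkE// /chebyshevT mul0r cos0 mul1r.
  rewrite /prop_for /continuous_at e1//; apply: cvg_trans c; apply: near_eq_cvg.
  have nO : \forall z \near y, Om z.
    by apply: open_nbhs_nbhs; split => //; exact: interval_open.
  have nx : \forall z \near y, z != x.
    have [yltx|xlty|/eqP] := ltgtP y x; last by rewrite (negbTE yx).
      by near=> z; rewrite lt_eqF//; near: z; exact: lt_nbhsl.
    by near=> z; rewrite gt_eqF//; near: z; exact: lt_nbhsr.
  near=> z; apply/esym/e1; last by near: z; exact: nx.
  by near: z; exact: nO.
- by apply: pvF_cvg; [rewrite lexx pi_ge0|lra|exact: acos_cvgN1|exact: cvg_at_right_filter].
- by apply: pvF_cvg; [rewrite lexx pi_ge0|lra|exact: acos_cvg1|exact: cvg_at_left_filter].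
Unshelve. all: by end_near. Qed.

Let excised_cheb n : \int[mu]_(y in S e) (winv y * chebyshevT n y) @[e --> 0^'+] -->
  (if n is 0 then pi else 0).
Proof.
rewrite -intW_cos.
case: n => [|n].
  apply: (@cvg_excised (fun y => cos (0%:R * y)) id 1).
  - exact: cos_mul_continuous.
  - by move=> y; rewrite mul0r cos0; exact: is_derive_id.
  - by move=> y; exact: cos_bound.
apply: (@cvg_excised (fun y => cos (n.+1%:R * y)) (fun y => n.+1%:R^-1 * sin (n.+1%:R * y)) 1).
- exact: cos_mul_continuous.
- move=> y; have -> : cos (n.+1%:R * y) = n.+1%:R^-1 * (n.+1%:R * cos (n.+1%:R * y)).
    by rewrite mulKf// pnatr_eq0.
  by apply: is_deriveZ; exact: is_derive_sin_mul.
- by move=> y; exact: cos_bound.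
Qed.

Let wcheb_intg n e : 0 < e -> intg (S e) (fun y => winv y * chebyshevT n y).
Proof.
move=> e0; apply: (@intgS _ Om) => //; [exact: mOm|exact: mS|].
by apply: (@intgW _ _ 1) => [|y _]; [exact: chebyshevT_mfun|exact: chebyshevT_bound].
Qed.

Lemma chebyshevT0 y : chebyshevT 0 y = 1 :> R.
Proof. by rewrite /chebyshevT mul0r cos0. Qed.

Lemma chebyshevT1 y : Om y -> chebyshevT 1 y = y :> R.
Proof. by move=> yO; rewrite /chebyshevT mul1r acosK_Om. Qed.

Lemma chebyshevTS n y : Om y ->
  chebyshevT n.+2 y = 2 * y * chebyshevT n.+1 y - chebyshevT n y :> R.
Proof.
move=> yO; rewrite /chebyshevT.
have -> : n.+2%:R * acos y = n.+1%:R * acos y + acos y by rewrite -natr1; ring.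
have -> : n%:R * acos y = n.+1%:R * acos y - acos y by rewrite -natr1; ring.
by rewrite cosB cosD acosK_Om//; ring.
Qed.

(** Writing y = x - (x - y) turns a recurrence of the T_n into one of the truncated integrals, up to
    a regular integral whose limit is known. The same device gives the three-term version below. *)
Let pv1 e : 0 < e -> -1 < x - e -> x + e < 1 ->
  \int[mu]_(y in S e) pvk 1 y =
  x * \int[mu]_(y in S e) pvk 0 y - \int[mu]_(y in S e) (winv y * chebyshevT 0 y).
Proof.
move=> e0 h1 h2; have i := pvk_intg _ e0 h1 h2.
rewrite -RintegralZl; [|exact: mS|exact: i].
rewrite -RintegralB; [|exact: mS|apply: intgZ; [exact: mS|exact: i]|exact: wcheb_intg].
apply: eq_Rintegral => y; rewrite inE => /(S_neq e0)[yO yx].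
rewrite !pvkE// chebyshevT0 chebyshevT1//; field.
by rewrite subr_eq0 eq_sym.
Qed.

Let pvSS n e : 0 < e -> -1 < x - e -> x + e < 1 ->
  \int[mu]_(y in S e) pvk n.+2 y =
  2 * x * \int[mu]_(y in S e) pvk n.+1 y - 2 * \int[mu]_(y in S e) (winv y * chebyshevT n.+1 y)
    - \int[mu]_(y in S e) pvk n y.
Proof.
move=> e0 h1 h2; have i k := @pvk_intg k _ e0 h1 h2.
have iz k (c : R) : intg (S e) (fun y => c * pvk k y) by apply: intgZ; [exact: mS|exact: i].
have jz k (c : R) : intg (S e) (fun y => c * (winv y * chebyshevT k y)).
  by apply: intgZ; [exact: mS|exact: wcheb_intg].
rewrite -RintegralZl; [|exact: mS|exact: i].
rewrite -RintegralZl; [|exact: mS|exact: wcheb_intg].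
rewrite -RintegralB; [|exact: mS|exact: iz|exact: jz].
rewrite -RintegralB; [|exact: mS|apply: intgB; [exact: mS|exact: iz|exact: jz]|exact: i].
apply: eq_Rintegral => y; rewrite inE => /(S_neq e0)[yO yx].
rewrite !pvkE// chebyshevTS//; field.
by rewrite subr_eq0 eq_sym.
Qed.

(** The sines satisfy the same three-term recurrence as the T_n, so the induction carries two
    consecutive indices. The regular correction is pi for [n = 0] and tends to 0 afterwards. *)
Lemma cvg_pvk n : \int[mu]_(y in S e) pvk n y @[e --> 0^'+] --> - (pi * sin (n%:R * th) / sin th).
Proof.
suff [] : (\int[mu]_(y in S e) pvk n y @[e --> 0^'+] --> - (pi * sin (n%:R * th) / sin th)) /\
  (\int[mu]_(y in S e) pvk n.+1 y @[e --> 0^'+] --> - (pi * sin (n.+1%:R * th) / sin th)) by [].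
have sn0 : sin th != 0 by rewrite gt_eqF.
elim: n => [|n [IH1 IH2]]; split => //.
- by rewrite mul0r sin0 mulr0 mul0r oppr0; exact: pv0.
- rewrite mul1r mulfK//.
  have : x * (\int[mu]_(y in S e) pvk 0 y) - \int[mu]_(y in S e) (winv y * chebyshevT 0 y)
      @[e --> 0^'+] --> - pi.
    rewrite -[X in _ --> X]add0r -[X in _ --> X + _](mulr0 x).
    by apply: cvgB; [apply: cvgMr; exact: pv0|exact: (@excised_cheb 0%N)].
  apply: cvg_trans; apply: near_eq_cvg.
  by apply: filterS small_e => e [e0 h1 h2]; rewrite pv1.
- have : 2 * x * (\int[mu]_(y in S e) pvk n.+1 y)
      - 2 * (\int[mu]_(y in S e) (winv y * chebyshevT n.+1 y))
      - \int[mu]_(y in S e) pvk n y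
      @[e --> 0^'+] --> - (pi * sin (n.+2%:R * th) / sin th).
    have -> : - (pi * sin (n.+2%:R * th) / sin th) =
      2 * x * (- (pi * sin (n.+1%:R * th) / sin th)) - 2 * 0 - - (pi * sin (n%:R * th) / sin th).
      have -> : n.+2%:R * th = n.+1%:R * th + th by rewrite -natr1; ring.
      have -> : n%:R * th = n.+1%:R * th - th by rewrite -natr1; ring.
      by rewrite sinB sinD cth; field.
    apply: cvgB => //; apply: cvgB; first exact: cvgMr.
    by apply: cvgMr; exact: (@excised_cheb n.+1).
  apply: cvg_trans; apply: near_eq_cvg.
  by apply: filterS small_e => e [e0 h1 h2]; rewrite pvSS.
Qed.

Lemma pv_integral_cheb (a : nat -> R) N :
  pv_integral (fun y => \sum_(0 <= n < N) a n * chebyshevT n y) x =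
  - (pi / weight x * \sum_(0 <= n < N) a n * sin (n%:R * acos x)).
Proof.
have -> : - (pi / weight x * \sum_(0 <= n < N) a n * sin (n%:R * acos x)) =
  \sum_(0 <= n < N) a n * (- (pi * sin (n%:R * th) / sin th)).
  rewrite mulr_sumr -sumrN; apply: eq_bigr => n _.
  by rewrite weight_acos// -/th; ring.
apply/cvg_lim => //.
have : \sum_(0 <= n < N) a n * (\int[mu]_(y in S e) pvk n y) @[e --> 0^'+] -->
    \sum_(0 <= n < N) a n * (- (pi * sin (n%:R * th) / sin th)).
  by apply: cvg_sum_nat => n; apply: cvgMr; exact: cvg_pvk.
apply: cvg_trans; apply: near_eq_cvg.
apply: filterS small_e => e [e0 h1 h2]; apply/esym.
have i k := @pvk_intg k _ e0 h1 h2.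
transitivity (\int[mu]_(y in S e) \sum_(0 <= n < N) a n * pvk n y).
  by apply: eq_Rintegral => y _; rewrite mulr_suml; apply: eq_bigr => n _; rewrite /pvk mulrA.
rewrite Rintegral_sum; [|exact: mS|by move=> k; apply: intgZ; [exact: mS|exact: i]].
by apply: eq_bigr => n _; rewrite RintegralZl//; [exact: mS|exact: i].
Qed.

End PrincipalValue.

(** * The operator on finite Chebyshev sums *)

Section PairA.
Context {R : realType}.
Implicit Types (f g F G eta phi psi : R -> R) (x y : R) (a b : nat -> R).
Local Notation mu := (@lebesgue_measure R).
Local Notation Om := (@Omega R).

Definition coef phi n := dotW phi (chebyshevT n) / chebh n.

Lemma chebyshev_sumE phi N x :
  chebyshev_sum phi N x = \sum_(0 <= n < N.+1) coef phi n * chebyshevT n x.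
Proof. by apply: eq_bigr => n _; rewrite dotW_chebyshev eqxx. Qed.

(** The conjugate sum: w / pi times the principal value of [trig_cos a N] is [- trig_sin a N], and
    differentiating brings out the factors n. *)
Definition trig_sin a N x := \sum_(0 <= n < N) a n * sin (n%:R * acos x).
Definition trig_cos a N x := \sum_(0 <= n < N) a n * chebyshevT n x.

Lemma segment_bounded f (c d : R) : c <= d -> continuous f ->
  exists M, forall x, x \in `[c, d] -> `|f x| <= M.
Proof.
move=> cd cf; have [//||z _ zM] := @EVT_max R (fun x => `|f x|) c d.
  by apply: continuous_subspaceT => x; apply: cvg_norm; exact: cf.
by exists `|f z|.
Qed.

Lemma is_derive_sum_nat (h dh : nat -> R -> R) N x :
  (forall n, is_derive x 1 (h n) (dh n x)) ->
  is_derive x 1 (fun y => \sum_(0 <= n < N) h n y) (\sum_(0 <= n < N) dh n x).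
Proof.
move=> hd; elim: N => [|N IH].
  rewrite big_geq//; have -> : (fun y => \sum_(0 <= n < 0) h n y) = cst 0.
    by apply/funext => y; rewrite big_geq.
  exact: is_derive_cst.
rewrite big_nat_recr//=.
have -> : (fun y => \sum_(0 <= n < N.+1) h n y) = (fun y => \sum_(0 <= n < N) h n y + h N y).
  by apply/funext => y; rewrite big_nat_recr.
exact: is_deriveD.
Qed.

Lemma trig_sin_derive a N x : Om x ->
  is_derive x 1 (trig_sin a N) (- (winv x * trig_cos (fun n => n%:R * a n) N x)).
Proof.
move=> xO.
have -> : - (winv x * trig_cos (fun n => n%:R * a n) N x) =
  \sum_(0 <= n < N) a n * ((n%:R * cos (n%:R * acos x)) * - winv x).
  by rewrite mulr_sumr -sumrN; apply: eq_bigr => n _; rewrite /chebyshevT; ring.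
apply: (@is_derive_sum_nat (fun n y => a n * sin (n%:R * acos y))
  (fun n x => a n * ((n%:R * cos (n%:R * acos x)) * - winv x))) => n.
apply: is_deriveZ; apply: (@is_derive1_comp _ (fun z => sin (n%:R * z)) (@acos R)).
  exact: is_derive_sin_mul.
Qed.

Lemma trig_cos_bound a N x : `|trig_cos a N x| <= \sum_(0 <= n < N) `|a n|.
Proof.
apply: le_trans (ler_norm_sum _ _ _) _; apply: ler_sum => n _.
by rewrite normrM ler_piMr// chebyshevT_bound.
Qed.

Lemma trig_sin_bound a N x : `|trig_sin a N x| <= \sum_(0 <= n < N) `|a n|.
Proof.
apply: le_trans (ler_norm_sum _ _ _) _; apply: ler_sum => n _.
by rewrite normrM ler_piMr// sin_bound.
Qed.

Lemma chebyshevT_continuous n x : Om x -> {for x, continuous (@chebyshevT R n)}.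
Proof.
move=> xO; apply: (@cvg_continuous _ _ _ _ (@acos R) (fun z => cos (n%:R * z))).
  exact: acos_continuous.
exact: cos_mul_continuous.
Qed.

Lemma trig_cos_continuous a N x : Om x -> {for x, continuous (trig_cos a N)}.
Proof.
move=> xO; apply: cvg_sum_nat => n; apply: cvgMr; exact: chebyshevT_continuous.
Qed.

Lemma trig_cos_mfun a N : mfun Om (trig_cos a N).
Proof. by apply: Om_mfun => x xO; exact: trig_cos_continuous. Qed.

Lemma wtrig_cos_intg a N : intg Om (fun x => winv x * trig_cos a N x).
Proof.
apply: (@intgW _ _ (\sum_(0 <= n < N) `|a n|)); first exact: trig_cos_mfun.
by move=> x _; exact: trig_cos_bound.
Qed.

(** Integration by parts against [eta]. The sine sum is not differentiable at -1 and 1, but it is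
    bounded and [eta] tends to 0 there, so the boundary terms vanish. *)
Lemma calA_density a N :
  is_density (calA (trig_cos a N)) (fun x => winv x * trig_cos (fun n => n%:R * a n) N x).
Proof.
split.
  apply: open_integrable_locally; first exact: interval_open.
  exact: wtrig_cos_intg.
move=> eta [seta _ eta_sub].
set g := fun x => winv x * trig_cos (fun n => n%:R * a n) N x.
set Q := trig_sin a N.
have dQ x : Om x -> is_derive x 1 Q (- g x) by exact: trig_sin_derive.
have sdeta := smooth_derive1 seta.
have ceta := smooth_continuous seta; have cdeta := smooth_continuous sdeta.
have cQ x : Om x -> {for x, continuous Q} by move=> /dQ; exact: is_derive_continuous.
have mQ : mfun Om Q by exact: Om_mfun.
have cg x : Om x -> {for x, continuous g}.
  by move=> xO; apply: cvgM; [exact: winv_continuous|exact: trig_cos_continuous].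
have gi : intg Om g by exact: wtrig_cos_intg.
have N11 : -1 <= 1 :> R by lra.
have [M1 hM1] := segment_bounded N11 ceta.
have [M2 hM2] := segment_bounded N11 cdeta.
have Om_in x : Om x -> x \in `[-1, 1] by exact: subset_itv_oo_cc.
have i1 : intg Om (fun x => g x * eta x).
  apply: (@eq_intg _ _ (fun x => eta x * g x)); first exact: mOm.
    by move=> x _; rewrite mulrC.
  apply: (@intgM_bounded _ _ _ _ M1) => //; [exact: mOm| |by move=> x /Om_in; exact: hM1].
  by apply: continuous_mfun => //; exact: mOm.
have i2 : intg Om (fun x => Q x * derive1 eta x).
  apply: (@intgM_bounded _ _ _ _ (\sum_(0 <= n < N) `|a n|)); first exact: mOm.
  - exact: mQ.
  - by move=> x _; exact: trig_sin_bound.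
  - apply: (@intgS _ `[-1, 1]); [exact: measurable_itv|exact: mOm|exact: subset_itv_oo_cc|].
    by apply: intg_segment; exact: continuous_subspaceT.
have eta_end z : ~ Om z -> eta z = 0.
  move=> zO; apply/eqP/negPn/negP => ez; apply: zO; apply: eta_sub.
  exact: subset_closure.
have Qeta (z : R) (F : set_system R) (FF : Filter F) : ~ Om z -> id @ F --> z -> (fun x => Q x * eta x) @ F --> 0.
  move=> zO Fz; pose M := \sum_(0 <= n < N) `|a n|.
  have h : (fun x => M * `|eta x|) @ F --> 0.
    rewrite -[X in _ --> X](mulr0 M); apply: cvgMr.
    rewrite -(normr0 R) -(eta_end _ zO); apply: cvg_norm.
    exact: (cvg_comp _ _ Fz (ceta z)).
  apply/cvgr0Pnorm_le => e e0.
  have /cvgr0Pnorm_le/(_ e e0) := h.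
  apply: filterS => x hx; apply: le_trans hx.
  rewrite normrM (@ger0_norm _ (_ * `|_|)) ?mulr_ge0 ?sumr_ge0// ler_wpM2r//.
  exact: trig_sin_bound.
have key : \int[mu]_(x in Om) (Q x * derive1 eta x - g x * eta x) = 0.
  rewrite -[RHS](subrr 0).
  apply: (@improper_FTC _ _ (fun x => Q x * eta x)) => //.
  - by apply: intgB => //; exact: mOm.
  - move=> x xO; apply: cvgB; apply: cvgM; [exact: cQ|exact: cdeta|exact: cg|exact: ceta].
  - move=> x xO; have -> : Q x * derive1 eta x - g x * eta x = Q x *: derive1 eta x + eta x *: - g x.
      by rewrite /GRing.scale/=; ring.
    by apply: is_deriveM; [exact: dQ|apply: is_derive_derive1; exact: smooth_derivable].
  - apply: (@Qeta (-1)); first by rewrite OmE ltxx.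
    exact: cvg_at_right_filter.
  - apply: (@Qeta 1); first by rewrite OmE ltxx andbF.
    exact: cvg_at_left_filter.
move: key; rewrite RintegralB//; last exact: mOm.
move=> /eqP; rewrite subr_eq0 => /eqP key.
have cancel (u p s d : R) : u != 0 -> p != 0 -> u / p * - (p / u * s) * d = - (s * d).
  by move=> u0 p0; field; rewrite u0.
rewrite /dotL2 -key /calA -RintegralN; first last.
- apply: (@eq_intg _ _ (fun x => - (Q x * derive1 eta x))); first exact: mOm.
    move=> x xO; rewrite pv_integral_cheb// -/(trig_sin _ _ _) -/Q.
    by rewrite cancel ?gt_eqF ?pi_gt0 ?weight_gt0.
  by apply: intgN => //; exact: mOm.
- exact: mOm.
apply: eq_Rintegral => x; rewrite inE => xO.
rewrite pv_integral_cheb// -/(trig_sin _ _ _) -/Q.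
by rewrite cancel ?gt_eqF ?pi_gt0 ?weight_gt0// opprK.
Qed.

Lemma Rintegral_ae f g D : mset D -> mfun D f -> mfun D g ->
  {ae mu, forall x, D x -> f x = g x} -> \int[mu]_(x in D) f x = \int[mu]_(x in D) g x.
Proof.
move=> mD mf mg fg; congr fine; apply: ae_eq_integral => //.
- exact/measurable_EFinP.
- exact/measurable_EFinP.
- by apply: aeS fg => x h Dx /=; rewrite h.
Qed.

Lemma sum_nat_delta (c : nat -> R) m N :
  \sum_(0 <= n < N) (if m == n then c n else 0) = if (m < N)%N then c m else 0.
Proof.
elim: N => [|N IH]; first by rewrite big_geq.
rewrite big_nat_recr//= IH ltnS [(m <= N)%N]leq_eqVlt; case: eqP => [->|_] /=.
  by rewrite ltnn add0r.
by rewrite addr0.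
Qed.

Lemma trig_cos_dot a b N : \int[mu]_(x in Om) (winv x * trig_cos a N x * trig_cos b N x) =
  \sum_(0 <= n < N) a n * b n * chebh n.
Proof.
have i m n : intg Om (fun x => winv x * (chebyshevT m x * chebyshevT n x)).
  apply: (@intgW _ _ 1); first by apply: measurable_funM; exact: chebyshevT_mfun.
  by move=> x _; rewrite normrM -[1]mulr1 ler_pM// chebyshevT_bound.
have iz m n (c : R) : intg Om (fun x => c * (winv x * (chebyshevT m x * chebyshevT n x))).
  by apply: intgZ; [exact: mOm|exact: i].
transitivity (\int[mu]_(x in Om) \sum_(0 <= m < N) \sum_(0 <= n < N)
   a m * b n * (winv x * (chebyshevT m x * chebyshevT n x))).
  apply: eq_Rintegral => x _; rewrite -mulrA mulr_suml mulr_sumr; apply: eq_bigr => m _.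
  by rewrite !mulr_sumr; apply: eq_bigr => n _; ring.
rewrite Rintegral_sum; [|exact: mOm|by move=> m; apply: intg_sum; [exact: mOm|move=> n; exact: iz]].
apply: eq_big_nat => m /andP[_ mN].
rewrite Rintegral_sum; [|exact: mOm|by move=> n; exact: iz].
rewrite (eq_bigr (fun n => if m == n then a m * b n * chebh n else 0)); last first.
  move=> n _; rewrite RintegralZl; [|exact: mOm|exact: i].
  have := dotW_chebyshev m n; rewrite /dotW => ->.
  by case: eqP => _; rewrite ?mulr0// => ->.
by rewrite sum_nat_delta mN.
Qed.

End PairA.

(** * The spaces L^2, L^2_w^-1 and H^1/2_w^-1 *)

Section WeightedL2.
Context {R : realType}.
Implicit Types (f g h : R -> R) (x : R).
Local Notation mu := (@lebesgue_measure R).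
Local Notation Om := (@Omega R).

(** Stated for a quadratic polynomial in [t], so that it serves the weighted inner products, the
    form [pa] and the tails of [pa] alike. *)
Lemma cauchy_schwarz_abstract (A B C : R) : 0 <= A -> 0 <= B ->
  (forall t, 0 <= A + 2 * t * C + t ^+ 2 * B) -> `|C| <= Num.sqrt A * Num.sqrt B.
Proof.
move=> A0 B0 H; rewrite -sqrtrM// -sqrtr_sqr ler_wsqrtr//.
have [Bz|Bn0] := eqVneq B 0.
  rewrite Bz mulr0.
  have [->|Cn0] := eqVneq C 0; first by rewrite expr0n.
  exfalso.
  (* For [B = 0] the polynomial is affine, and this [t] gives it the value -1. *)
  have := H (- (A + 1) / (2 * C)); rewrite Bz mulr0 addr0.
  have -> : 2 * (- (A + 1) / (2 * C)) * C = - (A + 1) by field.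
  by lra.
have Bp : 0 < B by rewrite lt_neqAle eq_sym Bn0.
(* The minimiser of the quadratic polynomial. *)
have := H (- C / B).
have -> : A + 2 * (- C / B) * C + (- C / B) ^+ 2 * B = A - C ^+ 2 / B by field.
by rewrite subr_ge0 ler_pdivrMr.
Qed.

Context (rho : R -> R) (mrho : mfun Om rho) (rho_gt0 : forall x, Om x -> 0 < rho x).

(** One development for a positive weight, used with [one] for L^2 and with [winv] for the weighted
    space. *)
Definition dotr f g := \int[mu]_(x in Om) (rho x * (f x * g x)).
Definition L2r f := mfun Om f /\ intg Om (fun x => rho x * (f x * f x)).

Lemma dotr_sym f g : dotr f g = dotr g f.
Proof. by apply: eq_Rintegral => x _; rewrite [f x * _]mulrC. Qed.

Lemma L2r_mul f g : L2r f -> L2r g -> intg Om (fun x => rho x * (f x * g x)).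
Proof.
move=> [mf fi] [mg gi].
apply: (@le_intg _ _ _ (fun x => rho x * (f x * f x) + rho x * (g x * g x))).
- exact: mOm.
- by apply: measurable_funM => //; exact: measurable_funM.
- by apply: intgD => //; exact: mOm.
- move=> x xO; rewrite -mulrDr normrM (gtr0_norm (rho_gt0 xO)) ler_pM2l ?rho_gt0//.
  rewrite ler_norml; apply/andP; split; nra.
Qed.

Lemma L2rZ (k : R) f : L2r f -> L2r (fun x => k * f x).
Proof.
move=> [mf fi]; split; first exact: measurable_funM.
apply: (@eq_intg _ _ (fun x => k ^+ 2 * (rho x * (f x * f x)))); first exact: mOm.
  by move=> x _; ring.
by apply: intgZ => //; exact: mOm.
Qed.

Lemma L2rD f g : L2r f -> L2r g -> L2r (fun x => f x + g x).
Proof.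
move=> Lf Lg; have fg := L2r_mul Lf Lg; have [[mf fi] [mg gi]] := (Lf, Lg).
split; first exact: measurable_funD.
apply: (@eq_intg _ _ (fun x => rho x * (f x * f x) + rho x * (g x * g x) + 2 * (rho x * (f x * g x)))).
- exact: mOm.
- by move=> x _; ring.
- by apply: intgD; [exact: mOm|apply: intgD => //; exact: mOm|apply: intgZ => //; exact: mOm].
Qed.

Lemma L2rB f g : L2r f -> L2r g -> L2r (fun x => f x - g x).
Proof.
move=> Lf Lg; have := L2rD Lf (L2rZ (-1) Lg).
by under eq_fun do rewrite mulN1r.
Qed.

Lemma eq_L2r f g : (forall x, Om x -> f x = g x) -> L2r f -> L2r g.
Proof.
move=> fg [mf fi]; split.
  by apply: eq_measurable_fun mf => x; rewrite inE; exact: fg.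
by apply: eq_intg fi; [exact: mOm|move=> x xO; rewrite fg].
Qed.

Lemma dotrDl f g h : L2r f -> L2r g -> L2r h -> dotr (fun x => f x + g x) h = dotr f h + dotr g h.
Proof.
move=> Lf Lg Lh; rewrite /dotr -RintegralD; [|exact: mOm|exact: L2r_mul|exact: L2r_mul].
by apply: eq_Rintegral => x _; ring.
Qed.

Lemma dotrBl f g h : L2r f -> L2r g -> L2r h -> dotr (fun x => f x - g x) h = dotr f h - dotr g h.
Proof.
move=> Lf Lg Lh; rewrite /dotr -RintegralB; [|exact: mOm|exact: L2r_mul|exact: L2r_mul].
by apply: eq_Rintegral => x _; ring.
Qed.

Lemma dotrZl (k : R) f h : L2r f -> L2r h -> dotr (fun x => k * f x) h = k * dotr f h.
Proof.
move=> Lf Lh; rewrite /dotr -RintegralZl; [|exact: mOm|exact: L2r_mul].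
by apply: eq_Rintegral => x _; ring.
Qed.

Lemma dotrBr f g h : L2r f -> L2r g -> L2r h -> dotr h (fun x => f x - g x) = dotr h f - dotr h g.
Proof. by move=> Lf Lg Lh; rewrite dotr_sym dotrBl// ![dotr h _]dotr_sym. Qed.

Lemma dotr_ge0 f : 0 <= dotr f f.
Proof. by apply: Rintegral_ge0 => x xO; rewrite mulr_ge0 ?(ltW (rho_gt0 xO))// -expr2 sqr_ge0. Qed.

Lemma dotr_addsq (t : R) f g : L2r f -> L2r g ->
  dotr (fun x => f x + t * g x) (fun x => f x + t * g x) =
  dotr f f + 2 * t * dotr f g + t ^+ 2 * dotr g g.
Proof.
move=> Lf Lg; have Lt := L2rZ t Lg; have LD := L2rD Lf Lt.
rewrite dotrDl// [dotr f _]dotr_sym [dotr _ (fun x => f x + _)]dotr_sym.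
rewrite !dotrDl// !dotrZl// [dotr f (fun x => t * _)]dotr_sym [dotr g (fun x => t * _)]dotr_sym.
by rewrite !dotrZl// [dotr g f]dotr_sym; ring.
Qed.

Lemma dotr_subsq f g : L2r f -> L2r g ->
  dotr (fun x => f x - g x) (fun x => f x - g x) = dotr f f - 2 * dotr f g + dotr g g.
Proof.
move=> Lf Lg; have LB := L2rB Lf Lg.
by rewrite dotrBl// ![dotr _ (fun x => f x - _)]dotr_sym !dotrBl// [dotr g f]dotr_sym; ring.
Qed.

Lemma dotr_CS f g : L2r f -> L2r g -> `|dotr f g| <= Num.sqrt (dotr f f) * Num.sqrt (dotr g g).
Proof.
move=> Lf Lg; apply: cauchy_schwarz_abstract; [exact: dotr_ge0|exact: dotr_ge0|].
by move=> t; rewrite -dotr_addsq//; exact: dotr_ge0.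
Qed.

Lemma L2rP f : mfun Om f ->
  (\int[mu]_(x in Om) (rho x * (f x * f x))%:E < +oo)%E -> L2r f.
Proof.
move=> mf fin; split => //; apply/integrableP; split.
  by apply/measurable_EFinP; apply: measurable_funM => //; exact: measurable_funM.
apply: le_lt_trans fin; rewrite le_eqVlt; apply/orP; left; apply/eqP.
apply: eq_integral => x; rewrite inE => xO /=; rewrite ger0_norm//.
by rewrite mulr_ge0 ?(ltW (rho_gt0 xO))// -expr2 sqr_ge0.
Qed.

Lemma L2r_EFin f : L2r f -> (\int[mu]_(x in Om) (rho x * (f x * f x))%:E = (dotr f f)%:E)%E.
Proof.
move=> [mf fi]; rewrite /dotr /Rintegral fineK//; apply: integrable_fin_num fi.
exact: mOm.
Qed.

Lemma dotr_eq0 f : L2r f -> dotr f f = 0 -> eq_ae_Omega f (fun=> 0).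
Proof.
move=> Lf h; have := L2r_EFin Lf; rewrite h => h0.
have [mf fi] := Lf.
have := @ae_eq_integral_abs _ _ _ mu Om mOm (fun x => (rho x * (f x * f x))%:E) (measurable_int _ fi).
move=> [+ _]; have -> : (\int[mu]_(x in Om) `|(rho x * (f x * f x))%:E| = 0)%E.
  apply: etrans h0; apply: eq_integral => x; rewrite inE => xO /=; rewrite ger0_norm//.
  by rewrite mulr_ge0 ?(ltW (rho_gt0 xO))// -expr2 sqr_ge0.
move=> /(_ erefl); apply: aeS => x hx xO; move: (hx xO) => /eqP.
by rewrite eqe mulf_eq0 (gt_eqF (rho_gt0 xO))/= mulf_eq0 orbb => /eqP.
Qed.

Lemma dotr_ae0 f g : {ae mu, forall x, Om x -> f x * g x = 0} -> mfun Om f -> mfun Om g -> dotr f g = 0.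
Proof.
move=> h mf mg; rewrite /dotr (@Rintegral_ae _ _ (fun=> 0)).
- by rewrite Rintegral_cst ?mul0r//; exact: mOm.
- exact: mOm.
- by apply: measurable_funM => //; exact: measurable_funM.
- exact: measurable_cst.
- by apply: aeS h => x hx xO; rewrite hx// mulr0.
Qed.

Lemma bounded_L2r f M : intg Om rho -> mfun Om f -> (forall x, Om x -> `|f x| <= M) -> L2r f.
Proof.
move=> ri mf fM; split => //.
apply: (@eq_intg _ _ (fun x => f x * f x * rho x)); [exact: mOm|by move=> x _; ring|].
apply: (@intgM_bounded _ _ _ _ (M * M)); [exact: mOm|exact: measurable_funM| |exact: ri].
by move=> x xO; rewrite normrM ler_pM// fM.
Qed.

End WeightedL2.

Section Spaces.
Context {R : realType}.
Implicit Types (f g h phi psi : R -> R) (x : R).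
Local Notation mu := (@lebesgue_measure R).
Local Notation Om := (@Omega R).

Definition one : R -> R := fun=> 1.
Definition L2 f := L2r one f.
Definition L2W f := L2r winv f.

Lemma one_mfun : mfun Om one. Proof. exact: measurable_cst. Qed.
Lemma one_gt0 x : Om x -> 0 < one x. Proof. by rewrite /one. Qed.

Lemma dotL2E f g : dotL2 f g = dotr one f g.
Proof. by apply: eq_Rintegral => x _; rewrite mul1r. Qed.

Lemma sqnormL2E f : (sqnormL2 f = \int[mu]_(x in Om) (one x * (f x * f x))%:E)%E.
Proof. by apply: eq_integral => x _; rewrite mul1r expr2. Qed.

Lemma sqnormWE f : (sqnormW f = \int[mu]_(x in Om) (winv x * (f x * f x))%:E)%E.
Proof. by apply: eq_integral => x _; rewrite expr2. Qed.

Lemma inL2P f : inL2 f <-> L2 f.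
Proof.
split=> [[mf fin]|Lf].
  by apply: L2rP; [exact: one_mfun|exact: one_gt0|exact: mf|rewrite -sqnormL2E].
split; first by case: Lf.
by rewrite sqnormL2E (L2r_EFin Lf) ltry.
Qed.

Lemma sqnormL2_dot f : L2 f -> sqnormL2 f = (dotL2 f f)%:E.
Proof. by move=> Lf; rewrite sqnormL2E (L2r_EFin Lf) dotL2E. Qed.

Lemma sqnormW_dot f : L2W f -> sqnormW f = (dotW f f)%:E.
Proof. by move=> Lf; rewrite sqnormWE (L2r_EFin Lf). Qed.

Lemma sqnormW_ge0 f : (0 <= sqnormW f)%E.
Proof.
apply: integral_ge0 => x xO; rewrite lee_fin mulr_ge0 ?sqr_ge0//.
by rewrite ltW// winv_gt0.
Qed.

Lemma L2W_L2 f : L2W f -> L2 f.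
Proof.
move=> [mf fi]; split => //; apply: (le_intg mOm _ fi).
  by apply: measurable_funM; [exact: one_mfun|exact: measurable_funM].
move=> x xO; rewrite /one mul1r ger0_norm -?expr2 ?sqr_ge0// ler_peMl ?sqr_ge0//.
exact: winv_ge1.
Qed.

Lemma dotL2_le_dotW f : L2W f -> dotL2 f f <= dotW f f.
Proof.
move=> Lf; have [mf fi] := Lf; have [_ fi1] := L2W_L2 Lf.
rewrite dotL2E; apply: le_Rintegral => //; first exact: mOm.
move=> x xO; rewrite -/(winv x) ler_wpM2r// -?expr2 ?sqr_ge0//; exact: winv_ge1.
Qed.

Lemma chebyshevT_L2W n : L2W (chebyshevT n).
Proof.
apply: (@bounded_L2r _ _ _ 1); [exact: winv_intg|exact: chebyshevT_mfun|].
by move=> x _; exact: chebyshevT_bound.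
Qed.

Lemma coefD f g n : L2W f -> L2W g -> coef (fun x => f x + g x) n = coef f n + coef g n.
Proof.
move=> Lf Lg; rewrite /coef -mulrDl; congr (_ / _).
by apply: dotrDl => //; [exact: winv_mfun|exact: winv_gt0|exact: chebyshevT_L2W].
Qed.

Lemma coefB f g n : L2W f -> L2W g -> coef (fun x => f x - g x) n = coef f n - coef g n.
Proof.
move=> Lf Lg; rewrite /coef -mulrBl; congr (_ / _).
by apply: dotrBl => //; [exact: winv_mfun|exact: winv_gt0|exact: chebyshevT_L2W].
Qed.

Lemma coefZ (k : R) f n : L2W f -> coef (fun x => k * f x) n = k * coef f n.
Proof.
move=> Lf; rewrite /coef mulrA; congr (_ / _).
by apply: dotrZl => //; [exact: winv_mfun|exact: winv_gt0|exact: chebyshevT_L2W].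
Qed.

Lemma L2WD f g : L2W f -> L2W g -> L2W (fun x => f x + g x).
Proof. by apply: L2rD; [exact: winv_mfun|exact: winv_gt0]. Qed.

Lemma L2WB f g : L2W f -> L2W g -> L2W (fun x => f x - g x).
Proof. by apply: L2rB; [exact: winv_mfun|exact: winv_gt0]. Qed.

Lemma L2WZ (k : R) f : L2W f -> L2W (fun x => k * f x).
Proof. exact: L2rZ. Qed.

(* Partial sums of the pairing (A phi, psi); [pa] is their limit, and [Hs] is H^{1/2}. *)
Definition pA phi psi N := \sum_(0 <= n < N) n%:R * coef phi n * coef psi n * chebh n.

Lemma pA_sym phi psi N : pA phi psi N = pA psi phi N.
Proof. by apply: eq_bigr => n _; ring. Qed.

(** [density] is a choice determined only up to a null set, hence the detour through almost
    everywhere equality. The sum of degree at most N has N + 1 terms, which explains [N.+1]. *)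
Lemma dotL2_density phi psi N :
  dotL2 (density (calA (chebyshev_sum phi N))) (chebyshev_sum psi N) = pA phi psi N.+1.
Proof.
have -> : chebyshev_sum phi N = trig_cos (coef phi) N.+1.
  by apply/funext => x; exact: chebyshev_sumE.
have -> : chebyshev_sum psi N = trig_cos (coef psi) N.+1.
  by apply/funext => x; exact: chebyshev_sumE.
have dens := calA_density (coef phi) N.+1.
have ae := density_ae dens.
have [[mg _ _] _] : is_density (calA (trig_cos (coef phi) N.+1)) (density (calA (trig_cos (coef phi) N.+1))).
  by apply: (@getPex _ [set g | is_density _ g]); eexists; exact: dens.
rewrite /dotL2 (@Rintegral_ae _ _ (fun x => winv x * trig_cos (fun n => n%:R * coef phi n) N.+1 x *
   trig_cos (coef psi) N.+1 x)).
- by rewrite trig_cos_dot.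
- exact: mOm.
- by apply: measurable_funM; [exact: mg|exact: trig_cos_mfun].
- apply: measurable_funM; last exact: trig_cos_mfun.
  by apply: measurable_funM; [exact: winv_mfun|exact: trig_cos_mfun].
- by apply: aeS ae => x h xO; rewrite h.
Qed.

Lemma pairAE phi psi : pairA phi psi = lim ((pA phi psi N.+1)%:E @[N --> \oo]).
Proof. by rewrite /pairA; under eq_fun do rewrite dotL2_density. Qed.

Lemma pA_term_ge0 phi n : 0 <= n%:R * coef phi n * coef phi n * chebh n.
Proof. by rewrite mulr_ge0 ?(ltW (chebh_gt0 n))// -mulrA mulr_ge0// -expr2 sqr_ge0. Qed.

Lemma pA_nondecreasing phi : nondecreasing_seq (pA phi phi).
Proof.
by apply/nondecreasing_seqP => n; rewrite /pA big_nat_recr//= lerDl pA_term_ge0.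
Qed.

Lemma pA_ge0 phi N : 0 <= pA phi phi N.
Proof. by apply: sumr_ge0 => n _; exact: pA_term_ge0. Qed.

Definition Hs phi := L2W phi /\ exists B, forall N, pA phi phi N <= B.

Definition pa phi psi := lim (pA phi psi N @[N --> \oo]).

Lemma Hs_cvg_diag phi : Hs phi -> pA phi phi N @[N --> \oo] --> pa phi phi.
Proof.
move=> [_ [B hB]]; apply: nondecreasing_is_cvgn; first exact: pA_nondecreasing.
by exists B => _ [N _ <-].
Qed.

Lemma pA_add phi psi (t : R) N : L2W phi -> L2W psi ->
  pA (fun x => phi x + t * psi x) (fun x => phi x + t * psi x) N =
  pA phi phi N + 2 * t * pA phi psi N + t ^+ 2 * pA psi psi N.
Proof.
move=> L1 L2'; rewrite /pA !mulr_sumr -!big_split/=; apply: eq_bigr => n _.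
by rewrite coefD//; [rewrite coefZ//; ring|exact: L2WZ].
Qed.

Lemma HsD phi psi (t : R) : Hs phi -> Hs psi -> Hs (fun x => phi x + t * psi x).
Proof.
move=> [L1 [B1 h1]] [L2' [B2 h2]]; split; first by apply: L2WD => //; exact: L2WZ.
exists (2 * (B1 + t ^+ 2 * B2)) => N.
have e1 := pA_add t N L1 L2'.
(* The parallelogram bound: nonnegativity at [phi - t psi] controls the cross term in the square of
   [phi + t psi]. *)
have e2 := pA_ge0 (fun x => phi x + (- t) * psi x) N; rewrite (pA_add (- t) N L1 L2') in e2.
have h1' := h1 N; have h2' : t ^+ 2 * pA psi psi N <= t ^+ 2 * B2 by rewrite ler_wpM2l ?sqr_ge0.
by rewrite e1; move: e2; rewrite sqrrN; lra.
Qed.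

Lemma HsB phi psi : Hs phi -> Hs psi -> Hs (fun x => phi x - psi x).
Proof. by move=> H1 H2; have := HsD (-1) H1 H2; under eq_fun do rewrite mulN1r. Qed.

(** Polarization: off the diagonal the partial sums are not monotone, but they are differences of
    two monotone bounded ones. *)
Lemma Hs_cvg phi psi : Hs phi -> Hs psi -> pA phi psi N @[N --> \oo] --> pa phi psi.
Proof.
move=> H1 H2; have H3 := HsD 1 H1 H2; have H4 := HsD (-1) H1 H2.
have -> : pA phi psi = (fun N => 4^-1 * (pA (fun x => phi x + 1 * psi x) (fun x => phi x + 1 * psi x) N
   - pA (fun x => phi x + (-1) * psi x) (fun x => phi x + (-1) * psi x) N)).
  by apply/funext => N; rewrite !pA_add//; [field|case: H1|case: H2|case: H1|case: H2].
suff : cvgn (fun N => 4^-1 * (pA (fun x => phi x + 1 * psi x) (fun x => phi x + 1 * psi x) N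
   - pA (fun x => phi x + (-1) * psi x) (fun x => phi x + (-1) * psi x) N)).
  rewrite /pa; have -> : pA phi psi = (fun N => 4^-1 * (pA (fun x => phi x + 1 * psi x) (fun x => phi x + 1 * psi x) N
   - pA (fun x => phi x + (-1) * psi x) (fun x => phi x + (-1) * psi x) N)).
    by apply/funext => N; rewrite !pA_add//; [field|case: H1|case: H2|case: H1|case: H2].
  by [].
by apply/cvg_ex; eexists; apply: cvgMr; apply: cvgB; exact: Hs_cvg_diag.
Qed.

Lemma pa_sym phi psi : pa phi psi = pa psi phi.
Proof. by rewrite /pa; under eq_fun do rewrite pA_sym. Qed.

Lemma pA_le_pa phi N : Hs phi -> pA phi phi N <= pa phi phi.
Proof.
move=> H; apply: nondecreasing_cvgn_le; first exact: pA_nondecreasing.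
by apply/cvg_ex; eexists; exact: Hs_cvg_diag.
Qed.

Lemma pa_ge0 phi : Hs phi -> 0 <= pa phi phi.
Proof. by move=> H; apply: le_trans (pA_le_pa 0 H); exact: pA_ge0. Qed.

Lemma pa_add phi psi (t : R) : Hs phi -> Hs psi ->
  pa (fun x => phi x + t * psi x) (fun x => phi x + t * psi x) =
  pa phi phi + 2 * t * pa phi psi + t ^+ 2 * pa psi psi.
Proof.
move=> H1 H2; apply/cvg_lim => //.
have -> : pA (fun x => phi x + t * psi x) (fun x => phi x + t * psi x) =
   (fun N => pA phi phi N + 2 * t * pA phi psi N + t ^+ 2 * pA psi psi N).
  by apply/funext => N; rewrite pA_add//; [case: H1|case: H2].
by apply: cvgD; [apply: cvgD|]; [|apply: cvgMr|apply: cvgMr]; exact: Hs_cvg.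
Qed.

Lemma pa_subl phi1 phi2 psi : Hs phi1 -> Hs phi2 -> Hs psi ->
  pa (fun x => phi1 x - phi2 x) psi = pa phi1 psi - pa phi2 psi.
Proof.
move=> H1 H2 H3; apply/cvg_lim => //.
have -> : pA (fun x => phi1 x - phi2 x) psi = (fun N => pA phi1 psi N - pA phi2 psi N).
  apply/funext => N; rewrite /pA -sumrB; apply: eq_bigr => n _.
  by rewrite coefB; [ring|case: H1|case: H2].
by apply: cvgB; exact: Hs_cvg.
Qed.

Lemma pa_CS phi psi : Hs phi -> Hs psi ->
  `|pa phi psi| <= Num.sqrt (pa phi phi) * Num.sqrt (pa psi psi).
Proof.
move=> H1 H2; apply: cauchy_schwarz_abstract; [exact: pa_ge0|exact: pa_ge0|] => t.
by rewrite -pa_add//; apply: pa_ge0; exact: HsD.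
Qed.

Definition tail phi N := pa phi phi - pA phi phi N.

Lemma tail_ge0 phi N : Hs phi -> 0 <= tail phi N.
Proof. by move=> H; rewrite subr_ge0 pA_le_pa. Qed.

(** The modes from N on make up a nonnegative form of their own. Its Cauchy-Schwarz inequality has
    two small factors, where that of [pa] has none. *)
Lemma pa_tail_CS phi psi N : Hs phi -> Hs psi ->
  `|pa phi psi - pA phi psi N| <= Num.sqrt (tail phi N) * Num.sqrt (tail psi N).
Proof.
move=> H1 H2; apply: cauchy_schwarz_abstract; [exact: tail_ge0|exact: tail_ge0|] => t.
have := @tail_ge0 _ N (HsD t H1 H2).
rewrite /tail pa_add// pA_add; [|by case: H1|by case: H2].
set p1 := pa phi phi; set p2 := pa psi psi; set p3 := pa phi psi.
set q1 := pA phi phi N; set q2 := pA psi psi N; set q3 := pA phi psi N.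
by move: p1 p2 p3 q1 q2 q3 => p1 p2 p3 q1 q2 q3; congr (_ <= _); ring.
Qed.

Lemma pairA_pa phi psi : Hs phi -> Hs psi -> pairA phi psi = (pa phi psi)%:E.
Proof.
move=> H1 H2; rewrite pairAE; apply/cvg_lim => //; apply: cvg_EFin; first exact: nearW.
by have := Hs_cvg H1 H2; rewrite -cvg_shiftS.
Qed.

(** The diagonal partial sums are nonnegative and monotone whatever the values of [coef], so
    [pairA phi phi] is a genuine limit in [0, +oo] even before [phi] is known to be in the weighted
    space. A finite sum of two nonnegative terms then makes each term finite. *)
Lemma inHP phi : inH phi <-> Hs phi.
Proof.
split=> [[[mf _] fin]|H].
  have cv : cvgn (fun N => (pA phi phi N.+1)%:E).
    apply: ereal_nondecreasing_is_cvgn; apply/nondecreasing_seqP => n; rewrite lee_fin.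
    by apply: pA_nondecreasing.
  have p0 : (0 <= pairA phi phi)%E.
    rewrite pairAE; apply: lime_ge => //; apply: nearW => N; rewrite lee_fin; exact: pA_ge0.
  have fW : (sqnormW phi < +oo)%E by apply: le_lt_trans fin; rewrite /sqnormH leeDl.
  have fA : (pairA phi phi < +oo)%E.
    by apply: le_lt_trans fin; rewrite /sqnormH leeDr// sqnormW_ge0.
  split.
    by apply: L2rP; [exact: winv_mfun|exact: winv_gt0|exact: mf|rewrite -sqnormWE].
  exists (fine (pairA phi phi)) => N; rewrite -lee_fin fineK ?ge0_fin_numE//.
  rewrite pairAE; apply: le_trans (_ : _ <= (pA phi phi N.+1)%:E)%E _.
    by rewrite lee_fin; exact: pA_nondecreasing.
  apply: lime_ge => //; exists N => // m /= Nm; rewrite lee_fin.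
  by apply: pA_nondecreasing; rewrite ltnS.
split; first by apply/inL2P; apply: L2W_L2; case: H.
rewrite /sqnormH pairA_pa// sqnormW_dot ?ltry//; by case: H.
Qed.

Lemma sqnormHE phi : Hs phi -> sqnormH phi = (dotW phi phi + pa phi phi)%:E.
Proof. by move=> H; rewrite /sqnormH pairA_pa// sqnormW_dot//; case: H. Qed.

End Spaces.

(** * Regularity in time *)

Section TimeTools.
Context {R : realType}.
Implicit Types (D : set R) (eta f : R -> R) (x t s : R).
Local Notation mu := (@lebesgue_measure R).
Local Notation Om := (@Omega R).

Lemma test_function_eq0 D eta x : test_function D eta -> ~ D x -> eta x = 0.
Proof.
move=> [_ _ sub] Dx; apply/eqP/negPn/negP => ex; apply: Dx; apply: sub.
exact: subset_closure.
Qed.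

Lemma test_function_derive1 D eta : test_function D eta -> test_function D (derive1 eta).
Proof.
move=> [seta ce sub].
have sub' : closure [set x | derive1 eta x != 0] `<=` closure [set x | eta x != 0].
  rewrite [X in _ `<=` X](_ : _ = closure (closure [set x | eta x != 0])); last first.
    by apply/closure_id; exact: closed_closure.
  apply: closure_subset => x /= dx; apply: contrapT => xc; move/negP: dx; apply.
  rewrite derive1E -(@near_eq_derive R _ _ (cst 0)) ?derive_cst//.
  have : open (~` closure [set x | eta x != 0]) by rewrite openC; exact: closed_closure.
  rewrite openE => /(_ x xc); apply: filterS => y yc; apply/esym/eqP/negPn/negP => ey.
  by apply: yc; exact: subset_closure.
split; [exact: smooth_derive1| |].
  by apply: (subclosed_compact _ ce sub'); exact: closed_closure.
exact: subset_trans sub.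
Qed.

Lemma test_functionS D D' eta : D `<=` D' -> test_function D eta -> test_function D' eta.
Proof. by move=> DD [? ? ?]; split=> //; exact: subset_trans DD. Qed.

(** The form in which Cauchy-Schwarz yields continuity in time: [q] is the squared distance between
    two states. *)
Lemma cvg_sqrt_squeeze (F : set_system R) (FF : Filter F) (k q : R -> R) (l C : R) :
  0 <= C -> (\forall t \near F, `|k t - l| <= C * Num.sqrt (q t)) -> q @ F --> 0 -> k @ F --> l.
Proof.
move=> C0 kq q0.
have h : (fun t => C * Num.sqrt (q t)) @ F --> 0.
  rewrite -[X in _ --> X](mulr0 C) -[X in _ --> C * X](sqrtr0 R); apply: cvgMr.
  by apply: (cvg_comp _ _ q0); exact: sqrt_continuous.
apply/cvgrPdist_le => e e0.
have /cvgr0Pnorm_le/(_ e e0) := h.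
apply: filterS2 kq => t kt /(le_trans (ler_norm _)) h'.
by rewrite distrC (le_trans kt).
Qed.

Lemma is_derive_dnbhs (k : R -> R) (s l : R) :
  (k t - k s) / (t - s) @[t --> s^'] --> l -> is_derive s 1 k l.
Proof.
move=> h.
have h' : e^-1 *: (k (e *: 1 + s) - k s) @[e --> 0^'] --> l.
  apply/cvgrPdist_le => e e0; have /cvgrPdist_le/(_ e e0)[d /= d0 H] := h.
  exists d => // y /=; rewrite sub0r normrN => yd y0.
  have := H (y + s); rewrite /= opprD addrCA subrr addr0 normrN => /(_ yd).
  rewrite -subr_eq0 addrK => /(_ y0).
  by rewrite /GRing.scale/= mulr1 mulrC.
apply: DeriveDef; first by apply/cvg_ex; exists l; exact: h'.
exact/cvg_lim.
Qed.

Lemma sqr_le_norm (a b : R) : `|a| <= `|b| -> a ^+ 2 <= b ^+ 2.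
Proof.
move=> ab; rewrite -[a ^+ 2]real_normK ?num_real// -[b ^+ 2]real_normK ?num_real//.
by rewrite lerXn2r ?nnegrE.
Qed.

Lemma L2D f1 f2 : @L2 R f1 -> L2 f2 -> L2 (fun x => f1 x + f2 x).
Proof. by apply: L2rD; [exact: one_mfun|exact: one_gt0]. Qed.

Lemma L2B f1 f2 : @L2 R f1 -> L2 f2 -> L2 (fun x => f1 x - f2 x).
Proof. by apply: L2rB; [exact: one_mfun|exact: one_gt0]. Qed.

Lemma L2Z (k : R) f : L2 f -> L2 (fun x => k * f x).
Proof. exact: L2rZ. Qed.

Lemma dotL2_CS f1 f2 : L2 f1 -> @L2 R f2 ->
  `|dotL2 f1 f2| <= Num.sqrt (dotL2 f1 f1) * Num.sqrt (dotL2 f2 f2).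
Proof. by rewrite !dotL2E; apply: dotr_CS; [exact: one_mfun|exact: one_gt0]. Qed.

Lemma dotL2_ge0 f : 0 <= dotL2 f f.
Proof. by rewrite dotL2E; apply: dotr_ge0; exact: one_gt0. Qed.

Lemma dotL2Bl f1 f2 h : L2 f1 -> L2 f2 -> @L2 R h ->
  dotL2 (fun x => f1 x - f2 x) h = dotL2 f1 h - dotL2 f2 h.
Proof. by rewrite !dotL2E; apply: dotrBl; [exact: one_mfun|exact: one_gt0]. Qed.

Lemma dotL2Zl (k : R) f1 h : L2 f1 -> @L2 R h -> dotL2 (fun x => k * f1 x) h = k * dotL2 f1 h.
Proof. by rewrite !dotL2E; apply: dotrZl; [exact: one_mfun|exact: one_gt0]. Qed.

Lemma dotL2_sym f h : dotL2 f h = dotL2 h f.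
Proof. by rewrite !dotL2E; exact: dotr_sym. Qed.

Lemma dotL2_add (t : R) f g : L2 f -> L2 g ->
  dotL2 (fun x => f x + t * g x) (fun x => f x + t * g x) =
  dotL2 f f + 2 * t * dotL2 f g + t ^+ 2 * dotL2 g g.
Proof. by rewrite !dotL2E; apply: dotr_addsq; [exact: one_mfun|exact: one_gt0]. Qed.

End TimeTools.

Section Evolution.
Context {R : realType} (T : R) (f : R -> R) (phi phi_t : R -> R -> R).
Local Notation mu := (@lebesgue_measure R).
Local Notation Om := (@Omega R).
Context (f_lip : exists k : R, k.-lipschitz f)
  (f_bound : exists c : R, 0 < c /\ forall x : R, `|f x| <= c * `|x|)
  (phi_C : continuous_into inH sqnormH T phi)
  (phi_t_C : continuous_into inL2 sqnormL2 T phi_t)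
  (phi_phi_t : is_time_derivative T phi phi_t)
  (phi_weak : weak_equation T f phi).
Implicit Types (t s : R).

Let itvT t : t \in `]0, T[ -> t \in `[0, T].
Proof. exact: subset_itv_oo_cc. Qed.

Let near_itvT s : s \in `]0, T[ -> \forall t \near s, t \in `]0, T[.
Proof. by move=> sT; apply: open_nbhs_nbhs; split => //; exact: interval_open. Qed.

Lemma phi_Hs t : t \in `]0, T[ -> Hs (phi t).
Proof. by move=> /itvT tT; apply/inHP; have [h _] := phi_C; exact: h. Qed.

Lemma phi_L2 t : t \in `]0, T[ -> L2 (phi t).
Proof. by move=> /phi_Hs[/L2W_L2]. Qed.

Lemma phi_t_L2 t : t \in `]0, T[ -> L2 (phi_t t).
Proof. by move=> /itvT tT; apply/inL2P; have [h _] := phi_t_C; exact: h. Qed.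

Definition dphi t s x := phi t x - phi s x.

Lemma dphi_Hs t s : t \in `]0, T[ -> s \in `]0, T[ -> Hs (dphi t s).
Proof. by move=> tT sT; apply: HsB; exact: phi_Hs. Qed.

Let within_itv (s : R) (F : set_system R) (P : set R) : s \in `]0, T[ -> ProperFilter F ->
  nbhs s `<=` F -> within `[0, T] F P -> F P.
Proof.
move=> sT FF sF; rewrite /within/= => h.
have : F `]0, T[%classic by apply: sF; exact: near_itvT.
by move: h; apply: filterS2 => x h xT; apply: h; exact: itvT.
Qed.

Lemma dphi_cvg s : s \in `]0, T[ ->
  dotW (dphi t s) (dphi t s) + pa (dphi t s) (dphi t s) @[t --> s] --> 0.
Proof.
move=> sT; have [_ /(_ s (itvT sT)) h] := phi_C.
have h' : sqnormH (phi t \- phi s) @[t --> s] --> 0%E.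
  apply: cvg_trans h => P hP; exact: (@within_itv s (nbhs s) _ sT _ (fun _ => id) hP).
have h2 : fine (sqnormH (phi t \- phi s)) @[t --> s] --> (0 : R) by exact: (fine_cvg h').
apply: cvg_trans h2; apply: near_eq_cvg.
apply: filterS (near_itvT sT) => t tT /=.
by rewrite (sqnormHE (dphi_Hs tT sT)).
Qed.

Lemma dotW_ge0 g : 0 <= dotW g g :> R.
Proof. by apply: (@dotr_ge0 _ winv); exact: winv_gt0. Qed.

Lemma squeeze0 s (q1 q2 : R -> R) : (\forall t \near s, 0 <= q1 t <= q2 t) ->
  q2 @ s --> 0 -> q1 @ s --> 0.
Proof.
move=> h q0; apply/cvgr0Pnorm_le => e e0.
have /cvgr0Pnorm_le/(_ e e0) := q0; apply: filterS2 h => t /andP[h1 h2] h3.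
by rewrite ger0_norm// (le_trans h2)// (le_trans (ler_norm _)).
Qed.

Lemma dphi_pa s : s \in `]0, T[ -> pa (dphi t s) (dphi t s) @[t --> s] --> 0.
Proof.
move=> sT; apply: squeeze0 (dphi_cvg sT); apply: filterS (near_itvT sT) => t tT.
by rewrite pa_ge0 ?lerDr ?dotW_ge0//; exact: dphi_Hs.
Qed.

Lemma dphi_dotW s : s \in `]0, T[ -> dotW (dphi t s) (dphi t s) @[t --> s] --> 0.
Proof.
move=> sT; apply: squeeze0 (dphi_cvg sT); apply: filterS (near_itvT sT) => t tT.
by rewrite dotW_ge0 lerDl pa_ge0//; exact: dphi_Hs.
Qed.

Lemma dphi_dotL2 s : s \in `]0, T[ -> dotL2 (dphi t s) (dphi t s) @[t --> s] --> 0.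
Proof.
move=> sT; apply: squeeze0 (dphi_dotW sT); apply: filterS (near_itvT sT) => t tT.
by rewrite dotL2_ge0/= dotL2_le_dotW//; case: (dphi_Hs tT sT).
Qed.

Lemma coef_phi_continuous n s : s \in `]0, T[ -> {for s, continuous (fun t => coef (phi t) n)}.
Proof.
move=> sT.
apply: (@cvg_sqrt_squeeze _ _ _ _ (fun t => dotW (dphi t s) (dphi t s)) _
  (Num.sqrt (dotW (@chebyshevT R n) (chebyshevT n)) / chebh n)); last exact: dphi_dotW.
- by rewrite divr_ge0 ?sqrtr_ge0// ltW// chebh_gt0.
- apply: filterS (near_itvT sT) => t tT.
  have [[L1 _] [L2' _]] := (phi_Hs tT, phi_Hs sT).
  rewrite -coefB// /coef normrM [`|(chebh n)^-1|]gtr0_norm ?invr_gt0 ?chebh_gt0//.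
  rewrite mulrAC ler_pM2r ?invr_gt0 ?chebh_gt0// mulrC.
  apply: (@dotr_CS _ winv); [exact: winv_mfun|exact: winv_gt0|exact: L2WB|exact: chebyshevT_L2W].
Qed.

Lemma pa_phi_continuous psi s : s \in `]0, T[ -> Hs psi ->
  {for s, continuous (fun t => pa (phi t) psi)}.
Proof.
move=> sT Hpsi.
apply: (@cvg_sqrt_squeeze _ _ _ _ (fun t => pa (dphi t s) (dphi t s)) _
  (Num.sqrt (pa psi psi))); [exact: sqrtr_ge0| |exact: dphi_pa].
apply: filterS (near_itvT sT) => t tT.
rewrite -pa_subl//; [|exact: phi_Hs|exact: phi_Hs].
by rewrite mulrC; apply: pa_CS => //; exact: dphi_Hs.
Qed.

Lemma pa_phi_diag_continuous s : s \in `]0, T[ -> {for s, continuous (fun t => pa (phi t) (phi t))}.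
Proof.
move=> sT; have Hps := phi_Hs sT.
have : pa (phi s) (phi s) + 2 * (pa (phi t) (phi s) - pa (phi s) (phi s)) +
    pa (dphi t s) (dphi t s) @[t --> s] --> pa (phi s) (phi s).
  rewrite -[X in _ --> X]addr0; apply: cvgD; last exact: dphi_pa.
  rewrite -[X in _ --> X]addr0 -[X in _ --> _ + X](mulr0 2).
  apply: cvgD; first exact: cvg_cst.
  apply: cvgMr; rewrite -[X in _ --> X](subrr (pa (phi s) (phi s))).
  by apply: cvgB; [exact: pa_phi_continuous|exact: cvg_cst].
apply: cvg_trans; apply: near_eq_cvg; apply: filterS (near_itvT sT) => t tT.
have Hd := dphi_Hs tT sT.
have e1 := pa_add 1 Hps Hd.
have E : (fun x => phi s x + 1 * dphi t s x) = phi t.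
  by apply/funext => x; rewrite /dphi; ring.
have e2 := pa_subl (phi_Hs tT) Hps Hps.
by rewrite E in e1; rewrite e1 -e2 [pa (phi s) (dphi t s)]pa_sym -/(dphi t s) mulr1 expr1n mul1r.
Qed.

Lemma tail_phi_continuous N s : s \in `]0, T[ -> {for s, continuous (fun t => tail (phi t) N)}.
Proof.
move=> sT; apply: cvgB; first exact: pa_phi_diag_continuous.
apply: cvg_sum_nat => n; apply: cvgMl; apply: cvgM; last exact: coef_phi_continuous.
by apply: cvgMr; exact: coef_phi_continuous.
Qed.

Lemma dotL2_phi_t_continuous psi s : s \in `]0, T[ -> L2 psi ->
  {for s, continuous (fun t => dotL2 (phi_t t) psi)}.
Proof.
move=> sT Lpsi; have [_ /(_ s (itvT sT)) h] := phi_t_C.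
have h' : sqnormL2 (phi_t t \- phi_t s) @[t --> s] --> 0%E.
  apply: cvg_trans h => P hP; exact: (@within_itv s (nbhs s) _ sT _ (fun _ => id) hP).
apply: (@cvg_sqrt_squeeze _ _ _ _ (fun t => fine (sqnormL2 (phi_t t \- phi_t s))) _
  (Num.sqrt (dotL2 psi psi))); [exact: sqrtr_ge0| |exact: fine_cvg h'].
apply: filterS (near_itvT sT) => t tT.
have [L1 L2'] := (phi_t_L2 tT, phi_t_L2 sT).
rewrite -dotL2Bl// sqnormL2_dot/=; last exact: L2B.
by rewrite mulrC; apply: dotL2_CS => //; exact: L2B.
Qed.

Lemma f_continuous : continuous f.
Proof.
have [k fk] := f_lip; move=> x; apply/cvgrPdist_le => e e0.
pose K := Num.max k 1.
have K0 : 0 < K by rewrite lt_max ltr01 orbT.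
near=> y; apply: (@le_trans _ _ (K * `|x - y|)).
  by apply: le_trans (fk (x, y) _) _ => //=; rewrite ler_wpM2r// le_max lexx.
rewrite -ler_pdivlMl//; near: y; apply: cvgr_dist_le; first exact: cvg_id.
by rewrite mulr_gt0// invr_gt0.
Unshelve. all: by end_near. Qed.

Lemma f_phi_L2 t : t \in `]0, T[ -> L2 (f \o phi t).
Proof.
move=> tT; have [mp ip] := phi_L2 tT; have [c [c0 fc]] := f_bound.
have mfp : mfun Om (f \o phi t).
  by apply: measurableT_comp mp; exact: continuous_measurable_fun f_continuous.
split => //; apply: (le_intg mOm _ (intgZ (c ^+ 2) mOm ip)).
  by apply: measurable_funM; [exact: one_mfun|exact: measurable_funM].
move=> x _; rewrite /one !mul1r /= normrM.
apply: (@le_trans _ _ ((c * `|phi t x|) * (c * `|phi t x|))); first by rewrite ler_pM.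
by rewrite mulrACA -!expr2 real_normK// num_real.
Qed.

Lemma f_phi_bound : exists2 c, 0 < c & forall t psi, t \in `]0, T[ -> L2 psi ->
  `|dotL2 (f \o phi t) psi| <= c * (Num.sqrt (dotL2 (phi t) (phi t)) * Num.sqrt (dotL2 psi psi)).
Proof.
have [c [c0 fc]] := f_bound; exists c => // t psi tT Lpsi.
apply: le_trans (dotL2_CS (f_phi_L2 tT) Lpsi) _.
rewrite mulrA ler_wpM2r ?sqrtr_ge0//.
rewrite -[c]gtr0_norm// -sqrtr_sqr -sqrtrM ?sqr_ge0// ler_wsqrtr//.
have [mp ip] := phi_L2 tT; have [mf' if'] := f_phi_L2 tT.
rewrite !dotL2E /dotr -RintegralZl; [|exact: mOm|exact: ip].
apply: le_Rintegral => //; [exact: mOm|by apply: intgZ => //; exact: mOm|].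
move=> x _; rewrite /one !mul1r /= -!expr2 -exprMn; apply: sqr_le_norm.
by rewrite normrM gtr0_norm.
Qed.

Lemma dotL2_f_phi_continuous psi s : s \in `]0, T[ -> L2 psi ->
  {for s, continuous (fun t => dotL2 (f \o phi t) psi)}.
Proof.
move=> sT Lpsi; have [k fk] := f_lip.
apply: (@cvg_sqrt_squeeze _ _ _ _ (fun t => dotL2 (dphi t s) (dphi t s)) _
  (`|k| * Num.sqrt (dotL2 psi psi))); [by rewrite mulr_ge0 ?sqrtr_ge0| |exact: dphi_dotL2].
apply: filterS (near_itvT sT) => t tT.
have [L1 L2'] := (f_phi_L2 tT, f_phi_L2 sT); have LB := L2B L1 L2'.
rewrite -dotL2Bl//; apply: le_trans (dotL2_CS LB Lpsi) _.
rewrite mulrAC ler_wpM2r ?sqrtr_ge0//.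
have Ld : L2 (dphi t s) by apply: L2B; exact: phi_L2.
rewrite -sqrtr_sqr -sqrtrM ?sqr_ge0// ler_wsqrtr//.
have [mp ip] := Ld; have [mf' if'] := LB.
rewrite !dotL2E /dotr -RintegralZl; [|exact: mOm|exact: ip].
apply: le_Rintegral => //; [exact: mOm|by apply: intgZ => //; exact: mOm|].
move=> x _; rewrite /one !mul1r /= -!expr2 -exprMn; apply: sqr_le_norm.
rewrite normrM; apply: le_trans (fk (phi t x, phi s x) _) _ => //=.
by rewrite ler_wpM2r// ler_norm.
Qed.

Definition quot t s x := (phi t x - phi s x) / (t - s) - phi_t s x.

Lemma quot_L2 t s : t \in `]0, T[ -> s \in `]0, T[ -> L2 (quot t s).
Proof.
move=> tT sT; have := L2B (L2Z ((t - s)^-1) (L2B (phi_L2 tT) (phi_L2 sT))) (phi_t_L2 sT).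
by apply: eq_L2r => x _; rewrite /quot; ring.
Qed.

Lemma quot_cvg s : s \in `]0, T[ -> dotL2 (quot t s) (quot t s) @[t --> s^'] --> (0 : R).
Proof.
move=> sT; have h := phi_phi_t (itvT sT).
have h' : sqnormL2 (quot t s) @[t --> s^'] --> 0%E.
  apply: cvg_trans h => P hP; apply: (@within_itv s s^' _ sT _ _ hP).
  by move=> B; exact: nbhs_dnbhs.
have h2 : fine (sqnormL2 (quot t s)) @[t --> s^'] --> (0 : R) by exact: (fine_cvg h').
apply: cvg_trans h2; apply: near_eq_cvg.
apply: nbhs_dnbhs; apply: filterS (near_itvT sT) => t tT /=.
by rewrite (sqnormL2_dot (quot_L2 tT sT)).
Qed.

Lemma dnbhs_itvT s : s \in `]0, T[ -> \forall t \near s^', (t \in `]0, T[) /\ t - s != 0.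
Proof.
move=> sT; near=> t; split.
  by near: t; apply: nbhs_dnbhs; exact: near_itvT.
by rewrite subr_eq0; near: t; exact: nbhs_dnbhs_neq.
Unshelve. all: by end_near. Qed.

Lemma dotL2_quot psi t s : t \in `]0, T[ -> s \in `]0, T[ -> L2 psi ->
  dotL2 (quot t s) psi =
  (dotL2 (phi t) psi - dotL2 (phi s) psi) / (t - s) - dotL2 (phi_t s) psi.
Proof.
move=> tT sT Lpsi; have Ld := L2B (phi_L2 tT) (phi_L2 sT).
rewrite mulrC -(dotL2Bl (phi_L2 tT) (phi_L2 sT) Lpsi) -(dotL2Zl _ Ld Lpsi).
rewrite -(dotL2Bl (L2Z _ Ld) (phi_t_L2 sT) Lpsi).
by apply: eq_Rintegral => x _; rewrite /quot; ring.
Qed.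

Lemma is_derive_dotL2_phi psi s : s \in `]0, T[ -> L2 psi ->
  is_derive s 1 (fun t => dotL2 (phi t) psi) (dotL2 (phi_t s) psi).
Proof.
move=> sT Lpsi; apply: is_derive_dnbhs.
apply: (@cvg_sqrt_squeeze _ _ _ _ (fun t => dotL2 (quot t s) (quot t s)) _
  (Num.sqrt (dotL2 psi psi))); [exact: sqrtr_ge0| |exact: quot_cvg].
apply: filterS (dnbhs_itvT sT) => t [tT ts].
by rewrite -dotL2_quot// mulrC; apply: dotL2_CS => //; exact: quot_L2.
Qed.

Lemma is_derive_sqnorm_phi s : s \in `]0, T[ ->
  is_derive s 1 (fun t => dotL2 (phi t) (phi t)) (2 * dotL2 (phi_t s) (phi s)).
Proof.
move=> sT; apply: is_derive_dnbhs.
have Ls := phi_L2 sT; have Lts := phi_t_L2 sT.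
have cq : dotL2 (quot t s) (phi s) @[t --> s^'] --> (0 : R).
  apply: (@cvg_sqrt_squeeze _ _ _ _ (fun t => dotL2 (quot t s) (quot t s)) _
    (Num.sqrt (dotL2 (phi s) (phi s)))); [exact: sqrtr_ge0| |exact: quot_cvg].
  apply: filterS (dnbhs_itvT sT) => t [tT ts].
  by rewrite subr0 mulrC; apply: dotL2_CS => //; exact: quot_L2.
have cq2 : dotL2 (quot t s) (phi_t s) @[t --> s^'] --> (0 : R).
  apply: (@cvg_sqrt_squeeze _ _ _ _ (fun t => dotL2 (quot t s) (quot t s)) _
    (Num.sqrt (dotL2 (phi_t s) (phi_t s)))); [exact: sqrtr_ge0| |exact: quot_cvg].
  apply: filterS (dnbhs_itvT sT) => t [tT ts].
  by rewrite subr0 mulrC; apply: dotL2_CS => //; exact: quot_L2.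
have cts : t - s @[t --> s^'] --> (0 : R).
  rewrite -[X in _ --> X](subrr s); apply: cvgB; last exact: cvg_cst.
  by move=> P; exact: nbhs_dnbhs.
(* The difference quotient of the squared norm, expanded with phi(t) = phi(s) + (t - s) (phi_t(s) +
   [quot t s]). *)
have : 2 * (dotL2 (phi_t s) (phi s) + dotL2 (quot t s) (phi s)) +
   (t - s) * (dotL2 (phi_t s) (phi_t s) + 2 * dotL2 (quot t s) (phi_t s) + dotL2 (quot t s) (quot t s))
   @[t --> s^'] --> 2 * dotL2 (phi_t s) (phi s).
  rewrite -[X in _ --> X]addr0; apply: cvgD.
    apply: cvgMr; rewrite -[X in _ --> X]addr0; apply: cvgD => //; exact: cvg_cst.
  rewrite -[X in _ --> X](mul0r (dotL2 (phi_t s) (phi_t s) + 2 * 0 + 0)).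
  apply: cvgM => //; apply: cvgD; last exact: quot_cvg.
  by apply: cvgD; [exact: cvg_cst|exact: cvgMr].
apply: cvg_trans; apply: near_eq_cvg; apply: filterS (dnbhs_itvT sT) => t [tT ts].
have Lq := quot_L2 tT sT; have LD := L2D Lts (L2Z 1 Lq).
have E : (fun x => phi s x + (t - s) * (phi_t s x + 1 * quot t s x)) = phi t.
  by apply/funext => x; rewrite /quot; field.
have := dotL2_add (t - s) Ls LD; rewrite E => ->.
rewrite (dotL2_add 1 Lts Lq) (dotL2_sym (phi s) (fun x => phi_t s x + 1 * quot t s x)).
have -> : dotL2 (fun x => phi_t s x + 1 * quot t s x) (phi s) =
   dotL2 (phi_t s) (phi s) + dotL2 (quot t s) (phi s).
  rewrite !dotL2E -(dotrDl one_mfun one_gt0 Lts Lq Ls).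
  by apply: eq_Rintegral => x _; rewrite mul1r.
by rewrite [dotL2 (quot t s) (phi_t s)]dotL2_sym; field.
Qed.

(** The weak equation becomes a classical one: (phi_t, psi) is continuous and its distributional
    derivative is a continuous function of time, so [weak_derivative] applies. *)
Lemma is_derive_dotL2_phi_t psi s : s \in `]0, T[ -> Hs psi ->
  is_derive s 1 (fun t => dotL2 (phi_t t) psi) (dotL2 (f \o phi s) psi - pa (phi s) psi).
Proof.
move=> sT Hpsi; have Lpsi : L2 psi by apply: L2W_L2; case: Hpsi.
have [s0 sT'] : 0 < s /\ s < T by move: sT; rewrite in_itv => /andP.
(* Continuity of the scalar functions is available at interior times; on a segment inside []0, T[]
   it makes them integrable. *)
pose a := s / 2; pose b := (s + T) / 2.
have [a0 as_ sb bT] : [/\ 0 < a, a < s, s < b & b < T] by rewrite /a /b; split; lra.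
have ab : a < b by exact: lt_trans sb.
have subT t : t \in `[a, b] -> t \in `]0, T[.
  by rewrite !in_itv/= => /andP[h1 h2]; lra.
have subo t : t \in `]a, b[ -> t \in `[a, b] by exact: subset_itv_oo_cc.
pose u t := dotL2 (phi t) psi; pose v t := dotL2 (phi_t t) psi.
pose g t := dotL2 (f \o phi t) psi; pose al t := pa (phi t) psi.
have cv t : t \in `[a, b] -> {for t, continuous v} by move=> /subT tT; exact: dotL2_phi_t_continuous.
have cg t : t \in `[a, b] -> {for t, continuous g} by move=> /subT tT; exact: dotL2_f_phi_continuous.
have cal t : t \in `[a, b] -> {for t, continuous al} by move=> /subT tT; exact: pa_phi_continuous.
have du t : t \in `[a, b] -> is_derive t 1 u (v t) by move=> /subT tT; exact: is_derive_dotL2_phi.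
apply: (@weak_derivative _ v (fun t => g t - al t) a b); last by rewrite in_itv/= as_.
- by move=> t /subo; exact: cv.
- by move=> t /subo tab; apply: cvgB; [exact: cg|exact: cal].
move=> eta teta.
have sub : `]a, b[ `<=` `]0, T[ by move=> t /subo/subT.
have := phi_weak ((inHP _).2 Hpsi) (test_functionS sub teta).
have t1 := test_function_derive1 teta; have t2 := test_function_derive1 t1.
have [se _ _] := teta; have [se1 _ _] := t1; have [se2 _ _] := t2.
have subc : `[a, b] `<=` `]0, T[ by move=> t /subT.
have out (e : R -> R) t : test_function (`]a, b[) e -> ~ `[a, b]%classic t -> e t = 0.
  by move=> te tab; apply: (test_function_eq0 te) => /subo.
have ci (k e : R -> R) : (forall t, t \in `[a, b] -> {for t, continuous k}) -> smooth e ->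
    intg `[a, b] (fun t => k t * e t).
  move=> ck sme; apply: intg_segment; apply: within_continuous => t tab.
  by apply: cvgM; [exact: ck|exact: smooth_continuous].
rewrite (Rintegral_supp subc); last by move=> t _ tab; rewrite /derive1n/= (out _ _ t2)// mulr0.
rewrite (Rintegral_supp subc); last by move=> t _ tab; rewrite (out _ _ teta)// mulr0.
rewrite (Rintegral_supp subc); last by move=> t _ tab; rewrite (out _ _ teta)// mulr0.
have -> : \int[mu]_(t in `[a, b]) (fine (pairA (phi t) psi) * eta t) =
    \int[mu]_(t in `[a, b]) (al t * eta t).
  by apply: eq_Rintegral => t; rewrite inE => /subT tT; rewrite pairA_pa//; exact: phi_Hs.
(* A single integration by parts, from phi to phi_t: the second derivative in time exists only
   weakly. *)
have -> : \int[mu]_(t in `[a, b]) (dotL2 (phi t) psi * derive1n 2 eta t) =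
    - \int[mu]_(t in `[a, b]) (v t * derive1 eta t).
  have za : derive1 eta a = 0 by apply: (test_function_eq0 t1); rewrite /= in_itv/= ltxx.
  have zb : derive1 eta b = 0 by apply: (test_function_eq0 t1); rewrite /= in_itv/= ltxx andbF.
  have := @Rby_parts _ u (derive1 eta) v (derive1 (derive1 eta)) a b ab.
  rewrite za zb !mulr0 subrr sub0r; apply.
  - by apply: within_continuous => t; exact: cv.
  - by apply: continuous_subspaceT; exact: smooth_continuous.
  - by move=> t _; apply: is_derive_derive1; exact: smooth_derivable.
move=> e1.
have mo (k e : R -> R) : (forall t, t \in `[a, b] -> {for t, continuous k}) -> smooth e ->
    mfun `]a, b[ (fun t => k t * e t).
  move=> ck sme; apply: itvoo_mfun => t /subo tab.
  by apply: cvgM; [exact: ck|exact: smooth_continuous].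
rewrite -(@Rintegral_itv_bnd _ _ _ _ true false); last exact: mo.
rewrite -[in RHS](@Rintegral_itv_bnd _ _ _ _ true false); last first.
  by apply: mo => // t tab; apply: cvgB; [exact: cg|exact: cal].
have -> : \int[mu]_(t in `[a, b]) ((g t - al t) * eta t) =
   \int[mu]_(t in `[a, b]) (g t * eta t) - \int[mu]_(t in `[a, b]) (al t * eta t).
  rewrite -RintegralB//; [|exact: ci|exact: ci].
  by apply: eq_Rintegral => t _; ring.
by move: e1; rewrite -/(al _) /g; lra.
Qed.

End Evolution.

(** * Mean value inequality and Dini's theorem *)

Section MVTtools.
Context {R : realType}.

Lemma lip_of_derive (F dF : R -> R) (a b K : R) :
  (forall t, t \in `[a, b] -> is_derive t 1 F (dF t)) ->
  (forall t, t \in `[a, b] -> `|dF t| <= K) ->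
  forall s t, s \in `[a, b] -> t \in `[a, b] -> `|F t - F s| <= K * `|t - s|.
Proof.
move=> hd hK s t.
wlog st : s t / s <= t.
  by move=> H sI tI; have [/H|/ltW/H] := leP s t; [exact|rewrite distrC [`|t - s|]distrC; exact].
move=> sI tI.
have sub x : x \in `[s, t] -> x \in `[a, b].
  move: sI tI; rewrite !in_itv/= => /andP[h1 h2] /andP[h3 h4] /andP[h5 h6].
  by lra.
have dst x : x \in `]s, t[ -> is_derive x 1 F (dF x).
  by move=> xst; apply: hd; apply: sub; exact: subset_itv_oo_cc.
have cst_ : {within `[s, t], continuous F}.
  by apply: within_continuous => x /sub xab; have := hd _ xab; exact: is_derive_continuous.
have [x xst E] := @MVT_segment R F dF s t st dst cst_.
by rewrite E normrM ler_wpM2r// hK// sub.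
Qed.

(** Near each point of [K] some index already works, by continuity of that one function;
    monotonicity keeps all later indices valid, and compactness makes the choice uniform. *)
Lemma dini (K : set R) (w : nat -> R -> R) : compact K ->
  (forall N t, K t -> {for t, continuous (w N)}) ->
  (forall t, \forall t' \near t, forall N M, (N <= M)%N -> K t -> w M t' <= w N t') ->
  (forall t, K t -> w N t @[N --> \oo] --> 0) ->
  forall e, 0 < e -> exists N, forall t, K t -> w N t <= e.
Proof.
move=> cK cw wmono w0 e e0.
move/compact_near_coveringP : cK => /(_ nat \oo (fun N t => w N t <= e) _) H.
have [|N _ hN] := H.
- move=> t Kt.
  have [N0 _ hN0] := cvgr_lt _ (w0 t Kt) _ e0.
  have hN0' := hN0 N0 (leqnn _).
  have ce : \forall t' \near t, w N0 t' < e by exact: (cvgr_lt _ (cw N0 t Kt) _ hN0').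
  exists ([set t' | w N0 t' < e /\ (forall N M, (N <= M)%N -> K t -> w M t' <= w N t')], [set N | (N0 <= N)%N]).
    split => /=; last by exists N0.
    by apply: filterI => //; exact: wmono.
  move=> [t' N] /= [[h1 h2] h3].
  exact: le_trans (h2 _ _ h3 Kt) (ltW h1).
- by exists N => t Kt; exact: (hN N (leqnn _) t Kt).
Qed.

End MVTtools.

(** * The energy estimate *)

Section Energy.
Context {R : realType} (T : R) (f : R -> R) (phi phi_t : R -> R -> R).
Context (f_lip : exists k : R, k.-lipschitz f)
  (f_bound : exists c : R, 0 < c /\ forall x : R, `|f x| <= c * `|x|)
  (phi_C : continuous_into inH sqnormH T phi)
  (phi_t_C : continuous_into inL2 sqnormL2 T phi_t)
  (phi_phi_t : is_time_derivative T phi phi_t)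
  (phi_weak : weak_equation T f phi).
Implicit Types (t s : R).

Local Notation e t := (dotL2 (phi t) (phi t)).

(** The velocity is tested against H^{1/2} only: those are the functions for which the equation is
    available. *)
Definition zero_data t := [/\ t \in `]0, T[, e t = 0 & forall psi, Hs psi -> dotL2 (phi_t t) psi = 0].

(** Dini's theorem: the tails are continuous in time and decrease pointwise to 0. This permits one
    cut-off N for a whole time segment. *)
Lemma uniform_tail (a b : R) : 0 < a -> b < T -> forall eps, 0 < eps ->
  exists N, forall t, t \in `[a, b] -> tail (phi t) N <= eps.
Proof.
move=> a0 bT; have sub t : t \in `[a, b] -> t \in `]0, T[.
  by rewrite !in_itv/= => /andP[h1 h2]; lra.
apply: (@dini R `[a, b]); first exact: segment_compact.
- by move=> N t /sub tT; exact: (tail_phi_continuous phi_C).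
- move=> t; near=> t' => N M NM tab; rewrite lerD2l lerN2.
  by apply: pA_nondecreasing.
- move=> t /sub tT; rewrite -[X in _ --> X](subrr (pa (phi t) (phi t))).
  by apply: cvgB; [exact: cvg_cst|apply: Hs_cvg_diag; exact: (phi_Hs phi_C)].
Unshelve. all: by end_near. Qed.

(* phi_t is not in H^{1/2}, so it is not a test function. With Psi the primitive
   of phi in t vanishing at t0, integrating the equation in time bounds
   W = phi_t + A Psi, and |phi|^2 + (A Psi, Psi) has derivative 2 (W, phi). Keeping
   only N modes of A reduces Psi to N scalar functions, at the cost of a tail
   that is small uniformly in t. *)
Lemma energy_step (c t0 t1 : R) : 0 < c ->
  (forall t psi, t \in `]0, T[ -> L2 psi ->
   `|dotL2 (f \o phi t) psi| <= c * (Num.sqrt (e t) * Num.sqrt (dotL2 psi psi))) ->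
  zero_data t0 -> t1 \in `]0, T[ -> 2 * (t1 - t0) ^+ 2 * c < 1 -> e t1 = 0.
Proof.
move=> c0 fc [t0T e0 v0] t1T small.
(* [t1] may precede [t0]: the estimate runs in both time directions. *)
pose a := Num.min t0 t1; pose b := Num.max t0 t1.
have [t0lo t0hi] : 0 < t0 /\ t0 < T by move: t0T; rewrite in_itv => /andP.
have [t1lo t1hi] : 0 < t1 /\ t1 < T by move: t1T; rewrite in_itv => /andP.
have a0 : 0 < a by rewrite lt_min t0lo.
have bT : b < T by rewrite gt_max t0hi.
have ab : a <= b by rewrite ge_min le_max lexx.
have t0I : t0 \in `[a, b] by rewrite in_itv/= ge_min le_max !lexx.
have t1I : t1 \in `[a, b] by rewrite in_itv/= ge_min le_max !lexx !orbT.
have len t : t \in `[a, b] -> `|t - t0| <= `|t1 - t0|.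
  rewrite in_itv/= /a /b; have [h|h] := leP t0 t1 => /andP[h1 h2].
    have p1 : 0 <= t - t0 by lra.
    have p2 : 0 <= t1 - t0 by lra.
    by rewrite (ger0_norm p1) (ger0_norm p2); lra.
  have p1 : t - t0 <= 0 by lra.
  have p2 : t1 - t0 <= 0 by lra.
  by rewrite (ler0_norm p1) (ler0_norm p2); lra.
have sub t : t \in `[a, b] -> t \in `]0, T[.
  by rewrite !in_itv/= => /andP[h1 h2]; lra.
set l := `|t1 - t0| in len.
have l0 : 0 <= l by exact: normr_ge0.
have PH t : t \in `[a, b] -> Hs (phi t) by move=> /sub; exact: (phi_Hs phi_C).
have PL t : t \in `[a, b] -> L2 (phi t) by move=> /sub; exact: (phi_L2 phi_C).
have de t : t \in `[a, b] -> is_derive t 1 (fun t => e t) (2 * dotL2 (phi_t t) (phi t)).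
  by move=> /sub tT; exact: (is_derive_sqnorm_phi phi_C phi_t_C phi_phi_t tT).
(* The estimate will be closed on the maximum [m] of the squared norm over the segment. *)
have [tm tmI hm] : exists2 tm, tm \in `[a, b] & forall t, t \in `[a, b] -> e t <= e tm.
  have [//||tm tmI hm] := @EVT_max R (fun t => e t) a b.
    by apply: within_continuous => t tab; have := de _ tab; exact: is_derive_continuous.
  by exists tm.
set m := e tm in hm.
(* Room on both sides makes the primitives [Psi] two-sided differentiable on all of [[a, b]]. *)
pose c1 := a / 2; pose d1 := (b + T) / 2.
have [c10 c1a bd1 d1T] : [/\ 0 < c1, c1 < a, b < d1 & d1 < T].
  by rewrite /c1 /d1; split; lra.
have coefi n : intg `[c1, d1] (fun t => coef (phi t) n).
  apply: intg_segment; apply: within_continuous => t; rewrite /= in_itv/= => /andP[h1 h2].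
  by apply: (coef_phi_continuous phi_C); rewrite in_itv/=; lra.
pose Psi n t := \int[lebesgue_measure]_(s in `[c1, t]) coef (phi s) n -
  \int[lebesgue_measure]_(s in `[c1, t0]) coef (phi s) n.
have dPsi n t : t \in `[a, b] -> is_derive t 1 (Psi n) (coef (phi t) n).
  move=> tab; have tT := sub _ tab; move: tab; rewrite in_itv/= => /andP[h1 h2].
  rewrite -[coef _ _]subr0; apply: is_deriveB.
  apply: (@is_derive_Rintegral _ _ _ _ d1) => //; [lra|lra|].
  exact: (coef_phi_continuous phi_C).
have Psi0 n : Psi n t0 = 0 by rewrite /Psi subrr.
clearbody Psi.
have key eps : 0 < eps -> m <= 2 * l ^+ 2 * (c * m + eps).
  move=> eps0; have [N hN] := uniform_tail a0 bT eps0.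
  have cm0 : 0 <= c * m + eps by rewrite addr_ge0 ?(ltW eps0)// mulr_ge0 ?(ltW c0)// dotL2_ge0.
  (* Differentiating the sum adds back the low modes of (A phi, psi), so that only the forcing and a
     tail of the form remain in the derivative. *)
  pose W psi t := dotL2 (phi_t t) psi + \sum_(0 <= n < N) n%:R * coef psi n * chebh n * Psi n t.
  have dW psi t : Hs psi -> t \in `[a, b] -> is_derive t 1 (W psi)
      (dotL2 (f \o phi t) psi - (pa (phi t) psi - pA (phi t) psi N)).
    move=> Hpsi tab.
    have -> : dotL2 (f \o phi t) psi - (pa (phi t) psi - pA (phi t) psi N) =
      (dotL2 (f \o phi t) psi - pa (phi t) psi) + \sum_(0 <= n < N) n%:R * coef psi n * chebh n * coef (phi t) n.
      rewrite opprB addrA addrAC; congr (_ + _).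
      by apply: eq_bigr => n _; ring.
    apply: is_deriveD.
      exact: (is_derive_dotL2_phi_t f_lip f_bound phi_C phi_t_C phi_phi_t phi_weak (sub _ tab) Hpsi).
    apply: (@is_derive_sum_nat _ (fun n t => n%:R * coef psi n * chebh n * Psi n t)
      (fun n t => n%:R * coef psi n * chebh n * coef (phi t) n)) => n.
    by apply: is_deriveZ; exact: dPsi.
  have Wb r t : r \in `[a, b] -> t \in `[a, b] -> `|W (phi r) t| <= l * (c * m + eps).
    move=> rab tab.
    have W0 : W (phi r) t0 = 0.
      rewrite /W v0; last exact: PH.
      by rewrite add0r big1// => n _; rewrite Psi0 mulr0.
    have -> : W (phi r) t = W (phi r) t - W (phi r) t0 by rewrite W0 subr0.
    apply: (@le_trans _ _ ((c * m + eps) * `|t - t0|)); last first.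
      by rewrite mulrC ler_wpM2r// len.
    have hd s : s \in `[a, b] -> is_derive s 1 (W (phi r))
        (dotL2 (f \o phi s) (phi r) - (pa (phi s) (phi r) - pA (phi s) (phi r) N)).
      by move=> sab; exact: (dW _ _ (PH _ rab) sab).
    apply: (lip_of_derive hd _ t0I tab) => s sab; apply: (le_trans (ler_normB _ _)); apply: lerD.
      apply: (le_trans (fc _ _ (sub _ sab) (PL _ rab))).
      rewrite ler_wpM2l ?(ltW c0)// -[m]sqr_sqrtr ?dotL2_ge0// expr2.
      by rewrite ler_pM ?sqrtr_ge0// ler_wsqrtr// hm.
    apply: (le_trans (pa_tail_CS _ (PH _ sab) (PH _ rab))).
    rewrite -[eps]sqr_sqrtr ?(ltW eps0)// expr2.
    by rewrite ler_pM ?sqrtr_ge0// ler_wsqrtr// hN.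
  (* The added sum is nonnegative, so [E] dominates the squared norm, and its derivative contributes
     exactly the low modes of [W]. The bound of [W] over a length at most [l], integrated once more,
     gives the factor [l ^+ 2]. *)
  pose E t := e t + \sum_(0 <= n < N) n%:R * chebh n * (Psi n t * Psi n t).
  have dE t : t \in `[a, b] -> is_derive t 1 E (2 * W (phi t) t).
    move=> tab.
    have -> : 2 * W (phi t) t = 2 * dotL2 (phi_t t) (phi t) +
      \sum_(0 <= n < N) n%:R * chebh n * (Psi n t *: coef (phi t) n + Psi n t *: coef (phi t) n).
      rewrite /W mulrDr mulr_sumr; congr (_ + _); apply: eq_bigr => n _.
      by rewrite /GRing.scale/=; ring.
    have hn n : is_derive t 1 (fun t => n%:R * chebh n * (Psi n t * Psi n t))
        (n%:R * chebh n * (Psi n t *: coef (phi t) n + Psi n t *: coef (phi t) n)).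
      have dM := is_deriveM (dPsi n t tab) (dPsi n t tab).
      exact: (is_deriveZ (n%:R * chebh n) dM).
    have dS := @is_derive_sum_nat _ _
      (fun n t => n%:R * chebh n * (Psi n t *: coef (phi t) n + Psi n t *: coef (phi t) n)) N t hn.
    exact: (is_deriveD (de _ tab) dS).
  have E0 : E t0 = 0 by rewrite /E e0 add0r big1// => n _; rewrite Psi0 !mulr0.
  have Eb : `|E tm - E t0| <= 2 * (l * (c * m + eps)) * `|tm - t0|.
    have bE t : t \in `[a, b] -> `|2 * W (phi t) t| <= 2 * (l * (c * m + eps)).
      by move=> tab; rewrite normrM ger0_norm// ler_wpM2l// Wb.
    exact: (lip_of_derive dE bE t0I tmI).
  have mE : m <= E tm.
    rewrite /E lerDl sumr_ge0// => n _.
    apply: mulr_ge0; last by rewrite -expr2 sqr_ge0.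
    by apply: mulr_ge0 => //; apply: ltW; exact: chebh_gt0.
  apply: (le_trans mE); move: Eb; rewrite E0 subr0 => Eb.
  apply: (le_trans (ler_norm _)); apply: (le_trans Eb).
  have -> : 2 * l ^+ 2 * (c * m + eps) = 2 * (l * (c * m + eps)) * l by ring.
  apply: ler_wpM2l; last exact: len.
  by rewrite pmulr_rge0//; exact: mulr_ge0.
have m0 : 0 <= m by exact: dotL2_ge0.
have small' : 2 * l ^+ 2 * c < 1 by rewrite /l real_normK ?num_real.
(* Here [eps] tends to 0; dividing it by [2 * l ^+ 2 + 1] absorbs the factor in front and is
   harmless for [l = 0]. *)
have {}key : m <= 2 * l ^+ 2 * (c * m).
  apply/ler_addgt0Pr => eps eps0.
  have k0 : 0 < 2 * l ^+ 2 + 1 by rewrite ltr_wpDl// mulr_ge0// sqr_ge0.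
  have := key (eps / (2 * l ^+ 2 + 1)); rewrite divr_gt0// => /(_ isT) h.
  apply: (le_trans h); rewrite mulrDr lerD2l mulrCA ler_piMr ?(ltW eps0)//.
  by rewrite ler_pdivrMr// mul1r lerDl.
have mz : m <= 0.
  rewrite -(@pmulr_rle0 _ (1 - 2 * l ^+ 2 * c)) ?subr_gt0//; lra.
apply/eqP; rewrite eq_le dotL2_ge0 andbT; exact: le_trans (hm _ t1I) mz.
Qed.

Lemma zero_data_of_near t : t \in `]0, T[ -> (\forall s \near t, e s = 0) -> zero_data t.
Proof.
move=> tT et; split => //; first exact: nbhs_singleton et.
have oT : \forall s \near t, s \in `]0, T[ by apply: open_nbhs_nbhs; split => //; exact: interval_open.
move=> psi Hpsi; have Lpsi : L2 psi by apply: L2W_L2; case: Hpsi.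
have d := is_derive_dotL2_phi phi_C phi_t_C phi_phi_t tT Lpsi.
rewrite -(@derive_val _ _ _ _ _ _ _ d) -(@near_eq_derive R _ _ (cst 0)) ?derive_cst//.
apply: filterS2 et oT => s es sT; rewrite /cst; apply/esym/eqP; rewrite -normr_le0.
apply: le_trans (dotL2_CS (phi_L2 phi_C sT) Lpsi) _.
by rewrite es sqrtr0 mul0r.
Qed.

Lemma zero_data_propagates t0 : zero_data t0 -> forall t, t \in `]0, T[ -> e t = 0.
Proof.
have [c c0 fc] := f_phi_bound f_lip f_bound phi_C.
(* With this length, 2 h^2 c = c / (2 (c + 1)^2) < 1, as [energy_step] demands. *)
pose h := (2 * (c + 1))^-1.
have h0 : 0 < h by rewrite invr_gt0; lra.
have hE : h * (2 * (c + 1)) = 1 by rewrite mulVf//; lra.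
have step s t : zero_data s -> t \in `]0, T[ -> `|t - s| <= h -> e t = 0.
  move=> ds tT st; apply: (energy_step c0 fc ds tT).
  have : (t - s) ^+ 2 <= h ^+ 2 by apply: sqr_le_norm; rewrite (gtr0_norm h0).
  move=> h2; apply: (@le_lt_trans _ _ (2 * h ^+ 2 * c)); first by rewrite ler_pM2r// ler_pM2l.
  by nra.
(* Moving by half of [h] leaves a whole neighbourhood of [t] within reach of [s], so that the
   velocity vanishes there too and the step can be repeated. *)
have step2 s t : zero_data s -> t \in `]0, T[ -> `|t - s| <= h / 2 -> zero_data t.
  move=> ds tT st; apply: zero_data_of_near => //.
  have oT : \forall r \near t, r \in `]0, T[ by apply: open_nbhs_nbhs; split => //; exact: interval_open.
  have dT : \forall r \near t, `|t - r| <= h / 2.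
    by exists (h / 2) => [|r /= /ltW//]; rewrite /= divr_gt0.
  apply: filterS2 oT dT => r rT tr; apply: (step s) => //.
  have -> : r - s = (t - s) - (t - r) by ring.
  by apply: (le_trans (ler_normB _ _)); lra.
have main k : forall s t, zero_data s -> t \in `]0, T[ -> `|t - s| <= k%:R * (h / 2) -> zero_data t.
  elim: k => [|k IH] s t ds tT ts; first by apply: (step2 s) => //; move: ts; rewrite mul0r; lra.
  have [hs|hs] := leP `|t - s| (h / 2); first exact: (step2 s).
  have [sT _ _] := ds.
  pose r := if s < t then s + h / 2 else s - h / 2.
  have [rT rs tr] : [/\ r \in `]0, T[, `|r - s| <= h / 2 & `|t - r| <= k%:R * (h / 2)].
    move: ts hs sT tT; rewrite -natr1 mulrDl mul1r !in_itv/= /r => ts hs /andP[s1 s2] /andP[t1 t2].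
    have [st|st] := ltP s t.
      move: ts hs; rewrite gtr0_norm ?subr_gt0// => ts hs; split.
      - by lra.
      - by rewrite ger0_norm; lra.
      - by rewrite ger0_norm; lra.
    move: ts hs; rewrite ler0_norm ?subr_le0// => ts hs; split.
    - by lra.
    - by rewrite ler0_norm; lra.
    - by rewrite ler0_norm; lra.
  by apply: (IH r) => //; exact: (step2 s).
move=> d0 t tT.
suff [] : zero_data t by [].
have hh : 0 < h / 2 by lra.
apply: (main (Num.Def.truncn (`|t - t0| / (h / 2))).+1 t0) => //.
by rewrite -ler_pdivrMr// ltW// truncnS_gt.
Qed.

End Energy.

(** * Power series vanishing on an arc *)

Section CirclePowerSeries.
Context {R : realType}.
Implicit Types (t : R) (z : R[i]) (c : nat -> R).
Import Normc.

Definition cis t : R[i] := Complex (cos t) (sin t).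

Lemma cisD s t : cis (s + t) = cis s * cis t.
Proof.
rewrite /cis; apply/eqP; rewrite eq_complex /= cosD sinD eqxx/=; apply/eqP; ring.
Qed.

Lemma cis0 : cis 0 = 1.
Proof. by rewrite /cis cos0 sin0. Qed.

Lemma cisX t n : cis t ^+ n = cis (n%:R * t).
Proof.
elim: n => [|n IH]; first by rewrite expr0 mul0r cis0.
by rewrite exprS IH -cisD -[n.+1]add1n natrD mulrDl mul1r.
Qed.

Lemma cis2pi : cis (2 * pi) = 1.
Proof. by rewrite /cis mulr_natl cos2pi sin2pi. Qed.

Lemma normc_cis t : normc (cis t) = 1.
Proof. by rewrite /normc/= cos2Dsin2 sqrtr1. Qed.

Lemma cis_neq1 t : 0 < t < 2 * pi -> cis t != 1.
Proof.
move=> /andP[t0 tpi]; apply/eqP => /(congr1 (@complex.Re R)) /= ct.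
have h : cos t = 1 - 2 * sin (t / 2) ^+ 2.
  have -> : cos t = cos (t / 2 + t / 2) by congr cos; field.
  by rewrite cosD; have := cos2Dsin2 (t / 2); rewrite !expr2; lra.
have s0 : 0 < sin (t / 2) by apply: sin_gt0_pi; lra.
have : 0 < sin (t / 2) ^+ 2 by rewrite exprn_gt0.
by move: h; rewrite ct; lra.
Qed.

Lemma normc_real (a : R) : normc (a%:C)%C = `|a|.
Proof. by rewrite /normc/= expr0n/= addr0 sqrtr_sqr. Qed.

Lemma normc_ge0 z : 0 <= normc z.
Proof. by case: z => a b; exact: sqrtr_ge0. Qed.

Lemma normc_sum (I : Type) (s : seq I) (F : I -> R[i]) :
  normc (\sum_(i <- s) F i) <= \sum_(i <- s) normc (F i).
Proof.
elim: s => [|i s IH]; first by rewrite !big_nil normc0.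
by rewrite !big_cons (le_trans (le_normcD _ _))// lerD2l.
Qed.

Lemma normc_prod (I : Type) (s : seq I) (F : I -> R[i]) :
  normc (\prod_(i <- s) F i) = \prod_(i <- s) normc (F i).
Proof.
elim: s => [|i s IH]; first by rewrite !big_nil normc1.
by rewrite !big_cons normcM IH.
Qed.

Lemma normc_le z : normc z <= `|complex.Re z| + `|complex.Im z|.
Proof.
case: z => a b; rewrite /normc/= -[X in _ <= X]ger0_norm ?addr_ge0//.
rewrite -sqrtr_sqr ler_wsqrtr// sqrrD !real_normK ?num_real// -addrA lerD2l lerDr.
by rewrite mulrn_wge0// mulr_ge0.
Qed.

(* Averaging over the [L]-th roots of unity isolates the constant term. *)
Lemma horner0_le (p : {poly R[i]}) (M : R) :
  (forall t, 0 <= t < 2 * pi -> normc p.[cis t] <= M) -> normc p.[0] <= M.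
Proof.
(* [L] exceeds the degree, so every frequency between 1 and the degree averages to 0 over the [L]-th
   roots of unity. *)
move=> hM; set L := (size p).+1; pose d : R := 2 * pi / L%:R.
have pi0 := @pi_gt0 R.
have L0 : 0 < L%:R :> R by rewrite ltr0n.
have d0 : 0 < d by rewrite divr_gt0// mulr_gt0.
have roots n : (0 < n < L)%N -> \sum_(l < L) cis (l%:R * d) ^+ n = 0.
  move=> /andP[n0 nL]; set w := cis (n%:R * d).
  have -> : \sum_(l < L) cis (l%:R * d) ^+ n = \sum_(l < L) w ^+ l.
    by apply: eq_bigr => l _; rewrite !cisX; congr cis; ring.
  have w1 : w != 1.
    apply: cis_neq1; rewrite mulr_gt0 ?ltr0n//= /d mulrCA gtr_pMr ?mulr_gt0//.
    by rewrite ltr_pdivrMr// mul1r ltr_nat.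
  have wL : w ^+ L = 1.
    rewrite /w cisX; have -> : L%:R * (n%:R * d) = n%:R * (2 * pi) by rewrite /d; field; rewrite gt_eqF.
    by rewrite -cisX cis2pi expr1n.
  have := subrX1 w L; rewrite wL subrr => /esym/eqP; rewrite mulf_eq0 subr_eq0 (negbTE w1)/=.
  by move=> /eqP.
have : \sum_(l < L) p.[cis (l%:R * d)] = L%:R * p.[0].
  under eq_bigr do rewrite horner_coef.
  rewrite exchange_big/=.
  case: (posnP (size p)) => [sp|sp].
    rewrite big1 => [|i _]; first by move/eqP: sp; rewrite size_poly_eq0 => /eqP ->; rewrite horner0 mulr0.
    by case: i => i; rewrite sp.
  rewrite (bigD1 (Ordinal sp))//= [X in _ + X]big1 => [|i i0].
    under eq_bigr do rewrite expr0 mulr1.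
    by rewrite addr0 sumr_const card_ord horner_coef0 mulr_natl.
  rewrite -mulr_sumr roots ?mulr0//.
  by rewrite lt0n (ltn_trans (ltn_ord i)) ?ltnSn// andbT.
move=> /(congr1 (@normc R)); rewrite normcM => h.
have -> : normc p.[0] = L%:R^-1 * normc (\sum_(l < L) p.[cis (l%:R * d)]).
  have nL : normc (L%:R : R[i]) = L%:R.
    by have -> : (L%:R : R[i]) = ((L%:R : R)%:C)%C by [rewrite rmorph_nat]; rewrite normc_real normr_nat.
  by rewrite h nL mulKf// gt_eqF.
rewrite ler_pdivrMl//; apply: le_trans (normc_sum _ _) _.
apply: (@le_trans _ _ (\sum_(l < L) M)); last by rewrite sumr_const card_ord mulr_natl.
apply: ler_sum => l _; apply: hM; rewrite mulr_ge0 ?(ltW d0)//= /d mulrCA gtr_pMr ?mulr_gt0//.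
by rewrite ltr_pdivrMr// mul1r ltr_nat.
Qed.

Definition csum c N z : R[i] := \sum_(0 <= n < N) ((c n)%:C)%C * z ^+ n.

Lemma csumE c N t : csum c N (cis t) =
  Complex (\sum_(0 <= n < N) c n * cos (n%:R * t)) (\sum_(0 <= n < N) c n * sin (n%:R * t)).
Proof.
elim: N => [|N IH]; first by rewrite /csum !big_geq.
rewrite /csum big_nat_recr//= -/(csum c N (cis t)) IH !(big_nat_recr N)//= cisX /cis.
by apply/eqP; rewrite eq_complex /= !mul0r subr0 addr0 !eqxx.
Qed.

Lemma csum_tail c N M t : (N <= M)%N -> normc (csum c M (cis t)) >= normc (csum c N (cis t)) -
  \sum_(N <= n < M) `|c n|.
Proof.
move=> NM; have -> : csum c N (cis t) = csum c M (cis t) - \sum_(N <= n < M) ((c n)%:C)%C * cis t ^+ n.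
  by rewrite /csum [\sum_(0 <= n < M) _](big_cat_nat (n := N))//= addrK.
rewrite lerBlDr; apply: le_trans (le_normcD _ _) _; rewrite lerD2l normcN.
apply: le_trans (normc_sum _ _) _; apply: ler_sum => n _.
by rewrite normcM normc_real cisX normc_cis mulr1.
Qed.

Section Uniqueness.
Context (c : nat -> R) (B al be : R) (cB : forall N, \sum_(0 <= n < N) `|c n| <= B).
Context (al_ge0 : 0 <= al) (albe : al < be).
Context (cos0_ : forall t, al < t < be -> \sum_(0 <= n < N) c n * cos (n%:R * t) @[N --> \oo] --> (0 : R)).
Context (sin0_ : forall t, al < t < be -> \sum_(0 <= n < N) c n * sin (n%:R * t) @[N --> \oo] --> (0 : R)).

Let sg N := \sum_(0 <= n < N) `|c n|.

Let sg_cvg : cvgn sg.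
Proof.
apply: nondecreasing_is_cvgn; last by exists B => _ [N _ <-]; exact: cB.
by apply/nondecreasing_seqP => N; rewrite /sg big_nat_recr//= lerDl.
Qed.

Let tau N := lim (sg @ \oo) - sg N.

Let tau_cvg : tau N @[N --> \oo] --> (0 : R).
Proof.
rewrite -[X in _ --> X](subrr (lim (sg @ \oo))); apply: cvgB; first exact: cvg_cst.
exact: sg_cvg.
Qed.

(** The full series is 0 on the arc, so a partial sum is bounded by the remaining absolute sum,
    uniformly in [t]. *)
Let csum_arc N t : al < t < be -> normc (csum c N (cis t)) <= tau N.
Proof.
move=> tI; apply/ler_addgt0Pr => e e0.
have e2 : 0 < e / 2 by rewrite divr_gt0.
have /cvgr0Pnorm_le/(_ _ e2)[N1 _ h1] := cos0_ tI.
have /cvgr0Pnorm_le/(_ _ e2)[N2 _ h2] := sin0_ tI.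
pose M := maxn N (maxn N1 N2).
have NM : (N <= M)%N by rewrite leq_maxl.
have := csum_tail c t NM; rewrite lerBlDr => h; apply: (le_trans h).
rewrite addrC; apply: lerD.
  have -> : \sum_(N <= n < M) `|c n| = sg M - sg N.
    by rewrite /sg [\sum_(0 <= n < M) _](big_cat_nat (n := N))//= addrAC subrr add0r.
  rewrite lerD2r; apply: nondecreasing_cvgn_le => //.
  by apply/nondecreasing_seqP => n; rewrite /sg big_nat_recr//= lerDl.
apply: le_trans (normc_le _) _; rewrite csumE/= [e]splitr; apply: lerD.
  by apply: h1; rewrite /= !leq_max leqnn !orbT.
by apply: h2; rewrite /= !leq_max leqnn !orbT.
Qed.

(** Raised to at least 1, so that a product of fewer than [m] factors bounded by [B1] is still at
    most [B1 ^+ m]. *)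
Let B1 := 1 + B.

Let B1_ge1 : 1 <= B1.
Proof. by rewrite lerDl; have := cB 0; rewrite big_geq. Qed.

(** A quantitative version on partial sums: on the whole circle the product of rotates is at most
    [tau (N + k) * B1 ^+ m], because one factor is evaluated on the arc. At 0 its modulus is
    [|c k| ^+ m], and N tends to infinity. *)
Let first_coef k : (forall j, (j < k)%N -> c j = 0) -> c k = 0.
Proof.
move=> ck0.
have pi0 := @pi_gt0 R; have al0 := al_ge0; have ab := albe.
(* The partial sum divided by z^k; its constant term is [c k]. *)
pose P N : {poly R[i]} := \poly_(n < N) ((c (n + k))%:C)%C.
have PE N z : (P N).[z] = \sum_(0 <= n < N) ((c (n + k)%N)%:C)%C * z ^+ n.
  by rewrite horner_poly big_mkord.
have PS N t : csum c (N + k) (cis t) = (P N).[cis t] * cis t ^+ k.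
  rewrite /csum (big_cat_nat (n := k))//= ?leq_addl// big_nat_cond big1 => [|n /andP[/andP[_ nk] _]]; last first.
    by rewrite ck0// mul0r.
  rewrite add0r -[X in \sum_(X <= _ < _) _]add0n big_addn addnK PE mulr_suml.
  by apply: eq_bigr => n _; rewrite exprD mulrA.
have P_arc N t : al < t < be -> normc (P N).[cis t] <= tau (N + k).
  move=> tI; have := csum_arc (N + k) tI.
  by rewrite PS normcM cisX normc_cis mulr1.
have P_bd N t : normc (P N).[cis t] <= B1.
  rewrite PE; apply: le_trans (normc_sum _ _) _.
  apply: (@le_trans _ _ (sg (N + k))).
    rewrite /sg [\sum_(0 <= n < N + k) _](big_cat_nat (n := k))//= ?leq_addl//.
    have -> : \sum_(k <= n < N + k) `|c n| = \sum_(0 <= n < N) `|c (n + k)%N|.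
      by rewrite -{1}[k]add0n big_addn addnK.
    rewrite -[X in X <= _]add0r; apply: lerD; first exact: sumr_ge0.
    by apply: ler_sum => n _; rewrite normcM normc_real cisX normc_cis mulr1.
  by rewrite (le_trans (cB _))// lerDr.
pose d := (be - al) / 2.
have d0 : 0 < d by rewrite divr_gt0// subr_gt0.
(* The angle step [d] is half the length of the arc, so steps cannot jump over it. At most (al + 2
   pi) / d + 1 of them lead from any t in [0, 2 pi) past al + 2 pi, and [.+2] makes that number an
   index below [m]. *)
pose m := (Num.Def.truncn ((al + 2 * pi) / d)).+2.
(* every point of the circle is mapped into the arc by one of the rotations *)
pose Q N : {poly R[i]} := \prod_(j < m) (P N \Po (cis (j%:R * d) *: 'X)).
have QE N z : (Q N).[z] = \prod_(j < m) (P N).[cis (j%:R * d) * z].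
  by rewrite /Q horner_prod; apply: eq_bigr => j _; rewrite horner_comp hornerZ hornerX.
have Q_bd N t : 0 <= t < 2 * pi -> normc (Q N).[cis t] <= tau (N + k) * B1 ^+ m.
  move=> /andP[t0 tpi]; rewrite QE normc_prod.
  (* The first number of steps that takes [t] beyond al + 2 pi; it then falls short of be + 2 pi. *)
  pose q := (Num.Def.truncn ((al + 2 * pi - t) / d)).+1.
  have y0 : 0 <= (al + 2 * pi - t) / d by apply: divr_ge0; [lra|exact: ltW].
  have qm : (q < m)%N.
    rewrite /q /m !ltnS; apply: le_truncn.
    by rewrite ler_pM2r ?invr_gt0// lerBlDr lerDl.
  have q1 : al + 2 * pi < q%:R * d + t.
    by rewrite -ltrBlDr -ltr_pdivrMr//; exact: truncnS_gt.
  have q2 : q%:R * d + t < be + 2 * pi.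
    have : (Num.Def.truncn ((al + 2 * pi - t) / d))%:R <= (al + 2 * pi - t) / d by rewrite truncn_le.
    rewrite ler_pdivlMr// => h; rewrite /q -natr1 mulrDl mul1r.
    by move: h; rewrite /d; lra.
  rewrite (bigD1 (Ordinal qm))//=; apply: ler_pM.
  - exact: normc_ge0.
  - by apply: prodr_ge0 => j _; exact: normc_ge0.
  - rewrite -cisD; have -> : cis (q%:R * d + t) = cis (q%:R * d + t - 2 * pi).
      rewrite -[LHS]mulr1 -[RHS]mulr1 -{2}cis2pi -cisD subrK mulr1//.
    by apply: P_arc; lra.
  - apply: (@le_trans _ _ (\prod_(j < m | j != Ordinal qm) B1)).
      by apply: ler_prod => j _; rewrite normc_ge0 -cisD P_bd.
    rewrite prodr_const; apply: ler_weXn2l => //.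
    by rewrite -[X in (_ <= X)%N]card_ord; exact: max_card.
have Q0 N : (0 < N)%N -> normc (Q N).[0] = `|c k| ^+ m.
  move=> N0; rewrite QE normc_prod.
  have -> : (\prod_(i < m) normc (P N).[cis (i%:R * d) * 0]) = \prod_(i < m) `|c k|.
    apply: eq_bigr => j _; rewrite mulr0 horner_coef0 coef_poly N0 add0n.
    exact: normc_real.
  by rewrite prodr_const card_ord.
have ck N : (0 < N)%N -> `|c k| ^+ m <= tau (N + k) * B1 ^+ m.
  by move=> N0; rewrite -(Q0 N N0); apply: horner0_le => t; exact: Q_bd.
have lim0 : tau (N + k) * B1 ^+ m @[N --> \oo] --> (0 : R).
  rewrite -[X in _ --> X](mul0r (B1 ^+ m)); apply: cvgMl.
  by rewrite (cvg_shiftn k); exact: tau_cvg.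
have : `|c k| ^+ m <= 0.
  rewrite -(cvg_lim _ lim0)//; apply: limr_ge; first by apply/cvg_ex; exists 0.
  by exists 1%N => // N /= N0; exact: ck.
by rewrite -normrX normr_le0 expf_eq0/= => /eqP.
Qed.

Lemma circle_uniqueness n : c n = 0.
Proof. by elim/ltn_ind: n => n IH; exact: first_coef. Qed.

End Uniqueness.

End CirclePowerSeries.

(** * Expansion of the primitive *)

Section Completeness.
Context {R : realType}.
Implicit Types (f g u chi : R -> R) (x a : R) (b : nat -> R).
Local Notation mu := (@lebesgue_measure R).
Local Notation Om := (@Omega R).

(** The polynomials on Omega, represented by their Chebyshev coefficients. *)
Definition chebspan f := exists b N, forall x, Om x -> f x = trig_cos b N x.

Lemma trig_cos_widen b N M x : (N <= M)%N ->
  trig_cos (fun n => if (n < N)%N then b n else 0) M x = trig_cos b N x.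
Proof.
move=> NM; rewrite /trig_cos (big_cat_nat (n := N))//= [X in _ + X]big_nat_cond [X in _ + X]big1 => [|n /andP[/andP[Nn _] _]].
  by rewrite addr0; apply: eq_big_nat => n /andP[_ ->].
by rewrite ltnNge Nn mul0r.
Qed.

Lemma chebspanD f g : chebspan f -> chebspan g -> chebspan (fun x => f x + g x).
Proof.
move=> [b [N fb]] [b' [N' gb]].
exists (fun n => (if (n < N)%N then b n else 0) + (if (n < N')%N then b' n else 0)), (maxn N N') => x xO.
rewrite fb// gb// -(trig_cos_widen b x (leq_maxl N N')) -(trig_cos_widen b' x (leq_maxr N N')).
by rewrite /trig_cos -big_split/=; apply: eq_bigr => n _; rewrite mulrDl.
Qed.

Lemma chebspanZ (k : R) f : chebspan f -> chebspan (fun x => k * f x).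
Proof.
move=> [b [N fb]]; exists (fun n => k * b n), N => x xO.
by rewrite fb// /trig_cos mulr_sumr; apply: eq_bigr => n _; rewrite mulrA.
Qed.

Lemma eq_chebspan f g : (forall x, Om x -> f x = g x) -> chebspan f -> chebspan g.
Proof. by move=> fg [b [N fb]]; exists b, N => x xO; rewrite -fg// fb. Qed.

Lemma chebspanT n : chebspan (chebyshevT n).
Proof.
exists (fun m => if n == m then 1 else 0), n.+1 => x _.
rewrite /trig_cos (eq_bigr (fun m => if n == m then chebyshevT m x else 0)).
  by rewrite sum_nat_delta ltnS leqnn.
by move=> m _; case: eqP => _; rewrite ?mul1r ?mul0r.
Qed.

Lemma chebspan0 : chebspan (fun=> 0).
Proof. by exists (fun=> 0), 0%N => x _; rewrite /trig_cos big_geq. Qed.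

Lemma chebspanXT n : chebspan (fun x => x * chebyshevT n x).
Proof.
case: n => [|n].
  apply: (@eq_chebspan (chebyshevT 1)); last exact: chebspanT.
  by move=> x xO; rewrite chebyshevT1// chebyshevT0 mulr1.
apply: (@eq_chebspan (fun x => 2^-1 * (chebyshevT n.+2 x + chebyshevT n x))).
  by move=> x xO; rewrite chebyshevTS//; field.
by apply: chebspanZ; apply: chebspanD; exact: chebspanT.
Qed.

Lemma chebspanX f : chebspan f -> chebspan (fun x => x * f x).
Proof.
move=> [b [N fb]]; apply: (@eq_chebspan (fun x => x * trig_cos b N x)).
  by move=> x xO; rewrite fb.
elim: N {fb} => [|N IH].
  apply: eq_chebspan chebspan0 => x _; by rewrite /trig_cos big_geq// mulr0.
apply: (eq_chebspan _ (chebspanD IH (chebspanZ (b N) (chebspanXT N)))) => x _.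
by rewrite /trig_cos big_nat_recr//=; ring.
Qed.

Lemma chebspan_poly (p : {poly R}) : chebspan (fun x => p.[x]).
Proof.
elim/poly_ind: p => [|p k IH].
  by apply: eq_chebspan chebspan0 => x _; rewrite horner0.
apply: (eq_chebspan _ (chebspanD (chebspanX IH) (chebspanZ k (chebspanT 0)))) => x _.
by rewrite chebyshevT0 hornerMXaddC mulr1 mulrC.
Qed.

Lemma chebspan_L2W f : chebspan f -> L2W f.
Proof.
move=> [b [N fb]]; apply: (@eq_L2r _ _ (trig_cos b N)); first by move=> x xO; rewrite fb.
apply: (@bounded_L2r _ _ _ (\sum_(0 <= n < N) `|b n|)); [exact: winv_intg|exact: trig_cos_mfun|].
by move=> x _; exact: trig_cos_bound.
Qed.

(* The cubic 3y^2 - 2y^3 fixes 0, 1/2 and 1, and its iterates push [0, 1/2) to 0 and (1/2, 1] to 1. *)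
Definition smoothstep : {poly R} := 3 *: 'X^2 - 2 *: 'X^3.

Lemma smoothstepE x : smoothstep.[x] = x ^+ 2 * (3 - 2 * x).
Proof. by rewrite /smoothstep hornerD hornerN !hornerZ !hornerXn; ring. Qed.

Definition stepn n x := iter n (horner smoothstep) x.

Lemma smoothstep01 x : 0 <= x <= 1 -> 0 <= smoothstep.[x] <= 1.
Proof.
move=> /andP[x0 x1]; rewrite smoothstepE; apply/andP; split.
  by rewrite mulr_ge0 ?sqr_ge0//; lra.
rewrite -subr_ge0; have -> : 1 - x ^+ 2 * (3 - 2 * x) = (1 - x) ^+ 2 * (1 + 2 * x) by ring.
by rewrite mulr_ge0 ?sqr_ge0//; lra.
Qed.

Lemma stepn01 n x : 0 <= x <= 1 -> 0 <= stepn n x <= 1.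
Proof. by move=> x01; elim: n => [//|n IH]; rewrite /stepn iterS; exact: smoothstep01. Qed.

Lemma stepn_sym n x : stepn n (1 - x) = 1 - stepn n x.
Proof.
elim: n => [//|n IH]; rewrite /stepn !iterS -!/(stepn n _) IH !smoothstepE; ring.
Qed.

Lemma stepn_cvg0 x : 0 <= x < 2^-1 -> stepn n x @[n --> \oo] --> (0 : R).
Proof.
move=> /andP[x0 x1]; pose q := x * (3 - 2 * x).
(* The factor [q] dominates the ratio of consecutive iterates, so the decay is geometric. *)
have q1 : q < 1.
  by rewrite -subr_gt0 (_ : 1 - q = (1 - x) * (1 - 2 * x)); [rewrite mulr_gt0//; lra|rewrite /q; ring].
have q0 : 0 <= q by rewrite mulr_ge0//; lra.
have bound n : 0 <= stepn n x <= x * q ^+ n.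
  elim: n => [|n /andP[s0 s1]]; first by rewrite expr0 mulr1 /stepn/= x0 lexx.
  have sx : stepn n x <= x by apply: (le_trans s1); rewrite ler_piMr// exprn_ile1// ltW.
  rewrite /stepn iterS -/(stepn n x) smoothstepE; apply/andP; split.
    by rewrite mulr_ge0 ?sqr_ge0//; lra.
  rewrite [q ^+ n.+1]exprSr [x * (_ * q)]mulrA; have -> : stepn n x ^+ 2 * (3 - 2 * stepn n x) =
    stepn n x * (stepn n x * (3 - 2 * stepn n x)) by ring.
  apply: ler_pM => //; first by rewrite mulr_ge0//; lra.
  by rewrite /q; nra.
apply: (@squeeze_cvgr _ _ _ _ (fun=> 0) (fun n => x * q ^+ n)).
- by apply: nearW => n; exact: bound.
- exact: cvg_cst.
- rewrite -[X in _ --> X](mulr0 x); apply: cvgMr; apply: cvg_expr.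
  by rewrite ger0_norm.
Qed.

Lemma stepn_cvg1 x : 2^-1 < x <= 1 -> stepn n x @[n --> \oo] --> (1 : R).
Proof.
move=> /andP[x0 x1].
have -> : (fun n => stepn n x) = (fun n => 1 - stepn n (1 - x)).
  by apply/funext => n; rewrite stepn_sym subKr.
rewrite -[X in _ --> X]subr0; apply: cvgB; first exact: cvg_cst.
by apply: stepn_cvg0; lra.
Qed.

Lemma stepn_poly n (p : {poly R}) : exists p' : {poly R}, forall x, stepn n p.[x] = p'.[x].
Proof.
elim: n => [|n [p' hp]]; first by exists p.
exists (smoothstep \Po p') => x.
by rewrite /stepn iterS -/(stepn n _) hp horner_comp.
Qed.

Definition right_of a x : R := if a < x then 1 else 0.

Lemma right_of_mfun a : mfun Om (right_of a).
Proof.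
have -> : right_of a = \1_(`]a, +oo[).
  apply/funext => x; rewrite /right_of indicE.
  by case: ifPn => ax; [rewrite mem_set//= in_itv/= ax|rewrite memNset//= in_itv/= andbT; exact/negP].
by apply: measurable_indic; exact: measurable_itv.
Qed.

Lemma right_of_bound a x : `|right_of a x| <= 1.
Proof. by rewrite /right_of; case: ifP => _; rewrite ?normr1 ?normr0. Qed.

Lemma right_of_L2W a : L2W (right_of a).
Proof.
apply: (@bounded_L2r _ _ _ 1); [exact: winv_intg|exact: right_of_mfun|].
by move=> x _; exact: right_of_bound.
Qed.

(** An explicit polynomial approximation of a step. An affine map sends Omega into [0, 1] and [a] to
    1/2, and the iterates of [smoothstep] then tend boundedly to the step away from the null set
    {a}. *)
Lemma right_of_approx a : Om a -> forall e, 0 < e ->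
  exists2 p, chebspan p & dotW (fun x => right_of a x - p x) (fun x => right_of a x - p x) <= e.
Proof.
rewrite OmE => /andP[a1 a2] e e0.
(* The slope 1/4 works because |x - a| < 2 on Omega. *)
pose l : {poly R} := (2^-1 - a / 4)%:P + 4^-1 *: 'X.
have lE x : l.[x] = 2^-1 + (x - a) / 4 by rewrite /l hornerD hornerC hornerZ hornerX; field.
pose p n x := stepn n l.[x].
have sp n : chebspan (p n).
  have [p' hp] := stepn_poly n l.
  by apply: (@eq_chebspan (fun x => p'.[x])) => [x _|]; [rewrite -hp|exact: chebspan_poly].
have l01 x : Om x -> 0 <= l.[x] <= 1.
  by rewrite OmE lE => /andP[x1 x2]; lra.
have h : dotW (fun x => right_of a x - p n x) (fun x => right_of a x - p n x) @[n --> \oo] -->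
    \int[mu]_(x in Om) (0 : R).
  apply: (@Rdominated _ _ _ _ (fun x => winv x)); first exact: mOm.
  - move=> n; have [mp _] := L2WB (right_of_L2W a) (chebspan_L2W (sp n)).
    by apply: measurable_funM; [exact: winv_mfun|exact: measurable_funM].
  - exact: measurable_cst.
  - exact: winv_intg.
  - have na : {ae mu, forall x, x != a}.
      have := @measure0 _ _ _ mu; move=> _.
      exists [set a]; split; [exact: measurable_set1|exact: lebesgue_measure_set1|].
      by move=> x /= /negP; rewrite negbK => /eqP.
    apply: aeS na => x xa xO.
    have pc : p n x @[n --> \oo] --> right_of a x.
      have := l01 x xO => /andP[h1 h2].
      rewrite /right_of; have [ax|xa'|e1] := ltgtP a x; last by rewrite e1 eqxx in xa.
        by apply: stepn_cvg1; rewrite h2 andbT lE; lra.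
      by apply: stepn_cvg0; rewrite h1/= lE; lra.
    have hd : right_of a x - p n x @[n --> \oo] --> (0 : R).
      by rewrite -[X in _ --> X](subrr (right_of a x)); apply: cvgB; [exact: cvg_cst|exact: pc].
    rewrite -[X in _ --> X](mulr0 (winv x)); apply: cvgMr.
    by rewrite -[X in _ --> X](mulr0 0); exact: cvgM.
  - move=> n x xO; rewrite normrM gtr0_norm ?winv_gt0// ler_piMr ?(ltW (winv_gt0 xO))//.
    have := stepn01 n (l01 x xO) => /andP[h1 h2].
    have hh : `|right_of a x - p n x| <= 1.
      by rewrite /right_of /p ler_norml; case: ifP => _; lra.
    by rewrite normrM -[1]mulr1 ler_pM.
have z0 : \int[mu]_(x in Om) (0 : R) = 0 by rewrite Rintegral_cst ?mul0r//; exact: mOm.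
rewrite z0 in h.
have [N _ hN] := cvgr_le _ h _ e0.
by exists (p N) => //; exact: (hN N (leqnn _)).
Qed.

End Completeness.

(** * Bessel, Parseval and the series of the primitive *)

Section Parseval.
Context {R : realType}.
Implicit Types (f g u chi psi : R -> R) (x a : R) (b : nat -> R).
Local Notation mu := (@lebesgue_measure R).
Local Notation Om := (@Omega R).

Lemma dotW_sym f g : dotW f g = dotW g f.
Proof. exact: dotr_sym. Qed.

Lemma dotWDl f g h : L2W f -> L2W g -> L2W h ->
  dotW (fun x => f x + g x) h = dotW f h + dotW g h.
Proof. exact: (dotrDl winv_mfun winv_gt0). Qed.

Lemma dotWZl (k : R) f h : L2W f -> L2W h -> dotW (fun x => k * f x) h = k * dotW f h.
Proof. exact: (dotrZl winv_mfun winv_gt0). Qed.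

Lemma dotWBl f g h : L2W f -> L2W g -> L2W h ->
  dotW (fun x => f x - g x) h = dotW f h - dotW g h.
Proof. exact: (dotrBl winv_mfun winv_gt0). Qed.

Lemma dotWBr f g h : L2W f -> L2W g -> L2W h ->
  dotW h (fun x => f x - g x) = dotW h f - dotW h g.
Proof. exact: (dotrBr winv_mfun winv_gt0). Qed.

Lemma dotW_subsq f g : L2W f -> L2W g ->
  dotW (fun x => f x - g x) (fun x => f x - g x) = dotW f f - 2 * dotW f g + dotW g g.
Proof. exact: (dotr_subsq winv_mfun winv_gt0). Qed.

Lemma dotW_CS f g : L2W f -> L2W g ->
  `|dotW f g| <= Num.sqrt (dotW f f) * Num.sqrt (dotW g g).
Proof. exact: (dotr_CS winv_mfun winv_gt0). Qed.

Lemma trig_cos_L2W b N : L2W (trig_cos b N).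
Proof. by apply: chebspan_L2W; exists b, N. Qed.

Lemma coefE u n : coef u n * chebh n = dotW u (chebyshevT n).
Proof. by rewrite /coef divfK// gt_eqF// chebh_gt0. Qed.

Lemma dotW_trig_cos u b N : L2W u ->
  dotW u (trig_cos b N) = \sum_(0 <= n < N) b n * (coef u n * chebh n).
Proof.
move=> Lu; elim: N => [|N IH].
  rewrite big_geq// /dotW; under eq_Rintegral do rewrite /trig_cos big_geq// !mulr0.
  by rewrite Rintegral_cst ?mul0r//; exact: mOm.
rewrite big_nat_recr//= -IH coefE.
have LT := chebyshevT_L2W (R := R) N; have LS := trig_cos_L2W b N.
rewrite -dotW_sym [dotW u (trig_cos b N)]dotW_sym [dotW u (chebyshevT N)]dotW_sym.
rewrite -(dotWZl (b N) LT Lu) -(dotWDl LS (L2WZ (b N) LT) Lu).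
by congr dotW; apply/funext => x; rewrite /trig_cos big_nat_recr.
Qed.

Lemma bessel u N : L2W u ->
  dotW (fun x => u x - trig_cos (coef u) N x) (fun x => u x - trig_cos (coef u) N x) <= dotW u u.
Proof.
move=> Lu; have LS := trig_cos_L2W (coef u) N.
rewrite dotW_subsq// dotW_trig_cos//.
have -> : dotW (trig_cos (coef u) N) (trig_cos (coef u) N) =
    \sum_(0 <= n < N) coef u n * coef u n * chebh n.
  by rewrite -trig_cos_dot; apply: eq_Rintegral => x _; rewrite mulrA.
set A := \sum_(_ <= _ < _) _; set A' := \sum_(_ <= _ < _) _.
have AA : A = A' by apply: eq_bigr => n _; rewrite mulrA.
have A0 : 0 <= A'.
  by apply: sumr_ge0 => n _; rewrite mulr_ge0 ?(ltW (chebh_gt0 n))// -expr2 sqr_ge0.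
by rewrite AA; lra.
Qed.

Lemma bessel_orthogonal u b M N : L2W u -> (M <= N)%N ->
  dotW (fun x => u x - trig_cos (coef u) N x) (trig_cos b M) = 0.
Proof.
move=> Lu MN; have LS := trig_cos_L2W (coef u) N; have LM := trig_cos_L2W b M.
rewrite dotWBl// dotW_trig_cos//.
have -> : dotW (trig_cos (coef u) N) (trig_cos b M) = \sum_(0 <= n < M) b n * (coef u n * chebh n).
  have -> : dotW (trig_cos (coef u) N) (trig_cos b M) =
      \int[mu]_(x in Om) (winv x * trig_cos (coef u) N x * trig_cos (fun n => if (n < M)%N then b n else 0) N x).
    by apply: eq_Rintegral => x _; rewrite trig_cos_widen// mulrA.
  rewrite trig_cos_dot (big_cat_nat (n := M))//= [X in _ + X]big_nat_cond [X in _ + X]big1 => [|n /andP[/andP[Mn _] _]].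
    by rewrite addr0; apply: eq_big_nat => n /andP[_ nM]; rewrite nM; ring.
  by rewrite ltnNge Mn/= mulr0 mul0r.
by rewrite subrr.
Qed.

(** Only [chi] has to be approximable. The remainder of [u] is orthogonal to the approximant [p]
    once N reaches its order, so the error is at most |u| |chi - p|. *)
Lemma parseval u chi : L2W u -> L2W chi ->
  (forall e, 0 < e -> exists2 p, chebspan p & dotW (fun x => chi x - p x) (fun x => chi x - p x) <= e) ->
  \sum_(0 <= n < N) coef u n * dotW chi (chebyshevT n) @[N --> \oo] --> dotW u chi.
Proof.
move=> Lu Lc approx; apply/cvgrPdist_le => e e0.
(* The 1 keeps [K] positive when [u] is zero. *)
pose K := Num.sqrt (dotW u u) + 1.
have K0 : 0 < K by rewrite ltr_wpDl ?sqrtr_ge0.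
have [|p sp hp] := approx ((e / K) ^+ 2); first by rewrite exprn_gt0// divr_gt0.
have [b [M pb]] := sp; have Lp := chebspan_L2W sp.
exists M => // N /= MN.
have LS := trig_cos_L2W (coef u) N.
have Lr := L2WB Lu LS; have Lcp := L2WB Lc Lp.
have -> : dotW u chi - \sum_(0 <= n < N) coef u n * dotW chi (chebyshevT n) =
    dotW (fun x => u x - trig_cos (coef u) N x) (fun x => chi x - p x).
  rewrite dotWBr//.
  have -> : dotW (fun x => u x - trig_cos (coef u) N x) p = 0.
    rewrite -(bessel_orthogonal b Lu MN); apply: eq_Rintegral => x; rewrite inE => xO.
    by rewrite pb.
  rewrite subr0; rewrite dotWBl//; congr (_ - _).
  rewrite [RHS]dotW_sym dotW_trig_cos//.
  by apply: eq_bigr => n _; rewrite coefE.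
apply: le_trans (dotW_CS Lr Lcp) _.
apply: (@le_trans _ _ (K * (e / K))); last by rewrite mulrCA divff ?mulr1// gt_eqF.
apply: ler_pM; rewrite ?sqrtr_ge0//.
  by apply: (@le_trans _ _ (Num.sqrt (dotW u u))); [rewrite ler_wsqrtr// bessel|rewrite lerDl].
by rewrite -[e / K]ger0_norm ?divr_ge0 ?(ltW e0) ?(ltW K0)// -sqrtr_sqr ler_wsqrtr.
Qed.

Lemma right_of_integral a h : Om a -> 
  \int[mu]_(x in Om) (winv x * (right_of a x * h x)) = \int[mu]_(x in `]a, 1[) (winv x * h x).
Proof.
rewrite OmE => /andP[a1 a2].
have sub : `]a, 1[ `<=` Om.
  by move=> x; rewrite /= in_itv OmE/= => /andP[h1 h2]; lra.
rewrite (Rintegral_supp sub).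
  apply: eq_Rintegral => x; rewrite inE/= in_itv/= => /andP[ax _].
  by rewrite /right_of ax mul1r.
move=> x; rewrite OmE => /andP[_ x1]; rewrite /= in_itv/= x1 andbT => /negP/negbTE.
by rewrite /right_of => ->; rewrite mul0r mulr0.
Qed.

Lemma right_of_cheb a n : Om a -> dotW (right_of a) (chebyshevT n) =
  if n is 0 then acos a else sin (n%:R * acos a) / n%:R.
Proof.
move=> aO; have := aO; rewrite OmE => /andP[a1 a2].
rewrite /dotW -/winv right_of_integral//.
have sub x : x \in `]a, 1[ -> Om x.
  by rewrite in_itv OmE/= => /andP[h1 h2]; lra.
have key (G : R -> R) : (forall y : R, is_derive y 1 G (cos (n%:R * y))) ->
    \int[mu]_(x in `]a, 1[) (winv x * chebyshevT n x) = G (acos a) - G 0.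
  move=> dG; have cG : continuous G by move=> y; exact: is_derive_continuous.
  transitivity (- G 0 - - G (acos a)); last by rewrite opprK addrC.
  apply: (@improper_FTC _ _ (fun x => - G (acos x))) => //.
  - apply: (@intgS _ Om); [exact: mOm|exact: measurable_itv|by move=> x /sub|].
    by apply: (@intgW _ _ 1) => [|x _]; [exact: chebyshevT_mfun|exact: chebyshevT_bound].
  - move=> x /sub xO; apply: cvgM; first exact: winv_continuous.
    exact: chebyshevT_continuous.
  - move=> x /sub xO; have -> : winv x * chebyshevT n x = - (cos (n%:R * acos x) * - winv x).
      by rewrite /chebyshevT; ring.
    by apply: is_deriveN; apply: (@is_derive1_comp _ G (@acos R)); exact: is_derive_acos.
  - apply: cvg_at_right_filter; apply: cvgN.
    by apply: (@cvg_continuous _ _ _ _ (@acos R)) => //; exact: acos_continuous.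
  - by apply: cvgN; apply: (@cvg_continuous _ _ _ _ (@acos R)) => //; exact: acos_cvg1.
case: n key => [|n] key.
  have d0 (y : R) : is_derive y 1 id (cos (0%:R * y)) by rewrite mul0r cos0; exact: is_derive_id.
  by have := key _ d0; rewrite subr0.
have d1 (y : R) : is_derive y 1 (fun z => n.+1%:R^-1 * sin (n.+1%:R * z)) (cos (n.+1%:R * y)).
  have -> : cos (n.+1%:R * y) = n.+1%:R^-1 * (n.+1%:R * cos (n.+1%:R * y)).
    by rewrite mulKf// pnatr_eq0.
  by apply: is_deriveZ; exact: is_derive_sin_mul.
by have := key _ d1; rewrite mulr0 sin0 mulr0 subr0 mulrC.
Qed.

(* The integral of u(cos r) over 0 < r < s. *)
Definition cumul u s := \int[mu]_(x in `]cos s, 1[) (winv x * u x).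

Lemma cos_Om s : 0 < s < pi -> Om (cos s) /\ acos (cos s) = s.
Proof.
move=> /andP[s0 spi]; split; last by rewrite cosK// in_itv/= !ltW.
rewrite OmE -cospi -cos0 !ltr_cos ?in_itv/= ?lexx ?pi_ge0 ?(ltW s0) ?(ltW spi)//.
by rewrite s0 spi.
Qed.

(** Parseval with the step at cos s, whose inner products with the T_n are s for n = 0 and sin (n s)
    / n otherwise. The summand of index 0 is 0, and the linear term stands apart. *)
Lemma cumul_series u s : L2W u -> 0 < s < pi ->
  coef u 0 * s + \sum_(0 <= n < N) coef u n * sin (n%:R * s) / n%:R @[N --> \oo] --> cumul u s.
Proof.
move=> Lu spi; have [cO cs] := cos_Om spi.
have -> : cumul u s = dotW u (right_of (cos s)).
  rewrite /cumul -right_of_integral//; apply: eq_Rintegral => x _.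
  by rewrite /winv; ring.
have h := parseval Lu (right_of_L2W (cos s)) (right_of_approx cO).
have E N : \sum_(0 <= n < N.+1) coef u n * dotW (right_of (cos s)) (chebyshevT n) =
    coef u 0 * s + \sum_(0 <= n < N.+1) coef u n * sin (n%:R * s) / n%:R.
  rewrite !(big_nat_recl N)//= right_of_cheb// cs mul0r sin0 mulr0 mul0r add0r.
  by congr (_ + _); apply: eq_bigr => n _; rewrite right_of_cheb// cs mulrA.
move: h; rewrite -cvg_shiftS => h; rewrite -cvg_shiftS; apply: cvg_trans h.
by apply: near_eq_cvg; apply: nearW => N; rewrite /= E.
Qed.

End Parseval.

(** * Unique continuation *)

Section Tents.
Context {R : realType}.
Implicit Types (f g u psi : R -> R) (x a s : R).
Local Notation mu := (@lebesgue_measure R).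
Local Notation Om := (@Omega R).

Lemma lt_cos_acos x s : Om x -> 0 < s < pi -> (x < cos s) = (s < acos x).
Proof.
move=> xO /andP[s0 spi]; have /andP[a0 api] := acos_Om xO.
by rewrite -{1}(acosK_Om xO) ltr_cos// in_itv/= !ltW.
Qed.

Lemma gt_cos_acos x s : Om x -> 0 < s < pi -> (cos s < x) = (acos x < s).
Proof.
move=> xO /andP[s0 spi]; have /andP[a0 api] := acos_Om xO.
by rewrite -{1}(acosK_Om xO) ltr_cos// in_itv/= !ltW.
Qed.

Lemma arc_integral (G g : R -> R) (s1 s2 : R) : 0 < s1 -> s1 < s2 -> s2 < pi ->
  continuous g -> (forall y : R, is_derive y 1 G (g y)) ->
  \int[mu]_(x in `[cos s2, cos s1]) (winv x * g (acos x)) = G s2 - G s1.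
Proof.
move=> s10 s12 s2pi cg dG.
have s1I : 0 < s1 < pi by rewrite s10 (lt_trans s12).
have s2I : 0 < s2 < pi by rewrite s2pi (lt_trans s10).
have [q1 a1] := cos_Om s1I; have [q2 a2] := cos_Om s2I.
have c12 : cos s2 < cos s1 by rewrite lt_cos_acos// a2.
have sub x : x \in `[cos s2, cos s1] -> Om x.
  move: q1 q2; rewrite !OmE in_itv/= => /andP[_ h1] /andP[h2 _] /andP[h3 h4].
  by rewrite (lt_le_trans h2)//= (le_lt_trans h4).
transitivity (- G (acos (cos s1)) - - G (acos (cos s2))); last by rewrite a1 a2 opprK addrC.
apply: (@RFTC2 _ _ (fun x => - G (acos x))); first exact: ltW.
  apply: within_continuous => x /sub xO; apply: cvgM; first exact: winv_continuous.
  by apply: (@cvg_continuous _ _ _ _ (@acos R)) => //; exact: acos_continuous.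
move=> x /sub xO; have -> : winv x * g (acos x) = - (g (acos x) * - winv x) by ring.
by apply: is_deriveN; apply: (@is_derive1_comp _ G (@acos R)); exact: is_derive_acos.
Qed.

(* The positive part of dl - |s - al|. *)
Definition tentf (al dl s : R) : R := 2^-1 * ((dl - `|s - al|) + `|dl - `|s - al| |).
Definition tent (al dl x : R) : R := tentf al dl (acos x).
(** The integral of (dl - |r|)^+ cos (n r) over the line for n >= 1; n^2 [tau] is also minus the
    multiplier of the second difference of step dl. At [n = 0] the value is 0, which is harmless
    because it is used with a factor n. *)
Definition tau (dl : R) (n : nat) : R := 2 * (1 - cos (n%:R * dl)) / n%:R ^+ 2.

Lemma tentf_continuous al dl : continuous (tentf al dl).
Proof.
move=> s; have c1 : (fun z => dl - `|z - al|) @ s --> dl - `|s - al|.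
  apply: cvgB; first exact: cvg_cst.
  by apply: cvg_norm; apply: cvgB; [exact: cvg_id|exact: cvg_cst].
by apply: cvgMr; apply: cvgD => //; apply: cvg_norm.
Qed.

Lemma tentf_out al dl s : dl <= `|s - al| -> tentf al dl s = 0.
Proof. by rewrite /tentf => h; rewrite (@ler0_norm _ (dl - _)) ?subr_le0//; ring. Qed.

Lemma tentf_in al dl s : `|s - al| <= dl -> tentf al dl s = dl - `|s - al|.
Proof. by rewrite /tentf => h; rewrite (@ger0_norm _ (dl - _)) ?subr_ge0//; field. Qed.

Lemma tentf_bound al dl s : 0 <= dl -> `|tentf al dl s| <= dl.
Proof.
move=> dl0; have [h|h] := leP `|s - al| dl.
  by rewrite tentf_in// ger0_norm ?subr_ge0// lerBlDr lerDl.
by rewrite tentf_out ?(ltW h)// normr0.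
Qed.

Lemma tent_L2W (al dl : R) : 0 <= dl -> L2W (tent al dl).
Proof.
move=> dl0; apply: (@bounded_L2r _ _ _ dl); [exact: winv_intg| |].
  by apply: acos_mfun; exact: tentf_continuous.
by move=> x _; exact: tentf_bound.
Qed.

Lemma tent_dot (al dl : R) n : 0 < dl -> 0 < al - dl -> al + dl < pi ->
  dotW (tent al dl) (chebyshevT n.+1) = cos (n.+1%:R * al) * tau dl n.+1.
Proof.
move=> dl0 aldl aldlpi; set k : R := n.+1%:R.
have k0 : k != 0 by rewrite pnatr_eq0.
have s1I : 0 < al - dl < pi by lra.
have s2I : 0 < al < pi by lra.
have s3I : 0 < al + dl < pi by lra.
have [q1 a1] := cos_Om s1I; have [q2 a2] := cos_Om s2I; have [q3 a3] := cos_Om s3I.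
pose w x := winv x * (tent al dl x * chebyshevT n.+1 x).
have wi : intg Om w.
  by apply: (L2r_mul winv_mfun winv_gt0); [apply: tent_L2W; exact: ltW|exact: chebyshevT_L2W].
have c32 : cos (al + dl) < cos al by rewrite lt_cos_acos// a3; lra.
have c21 : cos al < cos (al - dl) by rewrite lt_cos_acos// a2; lra.
have sub x : x \in `[cos (al + dl), cos (al - dl)] -> Om x.
  move: q1 q3; rewrite !OmE in_itv/= => /andP[_ h1] /andP[h2 _] /andP[h3 h4].
  by rewrite (lt_le_trans h2)//= (le_lt_trans h4).
have -> : dotW (tent al dl) (chebyshevT n.+1) = \int[mu]_(x in `[cos (al + dl), cos (al - dl)]) w x.
  rewrite /dotW -/Om; apply: Rintegral_supp; first by move=> x /sub.
  move=> x xO; rewrite /= in_itv/= => /negP; rewrite negb_and -!ltNge => h.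
  rewrite /tent tentf_out ?mul0r ?mulr0//.
  move: h; rewrite lt_cos_acos// gt_cos_acos// => /orP[h|h].
    by rewrite ger0_norm; lra.
  by rewrite ler0_norm; lra.
have wi' : intg `[cos (al + dl), cos (al - dl)] w.
  by apply: (@intgS _ Om) => //; exact: mOm.
have := @Rintegral_itvB _ w (BLeft (cos (al + dl))) (BRight (cos (al - dl))) (cos al) wi'.
rewrite !bnd_simp (ltW c32) (ltW c21) => /(_ isT isT).
rewrite Rintegral_itv_obnd_cbnd; last first.
  apply: (@intgS _ `[cos (al + dl), cos (al - dl)]) => //.
  by apply: subset_itv; rewrite bnd_simp// ltW.
move=> /eqP; rewrite subr_eq => /eqP ->.
have cc : continuous (fun y : R => cos (k * y)) by move=> y; exact: cos_mul_continuous.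
(* The hat has a kink at [al], so each half gets its own primitive, found by parts. *)
pose G1 s := (s - al + dl) * (k^-1 * sin (k * s)) + k^-2 * cos (k * s).
pose G2 s := (al + dl - s) * (k^-1 * sin (k * s)) - k^-2 * cos (k * s).
have dsin s : is_derive s 1 (fun s => k^-1 * sin (k * s)) (cos (k * s)).
  have -> : cos (k * s) = k^-1 * (k * cos (k * s)) by rewrite mulKf.
  by apply: is_deriveZ; exact: is_derive_sin_mul.
have dcos s : is_derive s 1 (fun s => k^-2 * cos (k * s)) (- (k^-1 * sin (k * s))).
  have -> : - (k^-1 * sin (k * s)) = k^-2 * - (k * sin (k * s)) by field.
  by apply: is_deriveZ; exact: is_derive_cos_mul.
have dl1 s : is_derive s 1 (fun s => s - al + dl) 1.
  have := is_derive_affine 1 (- al + dl) s.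
  by under eq_fun do rewrite mul1r addrA.
have dl2 s : is_derive s 1 (fun s => al + dl - s) (-1).
  have := is_derive_affine (-1) (al + dl) s.
  by under eq_fun do rewrite mulN1r addrC.
have dG1 s : is_derive s 1 G1 ((s - al + dl) * cos (k * s)).
  have h := is_deriveD (is_deriveM (dl1 s) (dsin s)) (dcos s).
  by apply: (@is_derive_eq _ _ _ G1 _ _ _ _ h); rewrite /GRing.scale/=; ring.
have dG2 s : is_derive s 1 G2 ((al + dl - s) * cos (k * s)).
  have h := is_deriveB (is_deriveM (dl2 s) (dsin s)) (dcos s).
  by apply: (@is_derive_eq _ _ _ G2 _ _ _ _ h); rewrite /GRing.scale/=; ring.
have cl1 : continuous (fun s => (s - al + dl) * cos (k * s)).
  by move=> s; apply: cvgM; [exact: is_derive_continuous (dl1 s)|exact: cc].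
have cl2 : continuous (fun s => (al + dl - s) * cos (k * s)).
  by move=> s; apply: cvgM; [exact: is_derive_continuous (dl2 s)|exact: cc].
have -> : \int[mu]_(x in `[cos al, cos (al - dl)]) w x = G1 al - G1 (al - dl).
  rewrite -(arc_integral aldl _ _ cl1 dG1); [|lra|lra].
  apply: eq_Rintegral => x; rewrite inE => xI.
  have xO : Om x.
    by apply: sub; move: xI; rewrite /= !in_itv/= => /andP[h1 h2]; apply/andP; split => //; lra.
  rewrite /w; congr (_ * (_ * _)).
  move: xI; rewrite /= in_itv/= !leNgt lt_cos_acos// gt_cos_acos// -!leNgt => /andP[h1 h2].
  by rewrite /tent tentf_in ler0_norm; lra.
have -> : \int[mu]_(x in `[cos (al + dl), cos al]) w x = G2 (al + dl) - G2 al.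
  rewrite -(arc_integral _ _ aldlpi cl2 dG2); [|lra|lra].
  apply: eq_Rintegral => x; rewrite inE => xI.
  have xO : Om x.
    by apply: sub; move: xI; rewrite /= !in_itv/= => /andP[h1 h2]; apply/andP; split => //; lra.
  rewrite /w; congr (_ * (_ * _)).
  move: xI; rewrite /= in_itv/= !leNgt lt_cos_acos// gt_cos_acos// -!leNgt => /andP[h1 h2].
  by rewrite /tent tentf_in ger0_norm; lra.
rewrite /G1 /G2 /tau -/k mulrBr mulrDr cosB cosD sinB sinD; field.
by rewrite addrC natr1; exact: k0.
Qed.

Lemma tau_bound dl n : 0 <= tau dl n <= 4 / n%:R ^+ 2.
Proof.
rewrite /tau; have := cos_le1 (n%:R * dl); have := cos_geN1 (n%:R * dl) => h1 h2.
apply/andP; split; first by rewrite divr_ge0 ?exprn_ge0// mulr_ge0// subr_ge0.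
by rewrite ler_wpM2r ?invr_ge0 ?exprn_ge0//; lra.
Qed.

(** Telescoping with 1 / n^2 <= 1 / (n - 1) - 1 / n; the term of index 0 is 0 because the inverse of
    0 is 0. *)
Lemma sum_inv_sq N : \sum_(0 <= n < N) (n%:R ^+ 2)^-1 <= 2 :> R.
Proof.
case: N => [|[|N]]; first by rewrite big_geq.
  by rewrite big_nat1 expr0n/= invr0.
suff : \sum_(0 <= n < N.+2) (n%:R ^+ 2)^-1 <= 2 - N.+1%:R^-1 :> R.
  by move=> /le_trans; apply; rewrite lerBlDr lerDl invr_ge0.
elim: N => [|N IH].
  by rewrite !big_nat_recr//= big_geq// expr0n/= invr0 expr1n invr1; lra.
rewrite big_nat_recr//=; apply: (le_trans (lerD IH (lexx _))).
have p1 : 0 < N.+1%:R :> R by rewrite ltr0n.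
have p2 : 0 < N.+2%:R :> R by rewrite ltr0n.
have e1 : N.+2%:R = N.+1%:R + 1 :> R by rewrite -natr1.
have h : (N.+2%:R ^+ 2)^-1 <= N.+1%:R^-1 - N.+2%:R^-1 :> R.
  have -> : N.+1%:R^-1 - N.+2%:R^-1 = (N.+1%:R * N.+2%:R)^-1 :> R.
    by move: p1 p2; rewrite e1; move: (N.+1%:R : R) => z p1 p2; field; rewrite !gt_eqF.

  by rewrite lef_pV2 ?posrE ?mulr_gt0// expr2 ler_pM2r// ler_nat.
by rewrite -addrA lerD2l -lerBrDl opprK [leRHS]addrC.
Qed.

Lemma chebh_ge1 n : 1 <= chebh n :> R.
Proof. by have := @pi_ge2 R; case: n => [|n] /=; lra. Qed.

(** n tau_n^2 = O(n^-3), weakened to n^-2 so that [sum_inv_sq] sums it both for the norm of the hat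
    and for the c_n. *)
Lemma tau_term dl n : n%:R * (tau dl n * tau dl n) <= 16 * (n%:R ^+ 2)^-1.
Proof.
case: n => [|n]; first by rewrite mul0r expr0n/= invr0 mulr0.
have /andP[t0 t1] := tau_bound dl n.+1; set k : R := n.+1%:R in t0 t1 *.
have k1 : 1 <= k by rewrite ler1n.
have k0 : 0 < k by lra.
apply: (@le_trans _ _ (k * (4 / k ^+ 2 * (4 / k ^+ 2)))).
  by rewrite ler_pM2l// ler_pM.
have -> : k * (4 / k ^+ 2 * (4 / k ^+ 2)) = 16 * (k ^+ 2)^-1 * k^-1 by field; rewrite gt_eqF.
rewrite ler_piMr ?invf_le1//.
by rewrite mulr_ge0// invr_ge0 exprn_ge0// ltW.
Qed.

Lemma tent_coef (al dl : R) n : 0 < dl -> 0 < al - dl -> al + dl < pi ->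
  n%:R * (coef (tent al dl) n * chebh n) = n%:R * (cos (n%:R * al) * tau dl n).
Proof.
move=> h1 h2 h3; case: n => [|n]; first by rewrite !mul0r.
by rewrite coefE tent_dot.
Qed.

Lemma tent_Hs (al dl : R) : 0 < dl -> 0 < al - dl -> al + dl < pi -> Hs (tent al dl).
Proof.
move=> h1 h2 h3; split; first by apply: tent_L2W; exact: ltW.
exists (16 * 2) => N; apply: (@le_trans _ _ (16 * \sum_(0 <= n < N) (n%:R ^+ 2)^-1)); last first.
  by rewrite ler_pM2l// sum_inv_sq.
rewrite mulr_sumr; apply: ler_sum => n _.
case: n => [|n]; first by rewrite !mul0r expr0n/= invr0 mulr0.
have hn := chebh_gt0 (R := R) n.+1; have hn1 := chebh_ge1 n.+1.
have e : coef (tent al dl) n.+1 = cos (n.+1%:R * al) * tau dl n.+1 / chebh n.+1.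
  by rewrite /coef tent_dot.
apply: le_trans (tau_term dl n.+1).
rewrite e; set C := cos _; set t := tau _ _; set k : R := n.+1%:R; set h := chebh _ in hn hn1 *.
have -> : k * (C * t / h) * (C * t / h) * h = k * (t * t) * (C ^+ 2 / h) by field; rewrite gt_eqF.
rewrite ler_piMr//; first by rewrite mulr_ge0// -expr2 sqr_ge0.
rewrite ler_pdivrMr// mul1r; apply: le_trans hn1.
by rewrite -[1](expr1n _ 2) -[C ^+ 2]real_normK ?num_real// lerXn2r ?nnegrE// cos_bound.
Qed.

End Tents.

Section UniqueContinuation.
Context {R : realType}.
Implicit Types (f g u psi : R -> R) (x a s : R).
Local Notation mu := (@lebesgue_measure R).
Local Notation Om := (@Omega R).

Lemma L2W_intg u : L2W u -> intg Om (fun x => winv x * u x).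
Proof.
move=> Lu; have := L2r_mul winv_mfun winv_gt0 Lu (chebyshevT_L2W 0).
apply: eq_intg; first exact: mOm.
by move=> x _; rewrite chebyshevT0 mulr1.
Qed.

Lemma cos_itv_Om (s : R) x : 0 < s < pi -> x \in `]cos s, 1[ -> Om x.
Proof.
move=> /cos_Om[]; rewrite !OmE in_itv/= => /andP[h1 h2] _ /andP[h3 ->].
by rewrite (lt_trans h1).
Qed.

Lemma cumulB u (s1 s2 : R) : L2W u -> 0 < s1 -> s1 <= s2 -> s2 < pi ->
  cumul u s2 - cumul u s1 = \int[mu]_(x in `]cos s2, cos s1]) (winv x * u x).
Proof.
move=> Lu s10 s12 s2pi.
have s1I : 0 < s1 < pi by rewrite s10 (le_lt_trans s12).
have s2I : 0 < s2 < pi by rewrite s2pi (lt_le_trans s10).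
have [q1 a1] := cos_Om s1I; have [q2 a2] := cos_Om s2I.
have i2 : intg `]cos s2, 1[ (fun x => winv x * u x).
  apply: (@intgS _ Om) => //; first exact: mOm.
    by move=> x; exact: cos_itv_Om.
  exact: L2W_intg.
have := @Rintegral_itvB _ _ (BRight (cos s2)) (BLeft 1) (cos s1) i2.
rewrite !bnd_simp; have -> : cos s2 <= cos s1 by rewrite leNgt gt_cos_acos// a2 -leNgt.
have -> : cos s1 < 1 by move: q1; rewrite OmE => /andP[].
by move=> /(_ isT isT) h; rewrite /cumul -h opprB addrC subrK.
Qed.

Lemma cumul_const u (a b s1 s2 : R) : L2W u -> 0 < a -> b < pi ->
  {ae mu, forall x, Om x -> a < acos x < b -> u x = 0} ->
  s1 \in `]a, b[ -> s2 \in `]a, b[ -> cumul u s1 = cumul u s2.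
Proof.
move=> Lu a0 bpi u0.
wlog s12 : s1 s2 / s1 <= s2 => [H|].
  by have [h|h] := leP s1 s2 => i1 i2; [exact: H|rewrite (H s2 s1)// ltW].
rewrite !in_itv/= => /andP[as1 s1b] /andP[as2 s2b].
have s1I : 0 < s1 < pi by lra.
have s2I : 0 < s2 < pi by lra.
have [q1 a1] := cos_Om s1I; have [q2 a2] := cos_Om s2I.
apply/esym/eqP; rewrite -subr_eq0 cumulB//; [|lra|lra].
have sub x : x \in `]cos s2, cos s1] -> Om x.
  move: q1 q2; rewrite !OmE in_itv/= => /andP[_ h1] /andP[h2 _] /andP[h3 h4].
  by rewrite (lt_trans h2)//= (le_lt_trans h4).
apply/eqP; transitivity (\int[mu]_(x in `]cos s2, cos s1]) (0 : R)); last first.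
  by rewrite Rintegral_cst ?mul0r.
apply: Rintegral_ae => //.
  apply: intg_measurable; apply: (@intgS _ Om) => //; first exact: mOm.
  exact: L2W_intg.
apply: aeS u0 => x H xI; have xO := sub _ xI.
rewrite H ?mulr0//; move: xI; rewrite /= in_itv/= leNgt !gt_cos_acos// -leNgt.
by move=> /andP[h1 h2]; lra.
Qed.

Lemma tent_out (al dl : R) x : ~~ (al - dl < acos x < al + dl) -> tent al dl x = 0.
Proof.
rewrite negb_and -!leNgt => h; apply: tentf_out.
by case/orP: h => h; [rewrite distrC|]; apply: (le_trans _ (ler_norm _)); lra.
Qed.

Lemma tau_neq0 (dl : R) n : (0 < n)%N -> 0 < dl -> n%:R * dl <= pi -> tau dl n != 0.
Proof.
move=> n0 d0 ndl; have n0' : 0 < n%:R :> R by rewrite ltr0n.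
have nd0 : 0 < n%:R * dl by rewrite mulr_gt0.
rewrite /tau gt_eqF// divr_gt0 ?exprn_gt0// mulr_gt0// subr_gt0 -[ltRHS]cos0.
by rewrite ltr_cos// in_itv/= ?lexx ?pi_ge0// ltW.
Qed.

Section Vanishing.
Variables (u : R -> R) (a b : R).
Hypotheses (Hu : Hs u) (a0 : 0 < a) (ab : a < b) (bpi : b < pi).
Hypothesis u0 : {ae mu, forall x, Om x -> a < acos x < b -> u x = 0}.
Hypothesis pu0 : forall psi, Hs psi ->
  (forall x, Om x -> ~~ (a < acos x < b) -> psi x = 0) -> pa u psi = 0.

Let c dl n := n%:R * coef u n * tau dl n.

Lemma sin_series_cvg0 (dl al : R) : 0 < dl -> a < al - dl -> al + dl < b ->
  \sum_(0 <= n < N) c dl n * sin (n%:R * al) @[N --> \oo] --> (0 : R).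
Proof.
have a0' := a0; have bpi' := bpi; move=> dl0 h1 h2; have [Lu _] := Hu.
pose S s N : R := coef u 0 * s + \sum_(0 <= n < N) coef u n * sin (n%:R * s) / n%:R.
have cS s : s \in `]a, b[ -> S s N @[N --> \oo] --> cumul u al.
  move=> sab; rewrite -(cumul_const Lu a0 bpi u0 sab); last by rewrite in_itv/=; lra.
  by apply: cumul_series => //; move: sab; rewrite in_itv/= => /andP[? ?]; lra.
(* Minus the second difference of step [dl]: the linear terms cancel, and (2 - 2 cos (n dl)) / n = n
   tau_n. The three nodes lie in []a, b[], where the limit is the same. *)
have -> : (fun N => \sum_(0 <= n < N) c dl n * sin (n%:R * al)) =
    (fun N => 2 * S al N - (S (al + dl) N + S (al - dl) N)).
  apply/funext => N; rewrite /S; elim: N => [|N]; first by rewrite !big_geq//; ring.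
  rewrite !(big_nat_recr N)//= => ->; rewrite /c /tau (mulrBr N%:R) (mulrDr N%:R) sinD sinB.
  case: N => [|N]; first by rewrite !mul0r sin0 invr0; ring.
  by field; rewrite addrC natr1 pnatr_eq0.
have -> : (0 : R) = 2 * cumul u al - (cumul u al + cumul u al) by ring.
apply: cvgB; first by apply: cvgMr; apply: cS; rewrite in_itv/=; lra.
by apply: cvgD; apply: cS; rewrite in_itv/=; lra.
Qed.

Lemma cos_series_cvg0 (dl al : R) : 0 < dl -> a < al - dl -> al + dl < b ->
  \sum_(0 <= n < N) c dl n * cos (n%:R * al) @[N --> \oo] --> (0 : R).
Proof.
have a0' := a0; have bpi' := bpi; move=> dl0 h1 h2.
have Ht : Hs (tent al dl) by apply: tent_Hs; lra.
have e : pa u (tent al dl) = 0.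
  apply: pu0 => // x xO /negP h; apply: tent_out; apply/negP => /andP[h3 h4]; apply: h.
  by lra.
have -> : (fun N => \sum_(0 <= n < N) c dl n * cos (n%:R * al)) = pA u (tent al dl).
  apply/funext => N; apply: eq_bigr => n _.
  transitivity (coef u n * (n%:R * (coef (tent al dl) n * chebh n))); last by ring.
  by rewrite tent_coef//; [rewrite /c; ring|lra|lra].
by rewrite -e; exact: Hs_cvg.
Qed.

(** From |v t| <= v^2 + t^2: n u_n^2 is summed by the H^{1/2} bound, since [chebh n >= 1], and n
    tau_n^2 by [tau_term]. *)
Lemma c_summable dl : exists B, forall N, \sum_(0 <= n < N) `|c dl n| <= B.
Proof.
have [_ [B hB]] := Hu; exists (B + 16 * 2) => N.
apply: (@le_trans _ _ (pA u u N + 16 * \sum_(0 <= n < N) (n%:R ^+ 2)^-1)); last first.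
  by rewrite lerD// ler_pM2l// sum_inv_sq.
rewrite mulr_sumr -big_split/=; apply: ler_sum => n _.
apply: le_trans (lerD (lexx _) (tau_term dl n)).
rewrite /c; set v := coef u n; set t := tau dl n.
have h1 : `|v * t| <= v * v + t * t.
  have q1 := sqr_ge0 (v - t); have q2 := sqr_ge0 (v + t); have q3 := sqr_ge0 v; have q4 := sqr_ge0 t.
  by rewrite ler_norml; lra.
have hn := chebh_ge1 (R := R) n; have v0 : 0 <= v * v by rewrite -expr2 sqr_ge0.
have h2 : v * v <= v * v * chebh n by rewrite ler_peMr.
have n0 : 0 <= n%:R :> R by [].
rewrite -mulrA normrM (ger0_norm n0).
have -> : n%:R * v * v * chebh n + n%:R * (t * t) = n%:R * (v * v * chebh n + t * t) by ring.
by rewrite ler_wpM2l//; lra.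
Qed.

Lemma coef_vanish n : coef u n.+1 = 0.
Proof.
have a0' := a0; have bpi' := bpi; have ab' := ab.
have n0 : 0 < n.+1%:R :> R by rewrite ltr0n.
(* The first bound leaves the arc []a + dl, b - dl[] nonempty; the second makes [tau dl n.+1]
   nonzero, at this one index. *)
pose dl := Num.min ((b - a) / 4) (pi / n.+1%:R) : R.
have dl0 : 0 < dl by rewrite lt_min !divr_gt0//; [exact: pi_gt0|lra].
have dl1 : dl <= (b - a) / 4 by rewrite ge_min lexx.
have dl2 : n.+1%:R * dl <= pi by rewrite mulrC -ler_pdivlMr// ge_min lexx orbT.
have [B hB] := c_summable dl.
have := @circle_uniqueness R (c dl) B (a + dl) (b - dl) hB _ _ _ _ n.+1.
have -> : 0 <= a + dl by lra.
have -> : a + dl < b - dl by lra.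
move=> /(_ isT isT) H; have : c dl n.+1 = 0.
  apply: H => t /andP[h1 h2]; [apply: cos_series_cvg0 => //; lra|apply: sin_series_cvg0 => //; lra].
move/eqP; rewrite /c mulf_eq0 [tau _ _ == 0]negbTE ?tau_neq0// orbF mulf_eq0 pnatr_eq0/=.
by move/eqP.
Qed.

Lemma cumul_affine s : 0 < s < pi -> cumul u s = coef u 0 * s.
Proof.
move=> sI; have [Lu _] := Hu; apply/esym; apply: (cvg_unique _ _ (cumul_series Lu sI)) => //.
have -> : (fun N => coef u 0 * s + \sum_(0 <= n < N) coef u n * sin (n%:R * s) / n%:R) =
    (fun=> coef u 0 * s).
  apply/funext => N; rewrite big1 ?addr0// => -[|n] _; first by rewrite mul0r sin0 mulr0 mul0r.
  by rewrite coef_vanish !mul0r.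
exact: cvg_cst.
Qed.

(** The primitive is linear in [s] and takes equal values at two points of the arc, so its slope
    [coef u 0] is 0. *)
Lemma cumul_vanish s : 0 < s < pi -> cumul u s = 0.
Proof.
have a0' := a0; have bpi' := bpi; have ab' := ab; have [Lu _] := Hu.
move=> sI; rewrite cumul_affine//.
pose s1 := (2 * a + b) / 3; pose s2 := (a + 2 * b) / 3.
have h1 : s1 \in `]a, b[ by rewrite in_itv/= /s1; lra.
have h2 : s2 \in `]a, b[ by rewrite in_itv/= /s2; lra.
have := cumul_const Lu a0 bpi u0 h1 h2; move: h1 h2; rewrite !in_itv/= => /andP[? ?] /andP[? ?].
rewrite !cumul_affine; try by lra.
move=> /eqP; rewrite -subr_eq0 -mulrBr mulf_eq0 => /orP[/eqP ->|]; first by rewrite mul0r.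
by rewrite /s1 /s2 => /eqP; lra.
Qed.

(** The primitive vanishes everywhere, so [u] does almost everywhere by Lebesgue differentiation;
    completeness of the T_n for general [u] is not invoked. *)
Lemma unique_continuation : eq_ae_Omega u (fun=> 0).
Proof.
have [Lu _] := Hu; apply: ae_Omega => c0 d c1 cd d1.
have wi : intg `[c0, d] (fun x => winv x * u x).
  apply: (@intgS _ Om) => //; [exact: mOm| |exact: L2W_intg].
  by move=> x; rewrite OmE /= in_itv/= => /andP[h1 h2]; lra.
have cO x : c0 <= x -> x <= d -> Om x by move=> h1 h2; rewrite OmE; lra.
have : {ae mu, forall x, x \in `]c0, d[ -> winv x * u x = 0}.
  apply: (ae_eq0_of_itv wi) => x; rewrite in_itv/= => /andP[h1 h2].
  have xO : Om x by apply: cO; exact: ltW.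
  have c0O : Om c0 by apply: cO => //; exact: ltW.
  have axc : acos x < acos c0 by rewrite -gt_cos_acos ?acosK_Om ?acos_Om.
  rewrite -Rintegral_itv_obnd_cbnd; last first.
    by apply: (@intgS _ `[c0, d]) => //; apply: subset_itv; rewrite bnd_simp// ltW.
  have /andP[i1 i2] := acos_Om xO; have /andP[i3 i4] := acos_Om c0O.
  have := cumulB Lu i1 (ltW axc) i4; rewrite !acosK_Om// => <-.
  by rewrite !cumul_vanish ?subrr ?acos_Om.
apply: aeS => x H xI; have /eqP := H xI; rewrite mulf_eq0 gt_eqF ?winv_gt0//.
  by move=> /eqP.
by move: xI; rewrite in_itv/= => /andP[h1 h2]; apply: cO; exact: ltW.
Qed.

End Vanishing.

End UniqueContinuation.

(** * From a vanishing rectangle to vanishing time slices *)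

Section LocalVanishing.
Context {R : realType}.
Local Notation mu := (@lebesgue_measure R).
Local Notation Om := (@Omega R).

Lemma ae_continuous_eq0 (h : R -> R) (c d : R) :
  (forall s, s \in `]c, d[ -> {for s, continuous h}) ->
  {ae mu, forall s, s \in `]c, d[ -> h s = 0} -> forall s, s \in `]c, d[ -> h s = 0.
Proof.
move=> ch h0 s sI; apply/eqP/negPn/negP => hs.
have : \forall y \near s, h y != 0 /\ y \in `]c, d[.
  apply: filterI; last exact: near_in_itvoo.
  exact: (cvgr_neq0 _ (ch _ sI)).
move=> /nbhs_ballP[e /= e0 he]; have [A [mA A0 sub]] := h0.
have iA : `]s - e, s + e[ `<=` A.
  move=> y; rewrite /= in_itv/= => /andP[h1 h2]; apply: sub => /= h3.
  have [|/eqP h4 h5] := he y; last by apply: h4; exact: h3.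
  by rewrite /ball/= ltr_norml; lra.
have : (mu `](s - e)%R, (s + e)%R[ <= mu A)%E by apply: le_measure => //; rewrite inE.
rewrite A0 lebesgue_measure_itv/= lte_fin; have -> : s - e < s + e by lra.
by rewrite lee_fin; lra.
Qed.

Context (T : R) (f : R -> R) (phi phi_t : R -> R -> R).
Context (f_lip : exists k : R, k.-lipschitz f)
  (f_bound : exists c : R, 0 < c /\ forall x : R, `|f x| <= c * `|x|)
  (phi_C : continuous_into inH sqnormH T phi)
  (phi_t_C : continuous_into inL2 sqnormL2 T phi_t)
  (phi_phi_t : is_time_derivative T phi phi_t)
  (phi_weak : weak_equation T f phi).
Context (t1 t2 x1 x2 : R).
Hypotheses (tsub : `]t1, t2[ `<=` `]0, T[) (xsub : `]x1, x2[ `<=` Om).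
Hypothesis phi0 : {ae mu, forall t, t \in `]t1, t2[ ->
  {ae mu, forall x, x \in `]x1, x2[ -> phi t x = 0}}.

(** From almost every time to every time: if [q] is phi(t) cut off outside the interval, (phi(s), q)
    is continuous in s and 0 for almost every s, and at s = t it is the squared norm of [q]. *)
Lemma phi_ae0 t : t \in `]t1, t2[ -> {ae mu, forall x, x \in `]x1, x2[ -> phi t x = 0}.
Proof.
move=> tI; have tT := tsub tI.
pose q x := \1_(`]x1, x2[ : set (measurableTypeR R)) x * phi t x.
have Lp := phi_L2 phi_C tT; have [mp ip] := Lp.
have mq : mfun Om q by apply: measurable_funM => //; exact: measurable_indic.
have q2 x : phi t x * q x = q x * q x.
  by rewrite /q indicE; case: (_ \in _); rewrite ?mul0r ?mulr0 ?mul1r.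
have Lq : L2 q.
  split => //; apply: (le_intg mOm _ ip).
    by apply: measurable_funM; [exact: one_mfun|exact: measurable_funM].
  move=> x _; rewrite /one !mul1r ger0_norm -?expr2 ?sqr_ge0// /q indicE.
  by case: (_ \in _); rewrite ?mul1r// mul0r expr0n/= sqr_ge0.
have : dotL2 (phi t) q = 0.
  apply: (@ae_continuous_eq0 (fun s => dotL2 (phi s) q) t1 t2) tI => [s sI|].
    exact: is_derive_continuous (is_derive_dotL2_phi phi_C phi_t_C phi_phi_t (tsub sI) Lq).
  apply: aeS phi0 => s H sI; rewrite dotL2E; apply: (dotr_ae0 one_mfun) => //.
    apply: aeS (H sI) => x h xO; rewrite /q indicE.
    case: (boolP (x \in _)) => xI; last by rewrite mul0r mulr0.
    by rewrite h ?mul0r//; move: xI; rewrite inE.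
  by have [] := phi_L2 phi_C (tsub sI).
have -> : dotL2 (phi t) q = dotL2 q q by apply: eq_Rintegral => x _; exact: q2.
rewrite dotL2E => /(dotr_eq0 one_gt0 Lq); apply: aeS => x h xI.
have := h (xsub xI); rewrite /q indicE (_ : x \in _) ?mul1r//; exact: mem_set.
Qed.

(** (phi, psi) and then (phi_t, psi) vanish on the time interval, and so does (f(phi), psi) because
    the growth bound gives f(0) = 0; the equation leaves only the pairing. *)
Lemma pa_phi_eq0 t psi : t \in `]t1, t2[ -> Hs psi ->
  (forall x, Om x -> x \notin `]x1, x2[ -> psi x = 0) -> pa (phi t) psi = 0.
Proof.
move=> tI Hpsi psi0; have Lpsi : L2 psi by have [/L2W_L2] := Hpsi.
have f0 : f 0 = 0.
  have [c [_ /(_ 0)]] := f_bound; rewrite normr0 mulr0 normr_le0; exact: eqP.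
have dot0 (g : R -> R) : mfun Om g -> {ae mu, forall x, x \in `]x1, x2[ -> g x = 0} ->
    dotL2 g psi = 0.
  move=> mg g0; rewrite dotL2E; apply: (dotr_ae0 one_mfun) => //; last by have [] := Lpsi.
  apply: aeS g0 => x h xO; have [/h ->|/(psi0 _ xO) ->] := boolP (x \in `]x1, x2[).
    by rewrite mul0r.
  by rewrite mulr0.
have phi_0 s : s \in `]t1, t2[ -> dotL2 (phi s) psi = 0.
  by move=> sI; apply: dot0 (phi_ae0 sI); have [] := phi_L2 phi_C (tsub sI).
have deriv0 (h : R -> R) s l : (forall y, y \in `]t1, t2[ -> h y = 0) -> s \in `]t1, t2[ ->
    is_derive s 1 h l -> l = 0.
  move=> h0 sI dh; have d0 : is_derive s 1 h 0.
    apply: (@near_eq_is_derive _ R R (fun=> 0) h s 1 0 _ (is_derive_cst 0 s 1)).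
    by apply: filterS (near_in_itvoo sI) => y yI; rewrite h0.
  by have [_ <-] := dh; have [_ ->] := d0.
have phit_0 s : s \in `]t1, t2[ -> dotL2 (phi_t s) psi = 0.
  move=> sI; apply: (deriv0 _ s _ phi_0 sI).
  exact: (is_derive_dotL2_phi phi_C phi_t_C phi_phi_t (tsub sI) Lpsi).
have := deriv0 _ _ _ phit_0 tI
  (is_derive_dotL2_phi_t f_lip f_bound phi_C phi_t_C phi_phi_t phi_weak (tsub tI) Hpsi).
rewrite dot0 ?sub0r; first by move/eqP; rewrite oppr_eq0 => /eqP.
  by have [] := f_phi_L2 f_lip f_bound phi_C (tsub tI).
by apply: aeS (phi_ae0 tI) => x h xI; rewrite /= h.
Qed.

Lemma phi_eq0 t : -1 < x1 -> x1 < x2 -> x2 < 1 -> t \in `]t1, t2[ -> eq_ae_Omega (phi t) (fun=> 0).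
Proof.
move=> x1N x12 x21 tI.
have q1 : Om x1 by rewrite OmE x1N (lt_trans x12).
have q2 : Om x2 by rewrite OmE x21 (lt_trans x1N).
have /andP[a0 _] := acos_Om q2; have /andP[_ bpi] := acos_Om q1.
have iE x : Om x -> (acos x2 < acos x < acos x1) = (x \in `]x1, x2[).
  move=> xO; rewrite -lt_cos_acos// ?acos_Om// -gt_cos_acos ?acos_Om//.
  by rewrite !acosK_Om// in_itv/= andbC.
apply: (@unique_continuation _ _ (acos x2) (acos x1)) => //.
- exact: phi_Hs phi_C _ (tsub tI).
- by rewrite -gt_cos_acos ?acos_Om// acosK_Om.
- by apply: aeS (phi_ae0 tI) => x h xO; rewrite iE.
- move=> psi Hpsi psi0; apply: pa_phi_eq0 => // x xO; rewrite -iE//; exact: psi0.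
Qed.

End LocalVanishing.

Theorem proposition1 (R : realType) (T : R) (phi0 phi1 f : R -> R)
    (phi : R -> R -> R) (M : set (R * R))
    (T_gt0 : 0 < T)
    (phi0_H : inH phi0) (phi1_L2 : inL2 phi1)
    (f_lip : exists k : R, k.-lipschitz f)
    (f_bound : exists c : R, 0 < c /\ forall x : R, `|f x| <= c * `|x|)
    (phi_sol : is_solution T f phi0 phi1 phi)
    (M_open : open M) (M_neq0 : M !=set0)
    (M_sub : M `<=` `]0, T[ `*` Omega)
    (phi_M : vanishes_on M phi) :
  forall t : R, t \in `]0, T[ -> eq_ae_Omega (phi t) (fun _ => 0).
Proof.
have [phi_t [phi_C phi_t_C phi_phi_t _ phi_weak]] := phi_sol.
have [[t0 x0] Mtx] := M_neq0.
have /nbhs_ballP[r /= r0 rM] : nbhs (t0, x0) M by exact: open_nbhs_nbhs.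
have box s y : s \in `]t0 - r, t0 + r[ -> y \in `]x0 - r, x0 + r[ -> M (s, y).
  rewrite !in_itv/= => /andP[h1 h2] /andP[h3 h4]; apply: rM; split => /=;
    by rewrite /ball/= ltr_norml; lra.
have t0I : t0 \in `]t0 - r, t0 + r[ by rewrite in_itv/=; lra.
have x0I : x0 \in `]x0 - r, x0 + r[ by rewrite in_itv/=; lra.
have tsub : `]t0 - r, t0 + r[ `<=` `]0, T[.
  by move=> s sI; have [] := M_sub _ (box s x0 sI x0I).
have xO y : y \in `]x0 - r, x0 + r[ -> Omega y by move=> yI; have [] := M_sub _ (box t0 y t0I yI).
(* Half the radius puts the end points themselves in Omega, as [phi_eq0] needs for an arc strictly
   inside (0, pi). *)
pose x1 := x0 - r / 2; pose x2 := x0 + r / 2.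
have xsub y : y \in `]x1, x2[ -> y \in `]x0 - r, x0 + r[.
  by rewrite !in_itv/= /x1 /x2 => /andP[h1 h2]; lra.
have x1O : Omega x1 by apply: xO; rewrite in_itv/= /x1; lra.
have x2O : Omega x2 by apply: xO; rewrite in_itv/= /x2; lra.
have phi_ae : {ae @lebesgue_measure R, forall s, s \in `]t0 - r, t0 + r[ ->
    {ae @lebesgue_measure R, forall x, x \in `]x1, x2[ -> phi s x = 0}}.
  apply: aeS phi_M => s H sI; apply: aeS H => x h xI; apply: h; apply: box => //; exact: xsub.
have zero s : s \in `]t0 - r, t0 + r[ -> dotL2 (phi s) (phi s) = 0.
  move=> sI.
  have : eq_ae_Omega (phi s) (fun=> 0).
    apply: (@phi_eq0 _ T f phi phi_t _ _ _ _ _ _ (t0 - r) (t0 + r) x1 x2) => //.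
    - by move=> y yI; apply: xO; exact: xsub.
    - by move: x1O; rewrite OmE => /andP[].
    - by rewrite /x1 /x2; lra.
    - by move: x2O; rewrite OmE => /andP[].
  have [mp _] := phi_L2 phi_C (tsub _ sI).
  move=> p0; rewrite dotL2E; apply: (dotr_ae0 one_mfun) => //.
  by apply: aeS p0 => x h xO'; rewrite h ?mul0r.
have d0 : zero_data T phi phi_t t0.
  apply: zero_data_of_near => //; first exact: tsub.
  by apply: filterS (near_in_itvoo t0I) => s; exact: zero.
move=> t tT; have Lp := phi_L2 phi_C tT; apply: (dotr_eq0 one_gt0 Lp).
rewrite -dotL2E.
exact: (zero_data_propagates f_lip f_bound phi_C phi_t_C phi_phi_t phi_weak d0).
Qed.
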